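(* Let $n\ge2$, let $\mathcal{S}$ be a compact topological hypersurface which is the boundary of a Jordan domain in $\mathbb{R}^n$, and let $g\in C^{0,\nu}(\mathcal{S})$ be $\mathcal{C}\ell(n)$-valued, $0<\nu\le1$. If $$\nu>1-\frac{\mathfrak{m}(\mathcal{S})}{n},$$ then the scalar additive Jump problem $$\Phi^+(\underline{x})-\Phi^-(\underline{x})=g(\underline{x}),\qquad \underline{x}\in\mathcal{S},$$ is solvable.
   Context: $\mathcal{C}\ell(n)$ is the real unital associative Clifford algebra generated by the standard orthonormal basis $e_1,\dots,e_n$ of $\mathbb{R}^n$ with $e_ie_j+e_je_i=-2\delta_{ij}$, with the Euclidean norm in the basis $e_A=e_{\beta_1}\cdots e_{\beta_k}$, $A=\{\beta_1<\dots<\beta_k\}\subseteq\{1,\dots,n\}$. The Dirac operator is $\partial_n=\sum_{j=1}^n e_j\,\partial/\partial x^j$; a $C^1$ function $u$ on an open subset of $\mathbb{R}^n$ with values in $\mathcal{C}\ell(n)$ is (left) monogenic if $\partial_nu=0$. $C^{0,\nu}(\mathcal{S})$ ($0<\nu\le 1$) is the set of functions $f$ on $\mathcal{S}$ with $|f(x)-f(y)|\le M|x-y|^\nu$ for all $x,y\in\mathcal{S}$, some $M$. $\Omega^+$ denotes the (bounded) Jordan domain bounded by $\mathcal{S}$ and $\Omega^-=\mathbb{R}^n\setminus(\Omega^+\cup\mathcal{S})$ the unbounded complement. $\mathcal{S}$ may be fractal. Scalar additive Jump problem: given $g$, find a function $\Phi$ monogenic on $\mathbb{R}^n\setminus\mathcal{S}$,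 continuously extendable from $\Omega^\pm$ to $\mathcal{S}$, whose boundary values $\Phi^\pm$ on $\mathcal{S}$ (from $\Omega^\pm$) satisfy $\Phi^+-\Phi^-=g$ on $\mathcal{S}$, and with $\Phi(\infty):=\lim_{|\underline x|\to\infty}\Phi(\underline x)=c$ for a given constant $c\in\mathcal{C}\ell(n)$. Solvable means that such a $\Phi$ exists. Marcinkiewicz exponent: for a bounded set $D\subset\mathbb{R}^n$ not meeting $\mathcal{S}$ put $I_p(D)=\int_D \mathrm{dist}(x,\mathcal{S})^{-p}\,dV(x)$. Let $\Omega^*=\Omega^-\cap\{|x|<r\}$ with $r$ such that $\mathcal{S}$ lies inside the ball of radius $r$ (the choice is immaterial). Then $\mathfrak{m}^+(\mathcal{S})=\sup\{p: I_p(\Omega^+)<\infty\}$, $\mathfrak{m}^-(\mathcal{S})=\sup\{p: I_p(\Omega^* )<\infty\}$, and $\mathfrak{m}(\mathcal{S})=\max\{\mathfrak{m}^+(\mathcal{S}),\mathfrak{m}^-(\mathcal{S})\}$. *)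

(* Defs.v *)
From HB Require Import structures.
From mathcomp Require Import all_boot all_order all_algebra.
From mathcomp Require Import ring.
From mathcomp Require Import all_classical all_reals all_analysis.
Import Order.TTheory GRing.Theory Num.Theory.
Import numFieldNormedType.Exports.

Set Implicit Arguments.
Unset Strict Implicit.
Unset Printing Implicit Defensive.

Local Open Scope classical_set_scope.
Local Open Scope ring_scope.

Definition l2norm (R : realType) (I : finType) (f : I -> R) : R :=
  Num.sqrt (\sum_i f i ^+ 2).

Section L2norm.
Variables (R : realType) (I : finType).
Implicit Types f g : I -> R.

Let sum_sqr_ge0 f : 0 <= \sum_i f i ^+ 2.
Proof. by apply: sumr_ge0 => i _; exact: sqr_ge0. Qed.

Lemma l2norm_ge0 f : 0 <= l2norm f.
Proof. exact: sqrtr_ge0. Qed.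

Lemma l2norm_eq0 f : l2norm f = 0 -> forall i, f i = 0.
Proof.
move=> /eqP; rewrite sqrtr_eq0 => f0 i; apply/eqP.
have /eqP : \sum_i f i ^+ 2 = 0 by apply/le_anti; rewrite f0 sum_sqr_ge0.
by rewrite psumr_eq0 => [/allP/(_ i (mem_index_enum _))|j _];
  rewrite ?sqrf_eq0 // sqr_ge0.
Qed.

Lemma l2normZ (a : R) f : l2norm (fun i => a * f i) = `|a| * l2norm f.
Proof.
rewrite /l2norm -sqrtr_sqr -sqrtrM ?sqr_ge0 // mulr_sumr; congr Num.sqrt.
by apply: eq_bigr => i _; rewrite exprMn.
Qed.

Lemma l2norm_CauchySchwarz f g : \sum_i f i * g i <= l2norm f * l2norm g.
Proof.
rewrite -sqrtrM ?sum_sqr_ge0 //; apply: le_trans (ler_norm _) _.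
rewrite -sqrtr_sqr ler_sqrt ?mulr_ge0 ?sum_sqr_ge0 // -subr_ge0.
suff : 0 <= ((\sum_i f i ^+ 2) * (\sum_i g i ^+ 2) - (\sum_i f i * g i) ^+ 2) *+ 2.
  by rewrite pmulrn_lge0.
have -> : ((\sum_i f i ^+ 2) * (\sum_i g i ^+ 2) - (\sum_i f i * g i) ^+ 2) *+ 2
        = \sum_i \sum_j (f i * g j - f j * g i) ^+ 2.
  have -> : \sum_i \sum_j (f i * g j - f j * g i) ^+ 2 =
      \sum_i \sum_j (f i ^+ 2 * g j ^+ 2) + \sum_i \sum_j (f j ^+ 2 * g i ^+ 2)
      - (\sum_i \sum_j (f i * g i) * (f j * g j)) *+ 2.
    rewrite -sumrMnl -sumrN -!big_split; apply: eq_bigr => i _ /=.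
    rewrite -sumrMnl -sumrN -!big_split; apply: eq_bigr => j _ /=.
    by ring.
  have sumM (a b : I -> R) :
      \sum_i \sum_j a i * b j = (\sum_i a i) * (\sum_i b i).
    by rewrite mulr_suml; apply: eq_bigr => i _; rewrite mulr_sumr.
  rewrite [X in _ = _ + X - _]exchange_big /= !sumM.
  by rewrite expr2; ring.
by apply: sumr_ge0 => i _; apply: sumr_ge0 => j _; exact: sqr_ge0.
Qed.

Lemma ler_l2normD f g : l2norm (fun i => f i + g i) <= l2norm f + l2norm g.
Proof.
rewrite -[leRHS]ger0_norm ?addr_ge0 ?l2norm_ge0 // -sqrtr_sqr.
rewrite ler_sqrt ?sqr_ge0 // sqrrD !sqr_sqrtr ?sum_sqr_ge0 //.
under eq_bigr do rewrite sqrrD.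
rewrite !big_split /= lerD2r lerD2l -mulr2n lerMn2r /=.
exact: l2norm_CauchySchwarz.
Qed.

End L2norm.

(* An element is its family of coordinates in the basis (e_A), A <= {1..n}.   *)
Definition clifford (R : realType) (n : nat) : Type := {ffun {set 'I_n} -> R}.

HB.instance Definition _ (R : realType) n :=
  GRing.Lmodule.copy (clifford R n) {ffun {set 'I_n} -> R}.

Section Clifford.
Variables (R : realType) (n : nat).
Implicit Types (A B C : {set 'I_n}) (u v w : clifford R n) (i j : 'I_n).

Definition coord A u : R := (u : {ffun {set 'I_n} -> R}) A.

Definition symdiff A B : {set 'I_n} := ((A :\: B) :|: (B :\: A))%SET.

(* e_A e_B = cliff_sign A B *: e_(symdiff A B): sorting the generators of     *)
(* e_A e_B costs a factor -1 for each pair j < i with i in A and j in B, and  *)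
(* each common generator contributes e_i ^+ 2 = -1.                           *)
Definition cliff_sign A B : R :=
  \prod_(i in A) \prod_(j in B) (-1) ^+ (j <= i)%N.

Definition cliff_mul u v : clifford R n :=
  [ffun C => \sum_A \sum_(B | symdiff A B == C)
     cliff_sign A B * (coord A u * coord B v)].

Definition cliff_basis A : clifford R n := [ffun B => (B == A)%:R].

Let in_symdiff i A B : (i \in symdiff A B) = (i \in A) (+) (i \in B).
Proof. by rewrite !inE; case: (i \in A); case: (i \in B). Qed.

Let symdiffA : associative symdiff.
Proof. by move=> A B C; apply/setP => i; rewrite !in_symdiff addbA. Qed.

Let symdiffC : commutative symdiff.
Proof. by move=> A B; apply/setP => i; rewrite !in_symdiff addbC. Qed.

Let symdiffK A : involutive (symdiff A).
Proof. by move=> B; apply/setP => i; rewrite !in_symdiff addbA addbb. Qed.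

Let symdiff_eq A B C : (symdiff A B == C) = (B == symdiff A C).
Proof. by apply/eqP/eqP => [<-|->]; rewrite symdiffK. Qed.

Let symdiff0 A : symdiff A finset.set0 = A.
Proof. by apply/setP => i; rewrite in_symdiff inE addbF. Qed.

Let sqr_sign (b : bool) : ((-1) ^+ b * (-1) ^+ b : R) = 1.
Proof. by rewrite -expr2 sqrr_sign. Qed.

Let cliff_signDl A B C :
  cliff_sign (symdiff A B) C = cliff_sign A C * cliff_sign B C.
Proof.
rewrite /cliff_sign big_mkcond [in RHS]big_mkcond [X in _ = _ * X]big_mkcond.
rewrite -big_split; apply: eq_bigr => i _ /=; rewrite in_symdiff.
case: (i \in A); case: (i \in B); rewrite /= ?mulr1 ?mul1r//.
by rewrite -big_split big1 // => j _; exact: sqr_sign.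
Qed.

Let cliff_signDr A B C :
  cliff_sign A (symdiff B C) = cliff_sign A B * cliff_sign A C.
Proof.
rewrite /cliff_sign -big_split; apply: eq_bigr => i _ /=.
rewrite big_mkcond [in RHS]big_mkcond [X in _ = _ * X]big_mkcond.
rewrite -big_split; apply: eq_bigr => j _ /=.
by rewrite in_symdiff; case: (j \in B); case: (j \in C); rewrite /= ?mulr1 ?mul1r.
Qed.

Lemma cliff_mulE u v C : coord C (cliff_mul u v) =
  \sum_A cliff_sign A (symdiff A C) * (coord A u * coord (symdiff A C) v).
Proof.
rewrite /coord ffunE; apply: eq_bigr => A _.
by rewrite (big_pred1 (symdiff A C)) // => B; rewrite /= symdiff_eq.
Qed.

Lemma coordP u v : (forall A, coord A u = coord A v) -> u = v.
Proof. by move=> uv; apply/ffunP => A; exact: uv. Qed.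

Lemma coordD A u v : coord A (u + v) = coord A u + coord A v.
Proof. by rewrite /coord ffunE. Qed.

Lemma coordZ A (a : R) u : coord A (a *: u) = a * coord A u.
Proof. by rewrite /coord ffunE. Qed.

Lemma coord_basis A B : coord A (cliff_basis B) = (A == B)%:R.
Proof. by rewrite /coord ffunE. Qed.

Let cliff_mulA : associative cliff_mul.
Proof.
move=> u v w; apply: coordP => D; rewrite !cliff_mulE.
under eq_bigr => A _ do rewrite cliff_mulE 2!mulr_sumr.
under [RHS]eq_bigr => C _ do rewrite cliff_mulE mulr_suml mulr_sumr.
rewrite [RHS]exchange_big /=; apply: eq_bigr => A _.
rewrite [RHS](reindex_inj (can_inj (symdiffK A))) /=; apply: eq_bigr => B _.
have -> : symdiff (symdiff A B) D = symdiff B (symdiff A D).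
  by rewrite symdiffA (symdiffC B).
rewrite symdiffK; move: (coord (symdiff B _) w) => c.
rewrite cliff_signDl !cliff_signDr.
have -> : forall s a b d e t x y : R, s * s = 1 ->
    s * (a * b) * (d * (e * t)) * (s * (x * y) * c) =
    a * b * (x * (d * (e * t) * (y * c))).
  by move=> s a b d e t x y s1; transitivity (s * s *
    (a * b * (x * (d * (e * t) * (y * c))))); [ring | rewrite s1 mul1r].
by [].
rewrite /cliff_sign -big_split big1 //= => i _.
by rewrite -big_split big1 // => j _; exact: sqr_sign.
Qed.

Let cliff_mul1 : left_id (cliff_basis finset.set0) cliff_mul.
Proof.
move=> u; apply: coordP => C; rewrite cliff_mulE (bigD1 finset.set0) //= big1.
  rewrite coord_basis eqxx mul1r addr0 /cliff_sign big_set0 mul1r.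
  by rewrite symdiffC symdiff0.
by move=> A /negPf A0; rewrite coord_basis A0 mul0r mulr0.
Qed.

Let cliff_mulr1 : right_id (cliff_basis finset.set0) cliff_mul.
Proof.
move=> u; apply: coordP => C; rewrite cliff_mulE (bigD1 C) //= big1.
  have -> : symdiff C C = finset.set0.
    by apply/setP => i; rewrite in_symdiff addbb inE.
  rewrite coord_basis eqxx mulr1 addr0 /cliff_sign.
  by under eq_bigr do rewrite big_set0; rewrite big1_eq mul1r.
move=> A AC; rewrite coord_basis [_ == _](_ : _ = false) ?mulr0 //.
apply/eqP => AC0; move/eqP: AC; apply.
by rewrite -[C](symdiffK A) AC0 symdiff0.
Qed.

Let cliff_mulDl : left_distributive cliff_mul +%R.
Proof.
move=> u v w; apply: coordP => C; rewrite coordD !cliff_mulE -big_split.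
by apply: eq_bigr => A _; rewrite coordD mulrDl mulrDr.
Qed.

Let cliff_mulDr : right_distributive cliff_mul +%R.
Proof.
move=> u v w; apply: coordP => C; rewrite coordD !cliff_mulE -big_split.
by apply: eq_bigr => A _; rewrite coordD !mulrDr.
Qed.

Let cliff_basis_neq0 : cliff_basis finset.set0 != 0.
Proof.
apply/eqP => /(congr1 (coord finset.set0)); rewrite coord_basis eqxx.
by rewrite /coord ffunE => /eqP; rewrite oner_eq0.
Qed.

HB.instance Definition _ := GRing.Zmodule_isNzRing.Build (clifford R n)
  cliff_mulA cliff_mul1 cliff_mulr1 cliff_mulDl cliff_mulDr cliff_basis_neq0.

Let cliff_scaleAl (a : R) u v : a *: (u * v) = (a *: u) * v.
Proof.
apply: coordP => C; rewrite coordZ !cliff_mulE mulr_sumr.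
by apply: eq_bigr => A _; rewrite coordZ; ring.
Qed.

Let cliff_scaleAr (a : R) u v : a *: (u * v) = u * (a *: v).
Proof.
apply: coordP => C; rewrite coordZ !cliff_mulE mulr_sumr.
by apply: eq_bigr => A _; rewrite coordZ; ring.
Qed.

HB.instance Definition _ := GRing.Lmodule_isLalgebra.Build R (clifford R n)
  cliff_scaleAl.
HB.instance Definition _ := GRing.Lalgebra_isAlgebra.Build R (clifford R n)
  cliff_scaleAr.

Lemma cliff_basisM A B :
  cliff_basis A * cliff_basis B = cliff_sign A B *: cliff_basis (symdiff A B).
Proof.
apply: coordP => C; rewrite cliff_mulE coordZ coord_basis (bigD1 A) //= big1.
  rewrite !coord_basis eqxx mul1r addr0 symdiff_eq.
  by case: eqVneq => [->|_]; rewrite ?symdiffK ?mulr0.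
by move=> D /negPf DA; rewrite coord_basis DA mul0r mulr0.
Qed.

Lemma cliff_basis0 : cliff_basis finset.set0 = 1.
Proof. by []. Qed.

Definition cliff_gen i : clifford R n := cliff_basis [set i]%SET.

Let cliff_sign1 i B :
  cliff_sign [set i]%SET B = \prod_(j in B) (-1) ^+ (j <= i)%N.
Proof. by rewrite /cliff_sign big_set1. Qed.

Lemma cliff_genC i j : cliff_gen i * cliff_gen j + cliff_gen j * cliff_gen i =
  (- 2 * (i == j)%:R)%:A.
Proof.
rewrite !cliff_basisM (symdiffC [set j]%SET) -scalerDl !cliff_sign1 !big_set1.
case: eqVneq => [->|ij].
  have -> : symdiff [set j]%SET [set j]%SET = finset.set0.
    by apply/setP => k; rewrite in_symdiff addbb inE.
  by rewrite leqnn cliff_basis0; congr (_ *: _); rewrite /= expr1 mulr1; ring.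
by move: ij; rewrite -val_eqE /=; case: ltngtP => // _ _;
  rewrite expr0 expr1 mulr0 ?subrr ?addNr !scale0r.
Qed.

Lemma cliff_basisE A : cliff_basis A = \prod_(i <- enum A) cliff_gen i.
Proof.
have sA : sorted ltn (map val (enum A)).
  rewrite /(enum A) /enum_mem -enumT.
  rewrite sorted_map; apply: sorted_filter; first by move=> x y z; exact: ltn_trans.
  by rewrite -sorted_map val_enum_ord iota_ltn_sorted.
have -> : cliff_basis A = cliff_basis [set i in enum A]%SET.
  by congr cliff_basis; apply/setP => i; rewrite inE mem_enum.
elim: (enum A) sA => [_|i s IHs] /=.
  by rewrite big_nil -cliff_basis0; congr cliff_basis.
rewrite (path_sortedE ltn_trans) => /andP[/allP si /IHs IH].
rewrite big_cons -IH cliff_basisM cliff_sign1 big1 ?scale1r.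
  congr cliff_basis; apply/setP => k; rewrite in_symdiff !inE.
  case: eqVneq => //= ->; case: (boolP (i \in s)) => // /(map_f val) /si.
  by rewrite /= ltnn.
by move=> j; rewrite inE => /(map_f val) /si /=; rewrite ltnNge => /negPf ->.
Qed.

Definition cliff_norm u : R := l2norm (coord^~ u).

Let ler_cliff_normD u v : cliff_norm (u + v) <= cliff_norm u + cliff_norm v.
Proof.
have -> : cliff_norm (u + v) = l2norm (fun A => coord A u + coord A v).
  by congr l2norm; apply/funext => A; rewrite coordD.
exact: ler_l2normD.
Qed.

Let cliff_normZ (a : R) u : cliff_norm (a *: u) = `|a| * cliff_norm u.
Proof.
by rewrite -l2normZ; congr l2norm; apply/funext => A; rewrite coordZ.
Qed.

Let cliff_norm0_eq0 u : cliff_norm u = 0 -> u = 0.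
Proof.
by move=> /l2norm_eq0 u0; apply: coordP => A; rewrite u0 /coord ffunE.
Qed.

HB.instance Definition _ := Lmodule_isNormed.Build R (clifford R n)
  ler_cliff_normD cliff_normZ cliff_norm0_eq0.

Lemma cliff_normE u : `|u| = Num.sqrt (\sum_A coord A u ^+ 2).
Proof. by []. Qed.

End Clifford.

(* R^n carries the sigma-algebra generated by its coordinates, i.e. the Borel *)
(* sets; lebesgue_row below is the n-fold product of the measure on R.        *)
Section MeasurableRow.
Context d (T : measurableType d) (n : nat).

Let coords (i : 'I_n) (x : 'rV[T]_n) : T := x ord0 i.

Let row_set0 : g_sigma_preimage coords set0.
Proof. exact: sigma_algebra0. Qed.

Let row_setC A : g_sigma_preimage coords A -> g_sigma_preimage coords (~` A).
Proof. exact: sigma_algebraC. Qed.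

Let row_bigcup (F : (set 'rV[T]_n)^nat) :
  (forall i, g_sigma_preimage coords (F i)) ->
  g_sigma_preimage coords (\bigcup_i (F i)).
Proof. exact: sigma_algebra_bigcup. Qed.

HB.instance Definition _ := @isMeasurable.Build (measure_tuple_display d)
  'rV[T]_n (g_sigma_preimage coords) row_set0 row_setC row_bigcup.

Lemma measurable_coord (i : 'I_n) :
  measurable_fun setT (fun x : 'rV[T]_n => x ord0 i).
Proof.
move=> _ Y mY; rewrite setTI; apply: sub_sigma_algebra => /=.
rewrite -bigcup_seq/=; exists i => /=; first by rewrite mem_index_enum.
by exists Y => //; rewrite setTI.
Qed.

Lemma measurable_fun_rowP d' (T' : measurableType d') (f : T' -> 'rV[T]_n) :
  (forall i, measurable_fun setT (fun x => f x ord0 i)) -> measurable_fun setT f.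
Proof.
move=> mf; suff H : g_sigma_preimage (fun i x => f x ord0 i) `<=` measurable.
  have E : g_sigma_preimage (fun i x => f x ord0 i) =
           preimage_set_system setT f (g_sigma_preimage coords).
    exact: (g_sigma_preimage_comp coords f).
  by move=> _ A mA; apply: H; rewrite E; exists A.
apply: smallest_sub; first exact: sigma_algebra_measurable.
move=> A; rewrite -bigcup_seq => -[i _] [B mB <-].
exact: (mf i measurableT).
Qed.

End MeasurableRow.

Section LebesgueRow.
Variable R : realType.

Let cons_row n (p : 'rV[R]_n * R) : 'rV[R]_n.+1 :=
  \row_i oapp (p.1 ord0) p.2 (unlift ord0 i).

Let measurable_cons_row n : measurable_fun setT (@cons_row n).
Proof.
apply: measurable_fun_rowP => i.
case: (unliftP ord0 i) => [j ->|->].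
  rewrite (_ : (fun _ => _) = (fun x : 'rV[R]_n => x ord0 j) \o fst).
    by apply: measurableT_comp => //; exact: measurable_coord.
  by apply/funext => p; rewrite /= mxE liftK.
rewrite (_ : (fun _ => _) = snd) //.
by apply/funext => p; rewrite /= mxE unlift_none.
Qed.

Fixpoint lebesgue_row n : {measure set 'rV[R]_n -> \bar R} :=
  match n with
  | 0 => dirac (0 : 'rV[R]_0)
  | n'.+1 => measure_function_pushforward__canonical__measure_function_Measure
               (lebesgue_row n' \x lebesgue_measure)%E (@measurable_cons_row n')
  end.

Lemma lebesgue_row_box n (A : 'I_n -> set R) :
  (forall i, measurable (A i)) ->
  lebesgue_row n [set x | forall i, A i (x ord0 i)] =
  (\prod_(i < n) lebesgue_measure (A i))%E.
Proof.
elim: n A => [|n IHn] A mA.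
  rewrite big_ord0 /= diracE mem_set //= => i; by case: i.
have mbox : measurable [set x : 'rV[R]_n | forall i, A (lift ord0 i) (x ord0 i)].
  rewrite (_ : [set _ | _] = \bigcap_(i in (setT : set 'I_n))
      ((fun x : 'rV[R]_n => x ord0 i) @^-1` A (lift ord0 i))).
    apply: fin_bigcap_measurable; first exact: finite_finset.
    move=> i _; rewrite -[X in measurable X]setTI.
    exact: (@measurable_coord _ R n i measurableT).
  by apply/seteqP; split => x /= Ax i *; exact: Ax.
rewrite big_ord_recl /= /pushforward.
rewrite (_ : _ @^-1` _ =
  [set x : 'rV[R]_n | forall i, A (lift ord0 i) (x ord0 i)] `*` A ord0).
  rewrite product_measure1E; [|exact: mbox|exact: mA].
  rewrite muleC; congr (_ * _)%E.
  by apply: (IHn (fun i => A (lift ord0 i))) => i; exact: mA.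
apply/seteqP; split => [[x t] /= Axt|[x t] /= [Ax At] i].
  split => [i|]; first by have := Axt (lift ord0 i); rewrite mxE liftK.
  by have := Axt ord0; rewrite mxE unlift_none.
by rewrite mxE; case: (unliftP ord0 i) => [j ->|->].
Qed.

End LebesgueRow.

(* The library norm on 'rV[R]_n is the sup norm; it induces the usual         *)
(* topology, but distances below are Euclidean.                               *)
Definition enorm (R : realType) n (x : 'rV[R]_n) : R := l2norm (x ord0).

Definition edist (R : realType) n (x : 'rV[R]_n) (S : set 'rV[R]_n) : R :=
  inf [set enorm (x - y) | y in S].

Definition at_infinity (R : realType) n : set_system 'rV[R]_n :=
  filter_from setT (fun M : R => [set x | M < enorm x]).

Global Instance at_infinity_filter (R : realType) n :
  Filter (@at_infinity R n).
Proof.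
apply: filter_from_filter; first by exists 0.
move=> M N _ _; exists (Num.max M N) => // x /=.
by rewrite gt_max => /andP[].
Qed.

Definition homeomorphic (T U : topologicalType) (A : set T) (B : set U) :=
  exists (f : T -> U) (g : U -> T),
    [/\ set_bij A B f, {in A, cancel f g},
        {within A, continuous f} & {within B, continuous g}].

Definition topological_hypersurface (R : realType) n (S : set 'rV[R]_n) :=
  forall x, S x -> exists (U : set 'rV[R]_n) (V : set 'rV[R]_n.-1),
    [/\ open U, U x, open V & homeomorphic (S `&` U) V].

(* S is not required to be connected (nor a sphere), and its orientability is *)
(* automatic when it is a compact hypersurface of R^n.                        *)
Definition jordan_domain (R : realType) n (Omega S : set 'rV[R]_n) :=
  [/\ Omega !=set0, open Omega, connected Omega, bounded_set Omega &
      closure Omega `\` interior Omega = S].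

Definition exterior (R : realType) n (Omega S : set 'rV[R]_n) : set 'rV[R]_n :=
  ~` (Omega `|` S).

Definition dist_integral (R : realType) n (S : set 'rV[R]_n) (p : R)
    (D : set 'rV[R]_n) : \bar R :=
  (\int[lebesgue_row R n]_(x in D) (edist x S `^ (- p))%:E)%E.

Definition integrability_exponent (R : realType) n (S D : set 'rV[R]_n) : \bar R :=
  ereal_sup [set p%:E | p in [set p : R | (dist_integral S p D < +oo)%E]].

Definition marcinkiewicz_plus (R : realType) n (Omega S : set 'rV[R]_n) :=
  integrability_exponent S Omega.

(* r is any radius such that S lies in the ball of radius r: the exponent     *)
(* does not depend on it.                                                     *)
Definition marcinkiewicz_minus (R : realType) n (Omega S : set 'rV[R]_n) (r : R) :=
  integrability_exponent S (exterior Omega S `&` [set x | enorm x < r]).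

Definition marcinkiewicz (R : realType) n (Omega S : set 'rV[R]_n) (r : R) : \bar R :=
  Order.max (marcinkiewicz_plus Omega S) (marcinkiewicz_minus Omega S r).

Definition std_vec (R : realType) n (j : 'I_n) : 'rV[R]_n := delta_mx ord0 j.

(* Only meaningful for open U. *)
Definition C1_on (R : realType) n (U : set 'rV[R]_n)
    (u : 'rV[R]_n -> clifford R n) :=
  forall j x, U x ->
    derivable u x (std_vec R j) /\ {for x, continuous ('D_(std_vec R j) u)}.

Definition dirac_op (R : realType) n (u : 'rV[R]_n -> clifford R n)
    (x : 'rV[R]_n) : clifford R n :=
  \sum_(j < n) cliff_gen R j * 'D_(std_vec R j) u x.

Definition monogenic (R : realType) n (U : set 'rV[R]_n)
    (u : 'rV[R]_n -> clifford R n) :=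
  C1_on U u /\ forall x, U x -> dirac_op u x = 0.

Definition holder (R : realType) n (S : set 'rV[R]_n) (nu : R)
    (f : 'rV[R]_n -> clifford R n) :=
  exists M : R, forall x y, S x -> S y -> `|f x - f y| <= M * enorm (x - y) `^ nu.

(* Psi extends Phi continuously from Omega to S; its restriction to S is the  *)
(* boundary value of Phi from Omega.                                          *)
Definition boundary_extension (R : realType) n (Omega S : set 'rV[R]_n)
    (Phi Psi : 'rV[R]_n -> clifford R n) :=
  {in Omega, Psi =1 Phi} /\ {within Omega `|` S, continuous Psi}.

(* The values of Phi on S are irrelevant. *)
Definition additive_jump_solvable (R : realType) n (Omega S : set 'rV[R]_n)
    (g : 'rV[R]_n -> clifford R n) (c : clifford R n) :=
  exists Phi Phip Phim : 'rV[R]_n -> clifford R n,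
    [/\ monogenic (~` S) Phi,
        boundary_extension Omega S Phi Phip,
        boundary_extension (exterior Omega S) S Phi Phim,
        forall x, S x -> Phip x - Phim x = g x
      & Phi @ @at_infinity R n --> c].

(* Main.v *)
(* Let U be the side of S (Omega or its exterior) on which I_p is finite for some p > n (1 - nu).  McShane's
   formula extends the coordinates of g to functions on R^n that are Hölder of exponent nu at S; averaging them
   over balls of radius comparable to the distance d to S, after a cut-off to a thin layer of U along S, gives a
   function u that is C^1 off S, has boundary value g from U and vanishes on the other side, and satisfies
   |grad u| <= C d^(nu - 1).  Since d^(-p) is integrable on the layer, grad u behaves there like an element of
   L^q with q > n, so that the Cauchy transform v of the Dirac derivative of u is continuous on R^n and tends
   to 0 at infinity.  Then u - v is monogenic off S and has jump g.

   No singular integral is needed: v is the uniform limit of convolutions with C^1 kernels K_j that equal the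
   Cauchy kernel off the ball of radius 2^(-j).  Near a point x0 off S, u coincides with a C^1 function f of
   compact support.  The convolution of K_j with the Dirac derivative of f is that of f with the divergence of
   K_j, an approximate identity, and hence tends to f; the convolution of K_j with the difference of the Dirac
   derivatives of u and f, which vanishes near x0, is monogenic near x0. *)
Require Import Defs.
From HB Require Import structures.
From mathcomp Require Import all_boot all_order all_algebra.
From mathcomp Require Import ring lra.
From mathcomp Require Import all_classical all_reals all_analysis.
From mathcomp Require Import measurable_realfun.
Import Order.TTheory GRing.Theory Num.Theory.
Import numFieldNormedType.Exports.

Set Implicit Arguments.
Unset Strict Implicit.
Unset Printing Implicit Defensive.

Local Open Scope classical_set_scope.
Local Open Scope ring_scope.

(* mathcomp-analysis and vector.v export homonyms of these two definitions. *)
Local Notation edist := Defs.edist.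
Local Notation coord := Defs.coord.

(** * Lebesgue measure on row vectors *)

Section RowMeasure.
Context {R : realType}.

(** The obstacle is that S may be fractal: it need carry no surface measure, so the classical
    solution, the Cauchy integral of g over S, has no meaning, and the data must be moved into the
    volume. The condition on nu comes from there. For nu < 1 and q = p / (1 - nu), the bound C d^(nu
    - 1) on the gradient has q-th power C^q d^(-p), and q > n says exactly that p > n (1 - nu). The
    threshold is n because the Cauchy kernel has size |x|^(1 - n), whose powers are locally
    integrable only below n / (n - 1), the exponent conjugate to n. Since u vanishes on one side of
    S, integrability is required on the other side only, which is why the maximum of the two
    exponents enters. The data are treated one real coordinate at a time: u is then scalar, its
    Dirac derivative is a combination of generators with real coefficients, and the Clifford-valued
    solution is recovered by multiplying on the right with the basis elements. No sphere area
    occurs: the kernel is left unnormalised, and the integral of its smoothed divergence is divided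
    out at the end. *)

Lemma measurable_row_rect n (A : 'I_n -> set R) :
  (forall i, measurable (A i)) ->
  measurable [set x : 'rV[R]_n | forall i, A i (x ord0 i)].
Proof.
move=> mA.
rewrite (_ : [set _ | _] = \bigcap_(i in (setT : set 'I_n))
    ((fun x : 'rV[R]_n => x ord0 i) @^-1` A i)).
  apply: fin_bigcap_measurable; first exact: finite_finset.
  move=> i _; rewrite -[X in measurable X]setTI.
  exact: (@measurable_coord _ R n i measurableT).
by apply/seteqP; split => x /= Ax i *; exact: Ax.
Qed.

(** Sup-norm balls are boxes, so an open set is the union of the countably many boxes with rational
    centre and radius 1/(k + 1) that it contains; boxes are measurable for the product
    sigma-algebra. *)
Lemma open_measurable_row n (A : set 'rV[R]_n) : open A -> measurable A.
Proof.
move=> oA.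
pose B (p : 'rV[rat]_n * nat) : set 'rV[R]_n :=
  [set x | forall i, ball (ratr (p.1 ord0 i) : R) p.2.+1%:R^-1 (x ord0 i)].
have mB p : measurable (B p).
  apply: (@measurable_row_rect n (fun i => ball (ratr (p.1 ord0 i) : R) p.2.+1%:R^-1)).
  by move=> i; apply: open_measurable; exact: ball_open.
rewrite (_ : A = \bigcup_(p in [set p | B p `<=` A]) B p); last first.
  apply/seteqP; split => [x Ax|x [p /= BA] /BA//].
  have /nbhs_ballP[e /= e0 xeA] : nbhs x A by exact: open_nbhs_nbhs.
  pose k := Num.truncn (2 / e).
  have k0 : (0 : R) < k.+1%:R^-1 by rewrite invr_gt0.
  have kE : k.+1%:R^-1 < e / 2.
    by rewrite -[ltRHS]invf_div ltf_pV2 ?posrE ?divr_gt0//; exact: truncnS_gt.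
  have /choice[q qE] (i : 'I_n) : exists q : rat, ball (x ord0 i) k.+1%:R^-1 (ratr q : R).
    have xk : x ord0 i - k.+1%:R^-1 < x ord0 i + k.+1%:R^-1.
      by rewrite ltrBlDr -addrA ltrDl addr_gt0.
    have [q] := @rat_in_itvoo R _ _ xk.
    rewrite in_itv/= => /andP[q1 q2]; exists q.
    by rewrite /ball /= ltr_distlC q1 q2.
  exists (\row_i q i, k) => /=; last first.
    by move=> i /=; rewrite mxE; exact/ball_sym/qE.
  move=> y By; apply: xeA; split => // i j; rewrite ord1.
  have := By j; rewrite /= mxE => qy.
  have := ball_triangle (qE j) qy; by apply: le_ball; rewrite [leRHS]splitr lerD ?ltW.
rewrite bigcup_mkcond; apply: countable_bigcupT_measurable => // p.
by case: ifP.
Qed.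

Lemma measurable_fun_lt_row n (f : 'rV[R]_n -> R) :
  (forall a, measurable [set x | f x < a]) -> measurable_fun setT f.
Proof.
move=> mf; apply: (measurability _ (RGenInftyO.measurableE R)).
move=> _ [_ [a ->] <-]; rewrite setTI.
by rewrite (_ : _ @^-1` _ = [set x | f x < a]).
Qed.

Lemma continuous_measurable_row n (f : 'rV[R]_n -> R) :
  continuous f -> measurable_fun setT f.
Proof.
move=> /continuousP cf; apply: measurable_fun_lt_row => a.
apply: open_measurable_row.
exact/(cf [set x | x < a])/open_lt.
Qed.

Lemma measurable_row_shift n (a : 'rV[R]_n) :
  measurable_fun setT (fun x : 'rV[R]_n => x + a).
Proof.
apply: measurable_fun_rowP => i.
rewrite (_ : (fun _ => _) = (fun x : 'rV[R]_n => x ord0 i + a ord0 i)).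
  by apply: measurable_funD => //; exact: measurable_coord.
by apply/funext => x; rewrite mxE.
Qed.

Lemma lebesgue_measure_shift (a : R) (A : set R) : measurable A ->
  lebesgue_measure ((fun x : R => x + a) @^-1` A) = lebesgue_measure A.
Proof.
move=> mA.
have msh : measurable_fun setT ((fun x => x + a) : measurableTypeR R -> measurableTypeR R).
  by apply: measurable_funD.
pose m := pushforward (lebesgue_measure : set (measurableTypeR R) -> \bar R)
   ((fun x => x + a) : measurableTypeR R -> measurableTypeR R).
apply/esym.
apply: (@lebesgue_measure_unique R
  (measure_function_pushforward__canonical__measure_function_Measure lebesgue_measure msh)) => //.
move=> _ [[u v]] _ <- /=; rewrite /pushforward.
rewrite (_ : _ @^-1` _ = `]u - a, v - a]%classic).
  rewrite !lebesgue_measure_itv/= !lte_fin ltrD2r.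
  by case: ifP => // _; rewrite -!EFinB; congr (_%:E); lra.
by apply/seteqP; split => x /=; rewrite !in_itv/= ltrBlDr lerBrDr.
Qed.

(** Repeats the map along which [lebesgue_row] is pushed forward, local to another section, so that
    preimages under it can be named in the induction below. *)
Let cons_row n (p : 'rV[R]_n * R) : 'rV[R]_n.+1 :=
  \row_i oapp (p.1 ord0) p.2 (unlift ord0 i).

Let measurable_cons_row n : measurable_fun setT (@cons_row n).
Proof.
apply: measurable_fun_rowP => i.
case: (unliftP ord0 i) => [j ->|->].
  rewrite (_ : (fun _ => _) = (fun x : 'rV[R]_n => x ord0 j) \o fst).
    by apply: measurableT_comp => //; exact: measurable_coord.
  by apply/funext => p; rewrite /= mxE liftK.
rewrite (_ : (fun _ => _) = snd) //.
by apply/funext => p; rewrite /= mxE unlift_none.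
Qed.

(** The product measure of [A] integrates the lengths of its slices: each slice is moved by
    one-dimensional invariance, and the base by the induction hypothesis, applied through a
    pushforward. *)
Lemma lebesgue_row_shift n (a : 'rV[R]_n) (A : set 'rV[R]_n) : measurable A ->
  lebesgue_row R n ((fun x => x + a) @^-1` A) = lebesgue_row R n A.
Proof.
elim: n a A => [a A mA|n IHn a A mA] /=.
  by rewrite !diracE; congr (_%:E); rewrite (_ : _ @^-1` A = A) //;
     apply/seteqP; split => x /=; rewrite (_ : x + a = x) //; apply/rowP => -[].
rewrite /pushforward/= /product_measure1.
pose B := @cons_row n @^-1` A.
have mB : measurable B by rewrite -[B]setTI; exact: measurable_cons_row.
pose h x := lebesgue_measure (xsection B x).
have mh : measurable_fun setT h by exact: measurable_fun_xsection.
pose a' : 'rV[R]_n := \row_i a ord0 (lift ord0 i).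
transitivity (\int[lebesgue_row R n]_x h ((x : 'rV[R]_n) + a')%R)%E.
  apply: eq_integral => x _; rewrite /h/=.
  rewrite -[RHS](@lebesgue_measure_shift (a ord0 ord0)); last exact: measurable_xsection.
  congr lebesgue_measure; rewrite /xsection; apply/seteqP.
  by split => t /=; rewrite !inE /B /cons_row /=;
    rewrite (_ : \row_i _ + a = \row_i oapp (((x : 'rV[R]_n) + a') ord0) (t + a ord0 ord0)
      (unlift ord0 i)) //;
    apply/rowP => i; rewrite !mxE; case: (unliftP ord0 i) => [j ->|->] /=; rewrite ?mxE.
rewrite -(ge0_integral_pushforward (measurable_row_shift a') _ measurableT mh)//.
apply: eq_measure_integral => [|msh C mC _]; first exact: measurable_row_shift.
exact: (IHn a' C mC).
Qed.

Lemma integral_row_shift n (a : 'rV[R]_n) (f : 'rV[R]_n -> \bar R) :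
  measurable_fun setT f ->
  (\int[lebesgue_row R n]_x f (x + a)%R = \int[lebesgue_row R n]_x f x)%E.
Proof.
have ge0 (g : 'rV[R]_n -> \bar R) : measurable_fun setT g -> (forall x, 0 <= g x)%E ->
    (\int[lebesgue_row R n]_x g (x + a)%R = \int[lebesgue_row R n]_x g x)%E.
  move=> mg g0.
  rewrite -(ge0_integral_pushforward (measurable_row_shift a) _ measurableT mg)//.
  apply: eq_measure_integral => [|msh C mC _]; first exact: measurable_row_shift.
  exact: lebesgue_row_shift.
move=> mf; rewrite integralE [RHS]integralE; congr (_ - _)%E.
- rewrite -(ge0 _ (measurable_funepos mf)) => [|x]; last exact: funepos_ge0.
  by apply: eq_integral => x _; rewrite !funeposE.

- rewrite -(ge0 _ (measurable_funeneg mf)) => [|x]; last exact: funeneg_ge0.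
  by apply: eq_integral => x _; rewrite !funenegE.

Qed.

Lemma integrable_row_shift n (a : 'rV[R]_n) (f : 'rV[R]_n -> R) :
  (lebesgue_row R n).-integrable setT (EFin \o f) ->
  (lebesgue_row R n).-integrable setT (EFin \o (fun x => f (x + a))).
Proof.
move=> /integrableP[mf fi]; apply/integrableP; split.
  exact: (measurableT_comp mf (measurable_row_shift a)).
apply: le_lt_trans fi.
by rewrite (integral_row_shift a (measurableT_comp (@abse_measurable _ setT) mf)).
Qed.

Lemma Rintegral_row_shift n (a : 'rV[R]_n) (f : 'rV[R]_n -> R) :
  measurable_fun setT f ->
  \int[lebesgue_row R n]_x f (x + a) = \int[lebesgue_row R n]_x f x.
Proof.
by move=> /measurable_EFinP mf; rewrite /Rintegral (integral_row_shift a mf).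
Qed.

End RowMeasure.

(** * Euclidean norm, distance to a set, directional derivatives *)

Section Enorm.
Context {R : realType} {n : nat}.
Implicit Types x y z : 'rV[R]_n.

Lemma enorm_ge0 x : 0 <= enorm x.
Proof. exact: l2norm_ge0. Qed.

Lemma enormZ (a : R) x : enorm (a *: x) = `|a| * enorm x.
Proof.
by rewrite /enorm -l2normZ; congr l2norm; apply/funext => i; rewrite mxE.
Qed.

Lemma enormN x : enorm (- x) = enorm x.
Proof. by rewrite -scaleN1r enormZ normrN1 mul1r. Qed.

Lemma enormBC x y : enorm (x - y) = enorm (y - x).
Proof. by rewrite -enormN opprB. Qed.

Lemma enormD x y : enorm (x + y) <= enorm x + enorm y.
Proof.
rewrite (_ : enorm (x + y) = l2norm (fun i => x ord0 i + y ord0 i)).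
  exact: ler_l2normD.
by congr l2norm; apply/funext => i; rewrite mxE.
Qed.

Lemma enorm0 : enorm (0 : 'rV[R]_n) = 0.
Proof. by rewrite -(scale0r 0) enormZ normr0 mul0r. Qed.

Lemma enorm_triangle y x z : enorm (x - z) <= enorm (x - y) + enorm (y - z).
Proof. by rewrite (le_trans _ (enormD _ _))// addrA subrK. Qed.

Lemma sqr_enorm x : enorm x ^+ 2 = \sum_i x ord0 i ^+ 2.
Proof. by rewrite sqr_sqrtr// sumr_ge0// => i _; exact: sqr_ge0. Qed.

Lemma ler_coord_enorm x i : `|x ord0 i| <= enorm x.
Proof.
rewrite -(@ler_pXn2r _ 2) ?nnegrE ?enorm_ge0// sqr_enorm (bigD1 i)//=.
by rewrite real_normK ?num_real// lerDl sumr_ge0// => j _; exact: sqr_ge0.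
Qed.

Lemma ler_coord_norm x i : `|x ord0 i| <= `|x|.
Proof.
rewrite -[`|x|]/(mx_norm x) mx_normrE.
exact: (le_bigmax_cond _ (fun ij : 'I_1 * 'I_n => `|x ij.1 ij.2|) (j := (ord0, i))).
Qed.

Lemma norm_le_enorm x : `|x| <= enorm x.
Proof.
rewrite -[`|x|]/(mx_norm x) mx_normrE; apply/bigmax_leP; split => /=.
  exact: enorm_ge0.
by move=> [i j] _ /=; rewrite ord1; exact: ler_coord_enorm.
Qed.

Lemma enorm_le_norm x : enorm x <= n%:R * `|x|.
Proof.
rewrite -(@ler_pXn2r _ 2) ?nnegrE ?enorm_ge0 ?mulr_ge0// sqr_enorm.
rewrite (@le_trans _ _ (\sum_(i < n) `|x| ^+ 2))//.
  apply: ler_sum => i _; rewrite -real_normK ?num_real//.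
  by rewrite ler_pXn2r ?nnegrE// ler_coord_norm.
rewrite sumr_const card_ord -[leLHS]mulr_natl exprMn ler_wpM2r ?sqr_ge0//.
by rewrite -natrX ler_nat; case: n => // m; rewrite leq_pmulr.
Qed.

Lemma ler_dist_enorm x y : `|enorm x - enorm y| <= enorm (x - y).
Proof.
have h1 : enorm x <= enorm (x - y) + enorm y by rewrite (le_trans _ (enormD _ _))// subrK.
have h2 : enorm y <= enorm (x - y) + enorm x.
  by rewrite enormBC (le_trans _ (enormD _ _))// subrK.
by rewrite ler_norml; apply/andP; split; lra.
Qed.

Lemma nbhs_enorm (x : 'rV[R]_n) (e : R) : 0 < e -> \forall y \near x, enorm (x - y) < e.
Proof.
move=> e0; have n0 : 0 < n.+1%:R :> R by rewrite ltr0n.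
near=> y; apply: le_lt_trans (enorm_le_norm _) _.
apply: (@le_lt_trans _ _ (n.+1%:R * `|x - y|)).
  by rewrite ler_wpM2r// ler_nat.
rewrite mulrC -ltr_pdivlMr//.
by near: y; apply: cvgr_dist_lt; [exact: cvg_id|exact: divr_gt0].
Unshelve. all: by end_near. Qed.

Lemma nbhs_enormP (x : 'rV[R]_n) (A : set 'rV[R]_n) :
  nbhs x A <-> exists2 e, 0 < e & forall y, enorm (x - y) < e -> A y.
Proof.
split => [/nbhs_ballP[e /= e0 eA]|[e e0 eA]]; last first.
  apply: (@filterS _ (nbhs x) (@nbhs_filter _ x) [set y | enorm (x - y) < e]) => [y /eA//|].
  exact: nbhs_enorm.
exists e => // y xy; apply: eA; rewrite mx_norm_ball /ball_.
exact: le_lt_trans (norm_le_enorm _) xy.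
Qed.

Lemma continuous_enormP (V : normedModType R) (f : 'rV[R]_n -> V) x :
  {for x, continuous f} <->
  forall e, 0 < e -> exists2 d, 0 < d & forall y, enorm (x - y) < d -> `|f x - f y| < e.
Proof.
split => [fx e e0|fx].
  have /nbhs_enormP : nbhs x [set y | `|f x - f y| < e].
    exact: (@cvgr_dist_lt _ _ _ (nbhs x) (nbhs_filter x) f (f x) fx e e0).
  by case=> d d0 h; exists d.
apply/(@cvgrPdist_lt _ _ _ (nbhs x) (nbhs_filter x)) => e /fx[d d0 h].
by apply/nbhs_enormP; exists d.
Qed.

Lemma lipschitz_continuous_row (f : 'rV[R]_n -> R) (k : R) :
  (forall x y, `|f x - f y| <= k * enorm (x - y)) -> continuous f.
Proof.
move=> fk x; apply/continuous_enormP => e e0.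
have k0 : 0 < `|k| + 1 by rewrite ltr_wpDl.
exists (e / (`|k| + 1)); first exact: divr_gt0.
move=> y xy; apply: le_lt_trans (fk _ _) _.
rewrite ltr_pdivlMr// in xy; apply: le_lt_trans xy.
rewrite mulrC ler_wpM2l ?enorm_ge0//.
by rewrite (le_trans (ler_norm _))// lerDl.
Qed.

Lemma continuous_enorm : continuous (@enorm R n).
Proof.
apply: (@lipschitz_continuous_row _ 1) => x y.
by rewrite mul1r ler_dist_enorm.
Qed.

End Enorm.

Section Edist.
Context {R : realType} {n : nat} (S : set 'rV[R]_n) (S0 : S !=set0).
Implicit Types x y z : 'rV[R]_n.

Let lb x : has_lbound [set enorm (x - s) | s in S].
Proof. by exists 0 => _ [s Ss <-]; exact: enorm_ge0. Qed.

Lemma edist_le x s : S s -> edist x S <= enorm (x - s).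
Proof. by move=> Ss; apply: ge_inf => //; exists s. Qed.

Lemma edist_ge x (a : R) : (forall s, S s -> a <= enorm (x - s)) -> a <= edist x S.
Proof.
move=> aS; apply: lb_le_inf.
  by case: S0 => s Ss; exists (enorm (x - s)); exists s.
by move=> _ [s Ss <-]; exact: aS.
Qed.

Lemma edist_ge0 x : 0 <= edist x S.
Proof. by apply: edist_ge => s _; exact: enorm_ge0. Qed.

Lemma edist_lt x (a : R) : edist x S < a -> exists2 s, S s & enorm (x - s) < a.
Proof.
move=> xa; apply: contrapT => h; move: xa; apply/negP; rewrite -leNgt.
apply: edist_ge => s Ss; rewrite leNgt; apply/negP => xs; apply: h.
by exists s.
Qed.

Lemma edistD x y : edist x S <= edist y S + enorm (x - y).
Proof.
rewrite -lerBlDr; apply: edist_ge => s Ss; rewrite lerBlDr addrC.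
exact: le_trans (edist_le _ Ss) (enorm_triangle y x s).
Qed.

Lemma ler_dist_edist x y : `|edist x S - edist y S| <= enorm (x - y).
Proof.
rewrite ler_norml lerNl opprB !lerBlDl; apply/andP; split.
  by rewrite enormBC; exact: edistD.
exact: edistD.
Qed.

Lemma continuous_edist : continuous (fun x => edist x S).
Proof.
apply: (@lipschitz_continuous_row _ _ _ 1) => x y.
by rewrite mul1r ler_dist_edist.
Qed.

Lemma edist_gt0 x : closed S -> ~ S x -> 0 < edist x S.
Proof.
move=> cS nSx; have /nbhs_enormP[e e0 eS] : nbhs x (~` S).
  by apply: open_nbhs_nbhs; split => //; exact: closed_openC.
apply: lt_le_trans e0 _; apply: edist_ge => s Ss.
by rewrite leNgt; apply/negP => /eS.
Qed.

Lemma edist0 x : S x -> edist x S = 0.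
Proof.
move=> Sx; apply/le_anti; rewrite edist_ge0 andbT.
by rewrite (le_trans (edist_le x Sx))// subrr enorm0.
Qed.

End Edist.

Section Derive.
Context {R : realType} {n : nat}.
Implicit Types (x v : 'rV[R]_n) (f : 'rV[R]_n -> R).

(** The two difference quotients coincide. Restricting to lines makes the one-variable chain rule
    and differentiation under the integral available for directional derivatives. *)
Lemma is_derive1_line f x v (t : R) df :
  is_derive t 1 (fun h : R => f (h *: v + x)) df <-> is_derive (t *: v + x) v f df.
Proof.
have E : (fun h : R => h^-1 *: ((f \o shift (t *: v + x)) (h *: v) - f (t *: v + x))) =
   (fun h : R => h^-1 *: (((fun h : R => f (h *: v + x)) \o shift t) (h *: 1) - f (t *: v + x))).
  by apply/funext => h /=; rewrite addrA -scalerDl [h *: 1]mulr1.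
split=> -[d1 d2]; split.
- by rewrite /derivable E.
- by rewrite /derive E.
- by rewrite /derivable -E.
- by rewrite /derive -E.
Qed.

Lemma is_derive_line f x v df :
  is_derive (0 : R) 1 (fun h : R => f (h *: v + x)) df <-> is_derive x v f df.
Proof. by rewrite -{2}[x]add0r -(scale0r v); exact: is_derive1_line. Qed.

Lemma is_derive_comp1 (g : R -> R) f x v df dg :
  is_derive (f x) 1 g dg -> is_derive x v f df ->
  is_derive x v (g \o f) (dg * df).
Proof.
move=> gd /is_derive_line fd; apply/is_derive_line.
have gd' : is_derive ((fun h : R => f (h *: v + x)) 0) 1 g dg.
  by rewrite scale0r add0r.
exact: is_derive_eq (is_derive1_comp gd' fd) _.
Qed.

(** Dominated convergence speaks of sequences, so continuity of a parameter integral is tested along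
    them. A failure of continuity supplies a sequence, with points at distance less than 1/(k +
    1). *)
Lemma continuous_row_seq f x :
  (forall u : nat -> 'rV[R]_n, u k @[k --> \oo] --> x -> f (u k) @[k --> \oo] --> f x) ->
  {for x, continuous f}.
Proof.
move=> fu; apply: contrapT => nc.
have [e e0 ne] : exists2 e, 0 < e & forall k : nat, exists y,
    enorm (x - y) < k.+1%:R^-1 /\ e <= `|f x - f y|.
  apply: contrapT => ne; apply: nc; apply/continuous_enormP => e e0.
  apply: contrapT => nn; apply: ne; exists e => // k.
  apply: contrapT => nk; apply: nn; exists (k.+1%:R^-1); first by rewrite invr_gt0.
  by move=> y xy; rewrite ltNge; apply/negP => exy; apply: nk; exists y.
have /choice[u uE] := ne.
have ux : u k @[k --> \oo] --> x.
  apply/cvgrPdist_lt => d d0; near=> k.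
  apply: le_lt_trans (norm_le_enorm _) _; apply: lt_trans (uE k).1 _.
  near: k; exact: near_infty_natSinv_lt (PosNum d0).
have /cvgrPdist_lt/(_ _ e0) [N _ /(_ N (leqnn _))/=] := fu _ ux.
by rewrite ltNge (uE N).2.
Unshelve. all: by end_near. Qed.

End Derive.

(** * Integrals depending on a parameter *)

Section ParameterIntegral.
Context {R : realType} {n : nat}.
Local Notation mu := (lebesgue_row R n).
Implicit Types (x v y z : 'rV[R]_n).

Lemma integrable_le (f g : 'rV[R]_n -> R) : measurable_fun setT f ->
  (forall y, `|f y| <= g y) -> mu.-integrable setT (EFin \o g) ->
  mu.-integrable setT (EFin \o f).
Proof.
move=> mf fg; apply: le_integrable => //; first exact/measurable_EFinP.
by move=> y _ /=; rewrite lee_fin (le_trans (fg y))// ler_norm.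
Qed.

Lemma integrable_measurable (f : 'rV[R]_n -> R) :
  mu.-integrable setT (EFin \o f) -> measurable_fun setT f.
Proof. by move=> /integrableP[/measurable_EFinP]. Qed.

Lemma integrable_bM (k m : 'rV[R]_n -> R) (C : R) : measurable_fun setT k ->
  (forall y, `|k y| <= C) -> mu.-integrable setT (EFin \o m) ->
  mu.-integrable setT (EFin \o (fun y => k y * m y)).
Proof.
move=> mk kC im; have mm := integrable_measurable im.
apply: (@integrable_le _ (fun y => C * `|m y|)) => [|y|].
- exact: measurable_funM.
- by rewrite normrM ler_wpM2r.
- rewrite (_ : _ \o _ = (fun y => C%:E * (`|m y|)%:E)%E).
    by apply: integrableZl => //; exact: integrable_norm im.
  by apply/funext => y /=; rewrite EFinM.
Qed.

Lemma is_derive_Rintegral (F dF : 'rV[R]_n -> 'rV[R]_n -> R) x v (e : R)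
    (H : 'rV[R]_n -> R) : 0 < e ->
  (forall t, `|t| < e -> mu.-integrable setT (EFin \o F (t *: v + x))) ->
  (forall t y, `|t| < e -> is_derive (t *: v + x) v (F ^~ y) (dF (t *: v + x) y)) ->
  (forall t y, `|t| < e -> `|dF (t *: v + x) y| <= H y) ->
  mu.-integrable setT (EFin \o H) ->
  is_derive x v (fun z => \int[mu]_y F z y) (\int[mu]_y dF x y).
Proof.
move=> e0 iF dFE dFH iH; apply/is_derive_line.
have Ie (t : R) : t \in `](-e), e[ -> `|t| < e by rewrite in_itv/= ltr_norml.
pose f (t : R) y := F (t *: v + x) y.
have fE (t : R) y : `|t| < e -> is_derive t 1 (f ^~ y) (dF (t *: v + x) y).
  by move=> te; apply/(@is_derive1_line _ _ (F ^~ y)); exact: dFE.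
have I0 : (0 : R) \in `](-e), e[ by rewrite in_itv/= oppr_lt0 e0.
have df1 (t : R) y : t \in `](-e), e[ -> [set: 'rV[R]_n] y -> derivable (f ^~ y) t 1.
  by move=> /Ie te _; have [] := fE t y te.
have i1 (t : R) : t \in `](-e), e[ -> mu.-integrable setT (EFin \o f t).
  by move=> /Ie; exact: iF.
have d1E (t : R) y : `|t| < e -> partial1of2 f t y = dF (t *: v + x) y.
  by move=> te; rewrite partial1of2E; have [_ <-] := fE t y te.
have H0 y : 0 <= H y.
  by have := dFH 0 y; rewrite normr0 => /(_ e0); exact: le_trans.
have G1 (t : R) y : t \in `](-e), e[ -> [set: 'rV[R]_n] y -> `|partial1of2 f t y| <= H y.
  by move=> /Ie te _; rewrite d1E //; exact: dFH.
have := derivable_under_integral measurableT I0 i1 df1 H0 iH G1.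
have := differentiation_under_integral measurableT I0 i1 df1 H0 iH G1.
rewrite derive1E => dE di; split => //; rewrite dE; apply: eq_Rintegral => y _.
by rewrite d1E ?normr0// scale0r add0r.
Qed.

Lemma continuous_Rintegral (F : 'rV[R]_n -> 'rV[R]_n -> R) x (e : R)
    (H : 'rV[R]_n -> R) : 0 < e ->
  (forall z, enorm (x - z) < e -> measurable_fun setT (F z)) ->
  (forall z y, enorm (x - z) < e -> `|F z y| <= H y) ->
  mu.-integrable setT (EFin \o H) ->
  (forall y, {for x, continuous (F ^~ y)}) ->
  {for x, continuous (fun z => \int[mu]_y F z y)}.
Proof.
move=> e0 mF FH iH cF; apply: continuous_row_seq => u ux.
have [N NE] : exists N, forall k, enorm (x - u (k + N)%N) < e.
  have /(_ _ (@nbhs_enorm _ _ x e e0)) [N _ Ne] := ux.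
  by exists N => k; apply: Ne; rewrite /= leq_addl.
rewrite -(cvg_shiftn N) /=.
have xx : enorm (x - x) < e by rewrite subrr enorm0.
have iF z : enorm (x - z) < e -> mu.-integrable setT (EFin \o F z).
  by move=> xz; apply: (integrable_le (mF _ xz)) iH => y; exact: FH.
apply: fine_cvg; rewrite fineK; last exact: integrable_fin_num (iF _ xx).
apply: (@dominated_cvg _ _ _ mu setT measurableT (fun k y => (F (u (k + N)%N) y)%:E) _ (EFin \o
  H)) => //.
- by move=> k; apply/measurable_EFinP; exact: mF.
- by move=> y _; apply: cvg_EFin; [exact: nearW|]; rewrite (cvg_shiftn N (fun k => F (u k) y));
  exact: (cvg_comp _ _ ux (cF y)).
- by move=> k y _; rewrite /= lee_fin; exact: FH.
Qed.

(** By translation invariance the integral of [f (z + y)] over y does not depend on z; it is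
    differentiated in z under the integral sign, for which the majorant has to hold along shifts |t|
    < 1. Integration by parts rests on this, without iterated integrals. *)
Lemma Rintegral_derive0 (f df : 'rV[R]_n -> R) v (H : 'rV[R]_n -> R) :
  mu.-integrable setT (EFin \o f) ->
  (forall z, is_derive z v f (df z)) ->
  (forall t y, `|t| < 1 -> `|df (t *: v + y)| <= H y) ->
  mu.-integrable setT (EFin \o H) ->
  \int[mu]_y df y = 0.
Proof.
move=> fi fd dfH iH; have mf := integrable_measurable fi.
have D : is_derive 0 v (fun z => \int[mu]_y f (z + y)) (\int[mu]_y df (0 + y)).
  apply: (@is_derive_Rintegral (fun z y => f (z + y)) (fun z y => df (z + y)) 0 v 1 H) => //.
  - move=> t _; rewrite addr0 (_ : (fun y => _) = (fun y => f (y + t *: v))).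
      exact: integrable_row_shift.
    by apply/funext => y; rewrite addrC.
  - move=> t y _; apply/(@is_derive1_line _ _ (fun z => f (z + y))); rewrite addr0.
    have -> : (fun h : R => f (h *: v + 0 + y)) = (fun h : R => f (h *: v + y)).
      by apply/funext => h; rewrite addr0.
    exact/is_derive1_line.
  - by move=> t y te; rewrite addr0; exact: dfH.
transitivity (\int[mu]_y df (0 + y)).
  by apply: eq_Rintegral => y _; rewrite add0r.
have [_ <-] := D.
rewrite (_ : (fun z => _) = cst (\int[mu]_y f y)) ?derive_cst//.
apply/funext => z /=; rewrite -(Rintegral_row_shift z mf).
by apply: eq_Rintegral => y _; rewrite addrC.
Qed.

Definition cube (x : 'rV[R]_n) (a : R) : set 'rV[R]_n :=
  [set y | forall i, `|x ord0 i - y ord0 i| <= a].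

Lemma measurable_cube x (a : R) : measurable (cube x a).
Proof.
apply: (@measurable_row_rect R n (fun i => [set t | `|x ord0 i - t| <= a])) => i.
rewrite (_ : mkset _ = `[x ord0 i - a, x ord0 i + a]%classic)//.
by apply/seteqP; split => t /=; rewrite in_itv/= ler_distlC.
Qed.

Lemma lebesgue_cube x (a : R) : 0 <= a -> mu (cube x a) = ((2 * a) ^+ n)%:E.
Proof.
move=> a0; rewrite (@lebesgue_row_box R n (fun i => [set t | `|x ord0 i - t| <= a])); last first.
  move=> i; rewrite (_ : mkset _ = `[x ord0 i - a, x ord0 i + a]%classic)//.
  by apply/seteqP; split => t /=; rewrite in_itv/= ler_distlC.
under eq_bigr => i _.
  rewrite (_ : mkset _ = `[x ord0 i - a, x ord0 i + a]%classic); last first.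
    by apply/seteqP; split => t /=; rewrite in_itv/= ler_distlC.
  rewrite lebesgue_measure_itv/= lte_fin.
  rewrite (_ : (if _ then _ else _) = (2 * a)%:E); last first.
    case: ifPn => [_|]; first by rewrite -EFinB; congr (_%:E); lra.
    by rewrite -leNgt => ?; congr (_%:E); lra.
  over.
by rewrite prodEFin prodr_const card_ord.
Qed.

End ParameterIntegral.

(** * The regularised Cauchy kernel *)

Section PosPart.
Context {R : realType}.
Implicit Types s t : R.

Definition pospart s := Num.max s 0.

Lemma pospart_ge0 s : 0 <= pospart s.
Proof. by rewrite le_max lexx orbT. Qed.

Lemma pospartE s : 0 <= s -> pospart s = s.
Proof. by move=> s0; rewrite /pospart max_l. Qed.

Lemma pospart0 s : s <= 0 -> pospart s = 0.
Proof. by move=> s0; rewrite /pospart max_r. Qed.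

(** The square of [pospart] is piecewise polynomial; a quadratic error estimate yields its
    derivative without treating the joint apart. With C = 0 it also serves for linear functions. *)
Lemma is_derive_quadratic_error (f : R -> R) s (d C : R) :
  (forall t, `|f (t + s) - f s - d * t| <= C * t ^+ 2) -> is_derive s 1 f d.
Proof.
move=> fC.
have cvgf : h^-1 *: ((f \o shift s) (h *: 1) - f s) @[h --> 0^'] --> d.
  apply/cvgrPdist_le => e e0; near=> h.
  have h0 : h != 0 by near: h; exact: nbhs_dnbhs_neq.
  rewrite /= [h *: 1]mulr1.
  rewrite (_ : d - _ = - (h^-1 * (f (h + s) - f s - d * h))); last first.
    by rewrite mulrBr [h^-1 * (d * h)]mulrC mulfK// opprB.
  rewrite normrN normrM normfV mulrC ler_pdivrMr ?normr_gt0//.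
  apply: le_trans (fC h) _.
  rewrite -real_normK ?num_real// expr2 mulrA ler_wpM2r//.
  have : `|h| <= e / (`|C| + 1).
    near: h; apply: dnbhs0_le; rewrite divr_gt0// ltr_wpDl//.
  rewrite ler_pdivlMr ?ltr_wpDl// => he.
  rewrite (le_trans _ he)// mulrC ler_wpM2l//.
  by rewrite (le_trans (ler_norm _))// lerDl.
by split; [apply/cvg_ex; exists d|exact/cvg_lim].
Unshelve. all: by end_near. Qed.

Lemma is_derive1_continuous (f : R -> R) s d :
  is_derive s 1 f d -> {for s, continuous f}.
Proof. by move=> [fs _]; apply/differentiable_continuous/derivable1_diffP. Qed.

Lemma is_derive_sqr_pospart s :
  is_derive s 1 (fun s => pospart s ^+ 2) (2 * pospart s).
Proof.
apply: (@is_derive_quadratic_error _ _ _ 1) => t; rewrite mul1r ler_norml.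
by rewrite /pospart; case: (leP (t + s) 0); case: (leP s 0) => s0 ts;
  apply/andP; split; nra.
Qed.

Lemma continuous_pospart : continuous pospart.
Proof.
by move=> s; apply: continuous_max; [exact: cvg_id|exact: cvg_cst].
Qed.

End PosPart.

Section RadialProfile.
Context {R : realType} (n : nat) (a : R).
Hypothesis a0 : 0 < a.
Implicit Types s t : R.

(* A positive C^1 function equal to s for s >= a: the field x m(|x|^2)^(-n/2) agrees with the Cauchy kernel
   x / |x|^n for |x|^2 >= a and is C^1 at the origin. *)
Definition smoothed s := s + pospart (a - s) ^+ 2 / (2 * a).
Definition dsmoothed s := 1 - pospart (a - s) / a.

Lemma smoothedE s : a <= s -> smoothed s = s.
Proof.
by move=> sa; rewrite /smoothed pospart0 ?subr_le0// expr0n mul0r addr0.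
Qed.

Lemma smoothed_small s : s <= a -> smoothed s = (s ^+ 2 + a ^+ 2) / (2 * a).
Proof.
by move=> sa; rewrite /smoothed pospartE ?subr_ge0//; field; rewrite gt_eqF.
Qed.

Lemma dsmoothedE s : a <= s -> dsmoothed s = 1.
Proof. by move=> sa; rewrite /dsmoothed pospart0 ?subr_le0// mul0r subr0. Qed.

Lemma dsmoothed_small s : s <= a -> dsmoothed s = s / a.
Proof.
by move=> sa; rewrite /dsmoothed pospartE ?subr_ge0//; field; rewrite gt_eqF.
Qed.

Lemma smoothed_ge s : s <= smoothed s.
Proof.
by rewrite /smoothed lerDl divr_ge0 ?sqr_ge0// mulr_ge0// ltW.
Qed.

Lemma smoothed_ge_half s : a / 2 <= smoothed s.
Proof.
have [sa|/ltW sa] := leP a s; first by rewrite smoothedE//; have := a0; lra.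
rewrite smoothed_small// ler_pdivlMr ?mulr_gt0//.
rewrite (_ : a / 2 * (2 * a) = a ^+ 2); last by field.
by rewrite lerDr sqr_ge0.
Qed.

Lemma smoothed_gt0 s : 0 < smoothed s.
Proof. by rewrite (lt_le_trans _ (smoothed_ge_half s))// divr_gt0. Qed.

Lemma dsmoothed_ge0 s : 0 <= s -> 0 <= dsmoothed s <= 1.
Proof.
move=> s0; have [sa|/ltW sa] := leP a s; first by rewrite dsmoothedE// lexx ler01.
by rewrite dsmoothed_small// divr_ge0 ?(ltW a0)//= ler_pdivrMr// mul1r.
Qed.

Lemma is_derive_smoothed s : is_derive s 1 smoothed (dsmoothed s).
Proof.
have D1 : is_derive s 1 (fun s : R => a - s) (- 1).
  by apply: is_derive_eq; rewrite add0r mul1r.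
have D2 := @is_derive1_comp _ (fun s : R => pospart s ^+ 2) (fun s : R => a - s) s _ _
  (is_derive_sqr_pospart (a - s)) D1.
have -> : smoothed = id + (2 * a)^-1 *: ((fun s => pospart s ^+ 2) \o (fun s : R => a - s)).
  by apply/funext => t; rewrite /smoothed /= mulrC.
apply: is_derive_eq (is_deriveD (is_derive_id _ _) (is_deriveZ _ D2)) _.
by rewrite /dsmoothed /= /GRing.scale /=; field; rewrite gt_eqF.
Qed.

Lemma continuous_dsmoothed : continuous dsmoothed.
Proof.
move=> s; apply: cvgB; first exact: cvg_cst.
apply: cvgM; last exact: cvg_cst.
apply: (@continuous_comp _ _ _ (fun s : R => a - s) pospart).
  by apply: cvgB; [exact: cvg_cst|exact: cvg_id].
exact: continuous_pospart.
Qed.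

Local Notation e := (- (n%:R / 2) : R).

Definition profile s := smoothed s `^ e.
Definition dprofile s := e * smoothed s `^ (e - 1) * dsmoothed s.

Lemma is_derive_profile s : is_derive s 1 profile (dprofile s).
Proof.
exact: is_derive1_comp (is_derive1_powR e (smoothed_gt0 s)) (is_derive_smoothed s).
Qed.

Lemma continuous_profile : continuous profile.
Proof.
move=> s; exact: is_derive1_continuous (is_derive_profile s).
Qed.

Lemma continuous_dprofile : continuous dprofile.
Proof.
move=> s; apply: cvgM; last exact: continuous_dsmoothed.
apply: cvgM; first exact: cvg_cst.
have D := is_derive1_comp (is_derive1_powR (e - 1) (smoothed_gt0 s)) (is_derive_smoothed s).
exact: is_derive1_continuous D.
Qed.

Lemma powR_neg_le (u v c : R) : c <= 0 -> 0 < u -> u <= v -> v `^ c <= u `^ c.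
Proof.
move=> c0 u0 uv; have v0 := lt_le_trans u0 uv.
rewrite -[c]opprK !(powRN _ (- c)) lef_pV2 ?posrE ?powR_gt0//.
by apply: ge0_ler_powR; rewrite ?oppr_ge0 ?nnegrE// ltW.
Qed.

Let e0 : e <= 0. Proof. by rewrite oppr_le0 divr_ge0. Qed.

Lemma profile_ge0 s : 0 <= profile s. Proof. exact: powR_ge0. Qed.

Lemma profile_le s : profile s <= (a / 2) `^ e.
Proof. by apply: powR_neg_le; rewrite ?divr_gt0// smoothed_ge_half. Qed.

Lemma dprofileE s : dprofile s = - (n%:R / 2) * (profile s * (dsmoothed s / smoothed s)).
Proof.
rewrite /dprofile /profile powRB ?(gt_eqF (smoothed_gt0 s)) ?implybT//.
by rewrite powRr1 ?ltW ?smoothed_gt0//; ring.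
Qed.

(** Because [dsmoothed s] <= 1 and s <= [smoothed s], the logarithmic derivative of the profile is
    at most n / (2 s) in absolute value. The bound controls the gradient of the kernel and also
    makes its divergence nonnegative. *)
Lemma norm_dprofile s : 0 <= s -> `|2 * s * dprofile s| <= n%:R * profile s.
Proof.
move=> s0; rewrite dprofileE.
have m0 := smoothed_gt0 s; have /andP[d0 d1] := dsmoothed_ge0 s0.
have -> : 2 * s * (- (n%:R / 2) * (profile s * (dsmoothed s / smoothed s)))
  = - (n%:R * profile s * (dsmoothed s * (s / smoothed s))) by field; rewrite gt_eqF.
rewrite normrN normrM ger0_norm ?mulr_ge0 ?profile_ge0//.
rewrite ler_piMr ?mulr_ge0 ?profile_ge0//.
have sm0 : 0 <= s / smoothed s by rewrite divr_ge0// ltW.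
rewrite ger0_norm; last exact: mulr_ge0.
by rewrite mulr_ile1// ler_pdivrMr// mul1r smoothed_ge.
Qed.

(** The left side is the divergence of the field x |-> x profile(|x|^2) at |x|^2 = s. The last
    factor vanishes wherever [smoothed] is the identity. *)
Lemma divergence_profile s : n%:R * profile s + 2 * s * dprofile s =
  n%:R * profile s * (1 - s * dsmoothed s / smoothed s).
Proof. by rewrite dprofileE; field; rewrite gt_eqF// smoothed_gt0. Qed.

Lemma divergence_profile0 s : a <= s -> n%:R * profile s + 2 * s * dprofile s = 0.
Proof.
move=> sa; rewrite divergence_profile smoothedE// dsmoothedE// mulr1.
by rewrite divff ?subrr ?mulr0// gt_eqF// (lt_le_trans a0 sa).
Qed.

Lemma divergence_profile_ge0 s : 0 <= s -> 0 <= n%:R * profile s + 2 * s * dprofile s.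
Proof.
by move=> /norm_dprofile; rewrite ler_norml => /andP[]; lra.
Qed.

(** Keeps the mass of the bump away from zero. Writing m for [smoothed], on this range m(s) <= a and
    s m'(s) / m(s) = 2 s^2 / (s^2 + a^2) <= 1/2. *)
Lemma divergence_profile_ge s : 0 <= s -> s <= a / 2 ->
  n%:R * a `^ e / 2 <= n%:R * profile s + 2 * s * dprofile s.
Proof.
move=> s0 sa; have a1 := a0; have sa' : s <= a by lra.
rewrite divergence_profile; apply: ler_pM; rewrite ?mulr_ge0 ?powR_ge0//.
  rewrite ler_wpM2l//; apply: powR_neg_le => //; first exact: smoothed_gt0.
  rewrite smoothed_small// ler_pdivrMr ?mulr_gt0//; nra.
rewrite smoothed_small// dsmoothed_small//.
have sa0 : 0 < s ^+ 2 + a ^+ 2 by rewrite ltr_wpDl ?sqr_ge0 ?exprn_gt0.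
have -> : s * (s / a) / ((s ^+ 2 + a ^+ 2) / (2 * a)) = 2 * s ^+ 2 / (s ^+ 2 + a ^+ 2).
  by field; rewrite !gt_eqF.
rewrite lerBrDr -lerBrDl ler_pdivrMr; nra.
Qed.

End RadialProfile.

Section Coordinates.
Context {R : realType} {n : nat}.
Implicit Types (x y : 'rV[R]_n) (i j l : 'I_n).

Lemma is_derive_coord l j x :
  is_derive x (std_vec R j) (fun y : 'rV[R]_n => y ord0 l) (j == l)%:R.
Proof.
apply/is_derive_line; apply: (@is_derive_quadratic_error _ _ _ _ 0) => t.
rewrite !mxE eqxx/= eq_sym mul0r addr0 mul0r add0r addrK.
by rewrite mulrC subrr normr0.
Qed.

Lemma is_deriveM_row (f g : 'rV[R]_n -> R) x v df dg :
  is_derive x v f df -> is_derive x v g dg ->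
  is_derive x v (fun y => f y * g y) (df * g x + f x * dg).
Proof.
move=> fd gd; apply: is_derive_eq (is_deriveM fd gd) _.
by rewrite /GRing.scale/=; ring.
Qed.

Lemma is_derive_sqr_enorm j x :
  is_derive x (std_vec R j) (fun y : 'rV[R]_n => enorm y ^+ 2) (2 * x ord0 j).
Proof.
have -> : (fun y : 'rV[R]_n => enorm y ^+ 2) =
    \sum_(i < n) (fun y : 'rV[R]_n => y ord0 i * y ord0 i).
  apply/funext => y; rewrite sqr_enorm fct_sumE; apply: eq_bigr => i _.
  by rewrite expr2.
have D i := is_deriveM_row (is_derive_coord i j x) (is_derive_coord i j x).
apply: is_derive_eq (is_derive_sum D) _.
rewrite (bigD1 j)//= big1 => [|i /negPf ij]; last first.
  by rewrite eq_sym ij !mul0r mulr0 addr0.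
by rewrite eqxx mul1r mulr1; ring.
Qed.

Lemma continuous_coord l : continuous (fun y : 'rV[R]_n => y ord0 l).
Proof. exact: coord_continuous. Qed.

Lemma continuous_sqr_enorm : continuous (fun y : 'rV[R]_n => enorm y ^+ 2).
Proof.
by move=> x; apply: (@continuous_comp _ _ _ (@enorm R n) (fun t => t ^+ 2));
  [exact: continuous_enorm|exact: exprn_continuous].
Qed.

Lemma continuousM_row (f g : 'rV[R]_n -> R) : continuous f -> continuous g ->
  continuous (fun y => f y * g y).
Proof. by move=> cf cg x; exact: (cvgM (cf x) (cg x)). Qed.

Lemma continuousD_row (f g : 'rV[R]_n -> R) : continuous f -> continuous g ->
  continuous (fun y => f y + g y).
Proof. by move=> cf cg x; exact: (cvgD (cf x) (cg x)). Qed.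

Lemma continuous_cst_row (c : R) : continuous (fun _ : 'rV[R]_n => c).
Proof. by move=> x; apply: (@cvg_cst _ _ _ (nbhs x)). Qed.

Lemma continuous_sum_row (I : finType) (f : I -> 'rV[R]_n -> R) :
  (forall k, continuous (f k)) -> continuous (fun y => \sum_k f k y).
Proof.
move=> cf; elim: (index_enum I) => [|k s IHs].
  rewrite (_ : (fun y => _) = fun=> 0); first exact: continuous_cst_row.
  by apply/funext => y; rewrite big_nil.
rewrite (_ : (fun y => _) = fun y => f k y + \sum_(k <- s) f k y).
  exact: continuousD_row.
by apply/funext => y; rewrite big_cons.
Qed.

End Coordinates.

(** * The smoothed kernel, its gradient and its divergence *)

Section Kernel.
Context {R : realType} {n : nat}.
Implicit Types (x y : 'rV[R]_n) (i j l : 'I_n) (a b : R).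

Definition kernel a l x := x ord0 l * profile n a (enorm x ^+ 2).

Definition dkernel a i l x :=
  (i == l)%:R * profile n a (enorm x ^+ 2) +
  2 * x ord0 i * x ord0 l * dprofile n a (enorm x ^+ 2).

Definition bump a x := \sum_i dkernel a i i x.

Lemma dkernelC a i l x : dkernel a i l x = dkernel a l i x.
Proof. by rewrite /dkernel eq_sym (mulrAC 2). Qed.

Lemma is_derive_kernel a i l x : 0 < a ->
  is_derive x (std_vec R i) (kernel a l) (dkernel a i l x).
Proof.
move=> a0.
have D := is_derive_comp1 (is_derive_profile n a0 _) (is_derive_sqr_enorm i x).
apply: is_derive_eq (is_deriveM_row (is_derive_coord l i x) D) _.
by rewrite /dkernel /=; ring.
Qed.

Let continuous_comp_sqr_enorm (p : R -> R) : continuous p ->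
  continuous (fun x : 'rV[R]_n => p (enorm x ^+ 2)).
Proof.
by move=> cp x; apply: (@continuous_comp _ _ _ (fun x => enorm x ^+ 2) p);
  [exact: continuous_sqr_enorm|exact: cp].
Qed.

Lemma continuous_kernel a l : 0 < a -> continuous (kernel a l).
Proof.
move=> a0; apply: continuousM_row; first exact: continuous_coord.
exact: continuous_comp_sqr_enorm (continuous_profile a0).
Qed.

Lemma continuous_dkernel a i l : 0 < a -> continuous (dkernel a i l).
Proof.
move=> a0; apply: continuousD_row; apply: continuousM_row.
- exact: continuous_cst_row.
- exact: continuous_comp_sqr_enorm (continuous_profile a0).
- apply: continuousM_row; last exact: continuous_coord.
  apply: continuousM_row; last exact: continuous_coord.
  exact: continuous_cst_row.
- exact: continuous_comp_sqr_enorm (continuous_dprofile a0).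
Qed.

Lemma bumpE a x : bump a x =
  n%:R * profile n a (enorm x ^+ 2) + 2 * enorm x ^+ 2 * dprofile n a (enorm x ^+ 2).
Proof.
rewrite /bump /dkernel big_split/= -!mulr_suml; congr (_ * _ + _ * _).
  under eq_bigr do rewrite eqxx.
  by rewrite sumr_const card_ord.
by rewrite sqr_enorm mulr_sumr; apply: eq_bigr => i _; rewrite -mulrA expr2.
Qed.

Lemma continuous_bump a : 0 < a -> continuous (bump a).
Proof.
by move=> a0; apply: continuous_sum_row => i; exact: continuous_dkernel.
Qed.

Lemma bump_ge0 a x : 0 < a -> 0 <= bump a x.
Proof. by move=> a0; rewrite bumpE; apply: divergence_profile_ge0 => //; exact: sqr_ge0. Qed.

Lemma bump0 a x : 0 < a -> a <= enorm x ^+ 2 -> bump a x = 0.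
Proof. by move=> a0 ax; rewrite bumpE divergence_profile0. Qed.

Lemma bump_ge a x : 0 < a -> enorm x ^+ 2 <= a / 2 ->
  n%:R * a `^ (- (n%:R / 2)) / 2 <= bump a x.
Proof.
by move=> a0 ax; rewrite bumpE; apply: divergence_profile_ge => //; exact: sqr_ge0.
Qed.

Lemma kernel_eq a b l x : 0 < a -> 0 < b -> a <= enorm x ^+ 2 -> b <= enorm x ^+ 2 ->
  kernel a l x = kernel b l x.
Proof. by move=> a0 b0 ax bx; rewrite /kernel /profile !smoothedE. Qed.

Lemma dkernel_eq a b i l x : 0 < a -> 0 < b -> a <= enorm x ^+ 2 -> b <= enorm x ^+ 2 ->
  dkernel a i l x = dkernel b i l x.
Proof.
by move=> a0 b0 ax bx; rewrite /dkernel /profile /dprofile !smoothedE// !dsmoothedE.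
Qed.

(** With m the smoothed value of |x|^2, |x_l| <= |x| <= m^(1/2), so the kernel is at most m^((1 -
    n)/2), which decreases in m. The free bound s serves twice: s = a / 2 gives a global bound, s =
    M^2 the decay at infinity. *)
Lemma norm_kernel_le a l x (s : R) : 0 < a -> (0 < n)%N -> 0 < s ->
  s <= smoothed a (enorm x ^+ 2) -> `|kernel a l x| <= s `^ ((1 - n%:R) / 2).
Proof.
move=> a0 n0 s0 sm; set q := enorm x ^+ 2 in sm *; set m := smoothed a q in sm.
have m0 : 0 < m by exact: smoothed_gt0.
have nn : (1 - n%:R) / 2 <= 0 :> R.
  by rewrite pmulr_lle0 ?invr_gt0// subr_le0 ler1n.
apply: le_trans (powR_neg_le nn s0 sm).
rewrite (_ : (1 - n%:R) / 2 = 2^-1 + - (n%:R / 2)); last by field.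
rewrite powRD ?(gt_eqF m0) ?implybT// /kernel normrM.
rewrite [X in _ * X]ger0_norm ?profile_ge0// ler_wpM2r ?powR_ge0//.
rewrite powR12_sqrt; last exact: ltW.
apply: le_trans (ler_coord_enorm x l) _.
rewrite -(ger0_norm (enorm_ge0 x)) -sqrtr_sqr ler_wsqrtr//.
exact: smoothed_ge.
Qed.

Lemma norm_kernel_le_half a l x : 0 < a -> (0 < n)%N ->
  `|kernel a l x| <= (a / 2) `^ ((1 - n%:R) / 2).
Proof.
move=> a0 n0; apply: norm_kernel_le => //; first by rewrite divr_gt0.
exact: smoothed_ge_half.
Qed.

Lemma norm_dkernel a i l x : 0 < a ->
  `|dkernel a i l x| <= (1 + n%:R) * (a / 2) `^ (- (n%:R / 2)).
Proof.
move=> a0; rewrite mulrDl mul1r; apply: le_trans (ler_normD _ _) _; apply: lerD.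
  rewrite normrM (ger0_norm (profile_ge0 _ _ _)).
  apply: le_trans (profile_le n a0 (enorm x ^+ 2)).
  by rewrite ler_piMl ?profile_ge0//; case: eqP; rewrite ?normr1 ?normr0.
have D0 : `|2 * enorm x ^+ 2 * dprofile n a (enorm x ^+ 2)| <= n%:R * (a / 2) `^ (- (n%:R / 2)).
  apply: le_trans (norm_dprofile n a0 (sqr_ge0 (enorm x))) _.
  by rewrite ler_wpM2l// profile_le.
apply: le_trans D0; rewrite !normrM ler_wpM2r// -mulrA ler_wpM2l//.
by rewrite (ger0_norm (enorm_ge0 x)) ler_pM// ler_coord_enorm.
Qed.

End Kernel.

(** * Convolution *)

Section Convolution.
Context {R : realType} {n : nat}.
Local Notation mu := (lebesgue_row R n).
Implicit Types (x y z : 'rV[R]_n) (k m : 'rV[R]_n -> R).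

Lemma integrable_cube x (C a : R) :
  mu.-integrable setT (EFin \o (fun y => C * \1_(cube x a) y)).
Proof.
rewrite (_ : _ \o _ = (fun y => C%:E * (\1_(cube x a) y)%:E)%E); last first.
  by apply/funext => y /=; rewrite EFinM.
apply: integrableZl => //; apply/integrableP; split.
  by apply/measurable_EFinP; apply: measurable_indic; exact: measurable_cube.
rewrite (eq_integral (fun y => (\1_(cube x a) y)%:E)); last first.
  by move=> y _; rewrite gee0_abs// lee_fin.
rewrite integral_indic// ?setIT; last exact: measurable_cube.
have [a0|a0] := leP 0 a; first by rewrite lebesgue_cube// ltry.
apply: (@le_lt_trans _ _ (mu (cube x 0))).
  apply: le_measure; rewrite ?inE; [exact: measurable_cube..|].
  by move=> y xy i; rewrite (le_trans (xy i))// ltW.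
by rewrite lebesgue_cube ?lexx// ltry.
Qed.

Lemma Rintegral_cube x (a : R) : 0 <= a -> \int[mu]_y \1_(cube x a) y = (2 * a) ^+ n.
Proof.
move=> a0; rewrite /Rintegral integral_indic ?setIT ?lebesgue_cube//.
exact: measurable_cube.
Qed.

Lemma integrable_bounded_support k (C N : R) : measurable_fun setT k ->
  (forall y, `|k y| <= C) -> (forall y, N < enorm y -> k y = 0) ->
  mu.-integrable setT (EFin \o k).
Proof.
move=> mk kC k0; apply: (integrable_le mk) (integrable_cube 0 C N) => y.
rewrite indicE; have [yN|yN] := boolP (y \in cube 0 N); first by rewrite mulr1.
rewrite mulr0 k0 ?normr0// ltNge; apply/negP => {}yN'; move: yN.
rewrite notin_setE; apply => i; rewrite mxE sub0r normrN.
exact: le_trans (ler_coord_enorm _ _) yN'.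
Qed.

Definition conv k m x := \int[mu]_y (k (x - y) * m y).

Lemma continuous_subl k x : continuous k -> continuous (fun y => k (x - y)).
Proof.
move=> ck y; apply: (@continuous_comp _ _ _ (fun y => x - y) k); last exact: ck.
by apply: (@cvgB _ _ _ (nbhs y)); [exact: cvg_cst|exact: cvg_id].
Qed.

Lemma continuous_subr k y : continuous k -> continuous (fun x => k (x - y)).
Proof.
move=> ck x; apply: (@continuous_comp _ _ _ (fun x => x - y) k); last exact: ck.
by apply: (@cvgB _ _ _ (nbhs x)); [exact: cvg_id|exact: cvg_cst].
Qed.

Lemma measurable_subl k x : continuous k -> measurable_fun setT (fun y => k (x - y)).
Proof. by move=> ck; apply: continuous_measurable_row; exact: continuous_subl. Qed.

Lemma integrable_conv k m (C : R) x : continuous k -> (forall z, `|k z| <= C) ->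
  mu.-integrable setT (EFin \o m) ->
  mu.-integrable setT (EFin \o (fun y => k (x - y) * m y)).
Proof. by move=> ck kC; apply: (@integrable_bM _ _ _ _ C) => //; exact: measurable_subl. Qed.

Lemma integrable_scaled_norm (C : R) m : mu.-integrable setT (EFin \o m) ->
  mu.-integrable setT (EFin \o (fun y => C * `|m y|)).
Proof.
move=> im; rewrite (_ : _ \o _ = (fun y => C%:E * (`|m y|)%:E)%E); last first.
  by apply/funext => y /=; rewrite EFinM.
by apply: integrableZl => //; exact: integrable_norm im.
Qed.

Lemma continuous_conv k m (C : R) : continuous k -> (forall z, `|k z| <= C) ->
  mu.-integrable setT (EFin \o m) -> continuous (conv k m).
Proof.
move=> ck kC im x.
apply: (@continuous_Rintegral _ _ (fun x y => k (x - y) * m y) x 1 (fun y => C * `|m y|)) => //.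
- by move=> z _; exact: integrable_measurable (integrable_conv _ ck kC im).
- by move=> z y _; rewrite normrM ler_wpM2r.
- exact: integrable_scaled_norm.
- by move=> y; apply: continuousM_row; [exact: continuous_subr|exact: continuous_cst_row].
Qed.

Lemma is_derive_subr k dk v x y : is_derive (x - y) v k (dk (x - y)) ->
  is_derive x v (fun x => k (x - y)) (dk (x - y)).
Proof.
move=> /is_derive_line kd; apply/is_derive_line.
by rewrite [X in is_derive _ _ X](_ : _ = (fun h : R => k (h *: v + (x - y))))//; apply/funext =>
  h; rewrite addrA.
Qed.

Lemma is_derive_subl k dk v x y : is_derive (x - y) v k (dk (x - y)) ->
  is_derive y v (fun y => k (x - y)) (- dk (x - y)).
Proof.
move=> /is_derive_line kd; apply/is_derive_line.
have kd' : is_derive (- (0 : R)) 1 (fun h : R => k (h *: v + (x - y))) (dk (x - y)).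
  by rewrite oppr0.
have D := is_derive1_comp kd' (is_deriveNid (0 : R) 1).
rewrite [X in is_derive _ _ X](_ : _ = (fun h : R => k (h *: v + (x - y))) \o -%R); last first.
  by apply/funext => h /=; rewrite scaleNr opprD addrCA.
by apply: is_derive_eq D _; rewrite mulrN1.
Qed.

Lemma is_derive_conv k dk m v (C : R) x : continuous k -> (forall z, `|k z| <= C) ->
  (forall z, is_derive z v k (dk z)) -> (forall z, `|dk z| <= C) ->
  mu.-integrable setT (EFin \o m) ->
  is_derive x v (conv k m) (conv dk m x).
Proof.
move=> ck kC kd dkC im.
apply: (@is_derive_Rintegral _ _ (fun x y => k (x - y) * m y) (fun x y => dk (x - y) * m y)
   x v 1 (fun y => C * `|m y|)) => //.
- by move=> t _; exact: integrable_conv im.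
- move=> t y _; apply: is_derive_eq (is_deriveM_row (is_derive_subr (kd _)) (is_derive_cst (m y)
  _ _)) _.
  by rewrite mulr0 addr0.
- by move=> t y _; rewrite normrM ler_wpM2r.
- exact: integrable_scaled_norm.
Qed.

Lemma enorm_std_vec (i : 'I_n) : enorm (std_vec R i) = 1.
Proof.
apply/eqP; rewrite -(@eqrXn2 _ 2) ?enorm_ge0// sqr_enorm expr1n.
rewrite (bigD1 i)//= big1 => [|j /negPf ij]; rewrite !mxE ?eqxx ?ij/= ?expr0n//.
by rewrite addr0 expr1n.
Qed.

(** The difference of the two integrands is the derivative in direction i of y |-> k(x - y) f(y),
    the minus sign coming from the inner function x - y, and such a derivative has integral 0. *)
Lemma conv_by_parts k dk (f df : 'rV[R]_n -> R) (i : 'I_n) (C N : R) x :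
  continuous k -> (forall z, `|k z| <= C) ->
  continuous dk -> (forall z, is_derive z (std_vec R i) k (dk z)) -> (forall z, `|dk z| <= C) ->
  continuous f -> (forall z, `|f z| <= C) -> (forall z, N < enorm z -> f z = 0) ->
  continuous df -> (forall z, is_derive z (std_vec R i) f (df z)) ->
  (forall z, `|df z| <= C) -> (forall z, N < enorm z -> df z = 0) ->
  conv k df x = conv dk f x.
Proof.
move=> ck kC cdk kd dkC cf fC f0 cdf fd dfC df0.
have intf := integrable_bounded_support (continuous_measurable_row cf) fC f0.
have intdf := integrable_bounded_support (continuous_measurable_row cdf) dfC df0.
apply/eqP; rewrite -subr_eq0 /conv -RintegralB//; last 2 first.
- exact: integrable_conv intdf.
- exact: integrable_conv intf.
apply/eqP.
(* The majorant lives on a cube enlarged by 1, so that it also covers the translates by t with |t| <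
   1 along a unit vector. *)
apply: (@Rintegral_derive0 _ _ (fun y => k (x - y) * f y) _ (std_vec R i)
   (fun y => (C * C + C * C) * \1_(cube 0 (N + 1)) y)).
- exact: integrable_conv intf.
- move=> y; apply: is_derive_eq (is_deriveM_row (is_derive_subl (kd _)) (fd y)) _.
  by rewrite addrC mulNr.
- move=> t y t1; rewrite indicE; have [yN|yN] := boolP (y \in _).
    rewrite mulr1; apply: le_trans (ler_normB _ _) _.
    by rewrite !normrM lerD// ler_pM.
  have tyN : N < enorm (t *: std_vec R i + y).
    rewrite ltNge; apply/negP => tyN; move: yN; rewrite notin_setE; apply => j.
    rewrite mxE sub0r normrN (le_trans (ler_coord_enorm _ _))//.
    rewrite -[y in enorm y](addKr (t *: std_vec R i)) (le_trans (enormD _ _))//.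
    rewrite enormN enormZ enorm_std_vec mulr1 addrC; apply: lerD => //; exact: ltW.
  by rewrite f0// df0// !mulr0 subrr normr0.
- exact: integrable_cube.
Qed.

Lemma Rintegral_sum_row (I : finType) (f : I -> 'rV[R]_n -> R) :
  (forall j, mu.-integrable setT (EFin \o f j)) ->
  \int[mu]_y (\sum_j f j y) = \sum_j \int[mu]_y f j y.
Proof.
move=> fi.
suff [] : mu.-integrable setT (EFin \o (fun y => \sum_j f j y)) /\
  \int[mu]_y (\sum_j f j y) = \sum_j \int[mu]_y f j y by [].
elim: (index_enum I) => [|k s [IHi IHs]].
  rewrite big_nil (_ : (fun y => _) = cst 0); last by apply/funext => y; rewrite big_nil.
  split; first by rewrite (_ : _ \o _ = cst 0%E)//; exact: integrable0.
  by rewrite /Rintegral integral0_eq.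
rewrite (_ : (fun y => _) = (fun y => f k y + \sum_(j <- s) f j y)); last first.
  by apply/funext => y; rewrite big_cons.
split; first by have := integrableD measurableT (fi k) IHi; congr (mu.-integrable _ _).
by rewrite big_cons -IHs RintegralD.
Qed.

Lemma integrable_bump (a : R) : 0 < a -> mu.-integrable setT (EFin \o bump a).
Proof.
move=> a0; apply: (@integrable_bounded_support _ (n%:R * ((1 + n%:R) * (a / 2) `^ (- (n%:R /
  2)))) (Num.sqrt a)).
- exact: continuous_measurable_row (continuous_bump a0).
- move=> y; rewrite (le_trans (ler_norm_sum _ _ _))//.
  rewrite (le_trans (ler_sum _ (fun i _ => norm_dkernel i i y a0)))//.
  by rewrite sumr_const card_ord -[leLHS]mulr_natl.
- move=> y ay; rewrite bump0//.
  rewrite -(sqr_sqrtr (ltW a0)) ler_pXn2r ?nnegrE ?sqrtr_ge0 ?enorm_ge0//.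
  exact: ltW.
Qed.

Definition bump_mass := \int[mu]_y bump 1 y.

(** The difference of [bump a] and [bump 1] is the divergence of the difference of the two kernels,
    a C^1 field of bounded support because both equal the Cauchy kernel far out. Its integral is
    therefore 0. *)
Lemma Rintegral_bump (a : R) : 0 < a -> \int[mu]_y bump a y = bump_mass.
Proof.
move=> a0; apply/eqP; rewrite -subr_eq0 -RintegralB//; [|exact: integrable_bump..].
have dk1 b i y : 0 < b -> `|dkernel b i i y| <= (1 + n%:R) * (b / 2) `^ (- (n%:R / 2)).
  by move=> b0; exact: norm_dkernel.
pose N := Num.max (Num.sqrt a) 1.
have aN y : N < enorm y -> a <= enorm y ^+ 2 /\ 1 <= enorm y ^+ 2.
  rewrite gt_max => /andP[ay y1]; split.
    rewrite -(sqr_sqrtr (ltW a0)) ler_pXn2r ?nnegrE ?sqrtr_ge0 ?enorm_ge0//.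
    exact: ltW.
  by rewrite exprn_ege1// ltW.
pose C : R := \sum_(b <- [:: a; 1]) ((1 + n%:R) * (b / 2) `^ (- (n%:R / 2))
  + (b / 2) `^ ((1 - n%:R) / 2)).
pose g i y : R := dkernel a i i y - dkernel 1 i i y.
have gC i y : `|g i y| <= C.
  rewrite (le_trans (ler_normB _ _))// /C big_cons big_seq1.
  by apply: lerD; rewrite (le_trans (dk1 _ _ _ _))// lerDl powR_ge0.
have g0 i y : N < enorm y -> g i y = 0.
  by move=> /aN[ay y1]; rewrite /g (@dkernel_eq _ _ a 1)// subrr.
have ig i : mu.-integrable setT (EFin \o g i).
  apply: (integrable_bounded_support _ (gC i) (g0 i)).
  by apply: measurable_funB; apply: continuous_measurable_row; exact: continuous_dkernel.
have D0 i : \int[mu]_y g i y = 0.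
  have n0 : (0 < n)%N by case: (n) i => [[]|].
  apply: (@Rintegral_derive0 _ _ (fun y => kernel a i y - kernel 1 i y) _ (std_vec R i)
    (fun y => C * \1_(cube 0 (N + 1)) y)).
  - apply: (@integrable_bounded_support _ C N).
    + by apply: measurable_funB; apply: continuous_measurable_row; exact: continuous_kernel.
    + move=> y; rewrite (le_trans (ler_normB _ _))// /C big_cons big_seq1.
      by apply: lerD; rewrite (le_trans (norm_kernel_le_half _ _ _ _))// lerDr mulr_ge0 ?powR_ge0
        ?addr_ge0.
    + by move=> y /aN[ay y1]; rewrite (@kernel_eq _ _ a 1)// subrr.
  - by move=> z; apply: is_deriveB; exact: is_derive_kernel.
  - move=> t y t1; rewrite indicE; have [yN|yN] := boolP (y \in _); first by rewrite mulr1.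
    rewrite g0 ?normr0 ?mulr0//.
    rewrite ltNge; apply/negP => tyN; move: yN; rewrite notin_setE; apply => j.
    rewrite mxE sub0r normrN (le_trans (ler_coord_enorm _ _))//.
    rewrite -[y in enorm y](addKr (t *: std_vec R i)) (le_trans (enormD _ _))//.
    rewrite enormN enormZ enorm_std_vec mulr1 addrC; apply: lerD => //; exact: ltW.
  - exact: integrable_cube.
apply/eqP; transitivity (\int[mu]_y (\sum_i g i y)).
  by apply: eq_Rintegral => y _; rewrite /bump -sumrB.
by rewrite Rintegral_sum_row// big1.
Qed.

Lemma bump_mass_gt0 : (0 < n)%N -> 0 < bump_mass.
Proof.
move=> n0; have n0' : 0 < n%:R :> R by rewrite ltr0n.
(* On the cube of half-side t, |y|^2 <= n t^2 = 1/(4n) <= 1/2, the range in which [bump_ge] applies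
   with a = 1. *)
pose t : R := (2 * n%:R)^-1.
have t0 : 0 < t by rewrite invr_gt0 mulr_gt0.
pose c : R := n%:R * 1 `^ (- (n%:R / 2)) / 2.
have c0 : 0 < c by rewrite divr_gt0// mulr_gt0// powR_gt0.
apply: (@lt_le_trans _ _ (c * (2 * t) ^+ n)); first by rewrite mulr_gt0// exprn_gt0// mulr_gt0.
have itv := integrable_cube 0 1 t.
have ic : mu.-integrable setT (EFin \o \1_(cube (0 : 'rV[R]_n) t)).
  by move: itv; congr (mu.-integrable _ _); apply/funext => y /=; rewrite mul1r.
rewrite -(Rintegral_cube 0 (ltW t0)) -RintegralZl//.
apply: le_Rintegral => //; [exact: integrable_cube|exact: integrable_bump|].
move=> y _; rewrite indicE; have [yt|_] := boolP (y \in _); last first.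
  by rewrite mulr0; exact: bump_ge0.
rewrite mulr1; apply: bump_ge => //; rewrite sqr_enorm.
apply: (@le_trans _ _ (\sum_(i < n) t ^+ 2)).
  apply: ler_sum => i _; have := set_mem yt i; rewrite mxE sub0r normrN => yi.
  by rewrite -(real_normK (num_real _)) ler_pXn2r ?nnegrE// ltW.
rewrite sumr_const card_ord -[leLHS]mulr_natl /t.
have n1 : 1 <= n%:R :> R by rewrite ler1n.
rewrite [leLHS](_ : _ = n%:R^-1 / 4); last by field; rewrite gt_eqF.
have : n%:R^-1 <= 1 :> R by rewrite invf_le1.
lra.
Qed.

Lemma conv_bump_cst (a : R) x : 0 < a -> \int[mu]_y bump a (x - y) = bump_mass.
Proof.
move=> a0; rewrite -(Rintegral_bump a0).
rewrite -(Rintegral_row_shift (- x) (continuous_measurable_row (continuous_bump a0))).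
by apply: eq_Rintegral => y _; rewrite !bumpE enormBC.
Qed.

(** The bump centred at x vanishes for |x - y|^2 >= a; once a is below the square of a modulus of
    continuity of f at x, only values within e of f(x) are averaged. *)
Lemma conv_bump_approx (f : 'rV[R]_n -> R) (C : R) x (e : R) : continuous f ->
  (forall y, `|f y| <= C) -> 0 < e ->
  exists2 d, 0 < d & forall a, 0 < a -> a < d ->
    `|conv (bump a) f x - bump_mass * f x| <= e * bump_mass.
Proof.
move=> cf fC e0.
have [d d0 fd] := (@continuous_enormP _ _ _ f x).1 (cf x) e e0.
exists (d ^+ 2); first exact: exprn_gt0.
move=> a a0 ad.
have mb : measurable_fun setT (fun y => bump a (x - y)).
  by apply: measurable_subl; exact: continuous_bump.
have ib : mu.-integrable setT (EFin \o (fun y => bump a (x - y))).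
  have := integrable_row_shift (- x) (integrable_bump a0).
  congr (mu.-integrable _ _); apply/funext => y /=.
  by rewrite !bumpE enormBC.
have ibC (h : 'rV[R]_n -> R) (B : R) : measurable_fun setT h -> (forall y, `|h y| <= B) ->
    mu.-integrable setT (EFin \o (fun y => bump a (x - y) * h y)).
  move=> mh hB; have := integrable_bM mh hB ib.
  by congr (mu.-integrable _ _); apply/funext => y /=; rewrite mulrC.
rewrite /conv -(conv_bump_cst x a0) -RintegralZr//.
have i1 := ibC _ _ (continuous_measurable_row cf) fC.
have i2 := ibC (cst (f x)) `|f x| (measurable_cst _) (fun=> lexx _).
rewrite -RintegralB//.
have i3 : mu.-integrable setT (EFin \o (fun y => bump a (x - y) * f y - bump a (x - y) * f x)).
  have := integrableB measurableT i1 i2; congr (mu.-integrable _ _).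
rewrite (le_trans (le_normr_Rintegral _ _))// -RintegralZl//.
apply: le_Rintegral => //.
- exact: integrable_norm i3.
- have := integrableZl measurableT e ib; congr (mu.-integrable _ _).
move=> y _; rewrite -mulrBr normrM (ger0_norm (bump_ge0 _ a0)) mulrC.
have [xy|xy] := ltP (enorm (x - y)) d.
  by rewrite ler_wpM2r ?bump_ge0// distrC ltW// fd.
rewrite bump0 ?mulr0//; apply: le_trans (ltW ad) _.
by rewrite ler_pXn2r ?nnegrE ?enorm_ge0// ltW.
Qed.

End Convolution.

(** * Limits of regularised Cauchy transforms *)

Section GeometricLimit.
Context {R : realType} {n : nat}.

(** Telescoping bounds the distance from stage N to the limit by B q^N / (1 - q), uniformly in x,
    and a uniform limit of continuous functions is continuous. *)
Lemma geometric_limit (u : nat -> 'rV[R]_n -> R) (B q : R) : 0 <= q -> q < 1 ->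
  (forall j, continuous (u j)) -> (forall j x, `|u j.+1 x - u j x| <= B * q ^+ j) ->
  exists2 T : 'rV[R]_n -> R, continuous T & forall x, u j x @[j --> \oo] --> T x.
Proof.
move=> q0 q1 cu uB.
have B0 : 0 <= B by have := le_trans (normr_ge0 _) (uB 0%N 0); rewrite expr0 mulr1.
have cvgu x : cvgn (u ^~ x).
  have -> : u ^~ x = (fun j => u 0%N x + series (telescope (u ^~ x)) j).
    by apply/funext => j; rewrite -eq_sum_telescope.
  apply: is_cvgD; first exact: is_cvg_cst.
  apply: normed_cvg; apply: (@series_le_cvg _ _ (geometric B q)) => //.
  - by move=> j; exact: normr_ge0.
  - by move=> j; rewrite /geometric /= mulr_ge0// exprn_ge0.
  - by move=> j; exact: uB.
  - by apply: is_cvg_geometric_series; rewrite ger0_norm.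
pose T x := limn (u ^~ x); exists T => //.
have q1' : 0 < 1 - q by rewrite subr_gt0.
have tail N k x : `|u (N + k)%N x - u N x| <= B * q ^+ N * ((1 - q ^+ k) / (1 - q)).
  elim: k => [|k IHk]; first by rewrite addn0 subrr normr0 expr0 subrr mul0r mulr0.
  rewrite addnS -(subrKA (u (N + k)%N x)) (le_trans (ler_normD _ _))//.
  rewrite (le_trans (lerD (uB _ _) IHk))// exprD mulrA -mulrDr ler_wpM2l//.
    by rewrite mulr_ge0// exprn_ge0.
  rewrite -[X in X + _](mulfK (lt0r_neq0 q1')) -mulrDl ler_wpM2r ?invr_ge0 ?(ltW q1')//.
  by rewrite exprS; lra.
have tailT N x : `|T x - u N x| <= B / (1 - q) * q ^+ N.
  apply: (@closed_cvg _ _ (nbhs \oo) _ (fun j => `|u j x - u N x|) [set r | r <= B / (1 - q) * q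
    ^+ N]).
  - exact: closed_le.
  - exists N => // j /= Nj; rewrite -(subnKC Nj) (le_trans (tail _ _ _))//.
    rewrite mulrAC ler_wpM2r ?exprn_ge0// ler_wpM2l//.
    by rewrite ler_piMl ?invr_ge0 ?(ltW q1')// gerBl exprn_ge0.
  - by apply: cvg_norm; apply: cvgB; [exact: cvgu|exact: cvg_cst].
move=> x; apply/continuous_enormP => e e0.
have e3 : 0 < e / 3 by rewrite divr_gt0.
have [N NE] : exists N, B / (1 - q) * q ^+ N < e / 3.
  have /cvgrPdist_lt/(_ _ e3)[N _ /(_ N (leqnn _))] :
      geometric (B / (1 - q)) q j @[j --> \oo] --> 0.
    by apply: cvg_geometric; rewrite ger0_norm.
  by rewrite sub0r normrN => ?; exists N; rewrite (le_lt_trans (ler_norm _)).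
have [d d0 dE] := (continuous_enormP (u N) x).1 (cu N x) _ e3.
exists d => // y /dE; have := tailT N x; have := tailT N y.
rewrite !ler_norml !ltr_norml => /andP[? ?] /andP[? ?] /andP[? ?].
by apply/andP; split; lra.
Qed.

End GeometricLimit.

(** * Geometric convergence of the regularisations *)

Section SingularIntegral.
Context {R : realType} {n : nat} (n0 : (0 < n)%N).
Local Notation mu := (lebesgue_row R n).
Implicit Types (x y z : 'rV[R]_n) (f m : 'rV[R]_n -> R) (l i : 'I_n).

(** The kernels are parametrised by the square of a radius, so 4^(-j) corresponds to the radius
    2^(-j). *)
Definition dyadic j : R := (4^-1) ^+ j.

Lemma dyadic_gt0 j : 0 < dyadic j. Proof. by rewrite exprn_gt0// invr_gt0. Qed.

Lemma dyadicS j : dyadic j.+1 <= dyadic j.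
Proof.
rewrite /dyadic exprS ler_piMl ?exprn_ge0 ?invr_ge0//.
by rewrite invf_le1 ?ler1n.
Qed.

(* By optimising over the level t, integration over a cube of side h costs only a factor h^(n - n/q), as
   Hölder's inequality would give for f in L^q. *)
Definition interpolable f := mu.-integrable setT (EFin \o f) /\
  exists (w : 'rV[R]_n -> R) (A q : R), [/\ mu.-integrable setT (EFin \o w),
    (forall y, 0 <= w y), 0 <= A, n%:R < q &
    forall t y, 0 < t -> `|f y| <= A * (t + t `^ (1 - q) * w y)].

(** Consecutive kernels agree off the ball of radius b = 2^(-j) and are O(b^(1 - n)) inside it,
    while [interpolable] bounds the integral of |f| over the cube of half-side b by O(b^(n - s))
    with s = n / q. The product is O(b^(1 - s)), geometric in j because q > n. *)
Lemma conv_kernel_step f : interpolable f -> exists B q : R, [/\ 0 <= q, q < 1 &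
  forall l j x, `|conv (kernel (dyadic j.+1) l) f x - conv (kernel (dyadic j) l) f x| <= B * q ^+
    j].
Proof.
move=> [fi [w [A [q [wi w0 A0 nq fw]]]]].
have n0' : 0 < n%:R :> R by rewrite ltr0n.
have q0 : 0 < q by rewrite (lt_trans n0').
pose s : R := n%:R / q.
have s1 : s < 1 by rewrite ltr_pdivrMr// mul1r.
pose th : R := 2^-1 `^ (1 - s).
pose c : R := (1 - n%:R) / 2.
pose W := \int[mu]_y w y.
exists (2 * 8^-1 `^ c * A * (2 ^+ n + W)), th.
have half0 : 0 < 2^-1 :> R by rewrite invr_gt0.
split; first exact: powR_ge0.
  rewrite /th; have := @gt0_ltr_powR R (1 - s) _ 2^-1 1.
  rewrite powR1 !nnegrE => -> //; rewrite ?subr_gt0 ?(ltW half0)//.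
  by rewrite invf_lt1 ?ltr1n.
move=> l j x.
pose b : R := 2^-1 ^+ j.
have b0 : 0 < b by rewrite exprn_gt0.
have dE : dyadic j = b ^+ 2 by rewrite /dyadic /b -exprM mulnC exprM; congr (_ ^+ _); field.
have dE' : dyadic j.+1 = b ^+ 2 / 4 by rewrite -dE /dyadic exprS mulrC.
(* b^2 / 8 is half of the smaller of the two parameters, so that [norm_kernel_le_half] bounds both
   kernels by [C]. *)
pose C : R := (b ^+ 2 / 8) `^ c.
have c0 : c <= 0 by rewrite pmulr_lle0 ?invr_gt0// subr_le0 ler1n.
have kC k z : (k <= 1)%N -> `|kernel (dyadic (k + j)) l z| <= C.
  move=> k1; apply: (le_trans (norm_kernel_le_half _ _ (dyadic_gt0 _) n0)).
  apply: powR_neg_le => //; first by rewrite divr_gt0// exprn_gt0.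
  by case: k k1 => [|[|//]] _; rewrite ?add0n ?add1n ?dE ?dE'; have := exprn_gt0 2 b0; lra.
have ci k : mu.-integrable setT (EFin \o (fun y => kernel (dyadic k) l (x - y) * f y)).
  have kk := norm_kernel_le_half l _ (dyadic_gt0 k) n0.
  exact: integrable_conv x (continuous_kernel (dyadic_gt0 k)) kk fi.
rewrite /conv -RintegralB//.
(* The level that balances the two terms: t b^n and t^(1 - q) both equal b^(n - s). *)
pose t : R := b `^ (- s).
have t0 : 0 < t by rewrite powR_gt0.
pose H y := 2 * C * A * (t * \1_(cube x b) y + t `^ (1 - q) * w y).
have i1 : mu.-integrable setT (EFin \o (fun y => t `^ (1 - q) * w y)).
  by have := integrableZl measurableT (t `^ (1 - q)) wi; congr (mu.-integrable _ _).
have i2 : mu.-integrable setT (EFin \o (fun y => t * \1_(cube x b) y + t `^ (1 - q) * w y)).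
  by have := integrableD measurableT (integrable_cube x t b) i1; congr (mu.-integrable _ _).
have iH : mu.-integrable setT (EFin \o H).
  by have := integrableZl measurableT (2 * C * A) i2; congr (mu.-integrable _ _).
have i3 : mu.-integrable setT (EFin \o (fun y => kernel (dyadic j.+1) l (x - y) * f y
    - kernel (dyadic j) l (x - y) * f y)).
  by have := integrableB measurableT (ci j.+1) (ci j); congr (mu.-integrable _ _).
have ic : mu.-integrable setT (EFin \o \1_(cube x b)).
  have := integrable_cube x 1 b; congr (mu.-integrable _ _).
  by apply/funext => y /=; rewrite mul1r.
apply: (@le_trans _ _ (\int[mu]_y H y)).
  apply: le_trans (le_normr_Rintegral measurableT i3) _.
  apply: le_Rintegral => //; first exact: integrable_norm i3.
  move=> y _; rewrite -mulrBl normrM /H -[in leRHS]mulrA.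
  have D2 : `|kernel (dyadic j.+1) l (x - y) - kernel (dyadic j) l (x - y)| <= 2 * C.
    rewrite (le_trans (ler_normB _ _))// mulr_natl mulr2n.
    by apply: lerD; [exact: (kC 1%N)|exact: (kC 0%N)].
  have Aw0 : 0 <= A * (t * \1_(cube x b) y + t `^ (1 - q) * w y).
    by rewrite mulr_ge0// addr_ge0// mulr_ge0// ?powR_ge0// ltW.
  have [yb|yb] := boolP (y \in cube x b).
    by apply: ler_pM => //; rewrite indicE yb mulr1; exact: fw.
  have bxy : dyadic j <= enorm (x - y) ^+ 2.
    rewrite dE ler_pXn2r ?nnegrE ?enorm_ge0 ?(ltW b0)// leNgt; apply/negP => xyb.
    move: yb; rewrite notin_setE; apply => i.
    by have := ler_coord_enorm (x - y) i; rewrite !mxE => /le_trans; apply; exact: ltW.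
  rewrite (@kernel_eq _ _ (dyadic j.+1) (dyadic j)) ?dyadic_gt0//.
  + by rewrite subrr normr0 mul0r mulr_ge0// mulr_ge0// powR_ge0.
  + exact: le_trans (dyadicS j) bxy.
rewrite /H RintegralZl// RintegralD// ?RintegralZl//; last exact: integrable_cube.
rewrite Rintegral_cube ?(ltW b0)// -/W.
have bN : b != 0 by rewrite gt_eqF.
have thE : th ^+ j = b `^ (1 - s).
  by rewrite -powR_mulrn ?powR_ge0// /th powRAC powR_mulrn ?ltW.
have tb : t * (2 * b) ^+ n = 2 ^+ n * b `^ (n%:R - s).
  rewrite exprMn mulrCA -(powR_mulrn n (ltW b0)) /t -powRD ?bN ?implybT//.
  by rewrite addrC.
have tq : t `^ (1 - q) = b `^ (n%:R - s).
  by rewrite /t -powRrM; congr (_ `^ _); rewrite /s; field; rewrite gt_eqF.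
have CE : C = 8^-1 `^ c * b `^ (1 - n%:R).
  rewrite /C mulrC powRM ?invr_ge0 ?exprn_ge0 ?(ltW b0)//; congr (_ * _).
  rewrite -(powR_mulrn 2 (ltW b0)) -powRrM; congr (_ `^ _).
  by rewrite /c; field.
rewrite tb tq CE thE.
have bE : b `^ (1 - s) = b `^ (1 - n%:R) * b `^ (n%:R - s).
  by rewrite -powRD ?bN ?implybT//; congr (_ `^ _); ring.
by rewrite bE le_eqVlt; apply/orP; left; apply/eqP; ring.
Qed.

End SingularIntegral.

(** * Clifford-valued Cauchy transforms *)

Section CliffordCalculus.
Context {R : realType} {n : nat}.
Local Notation Cl := (clifford R n).
Local Notation gen := (@cliff_gen R n).
Implicit Types (x y : 'rV[R]_n) (i l : 'I_n).

(** Averaging the sum with its transpose replaces e_l e_i by half the anticommutator, which is -1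
    for l = i and 0 otherwise. *)
Lemma sum_sym_gen (c : 'I_n -> 'I_n -> R) : (forall l i, c l i = c i l) ->
  \sum_l \sum_i c l i *: (gen l * gen i) = (- \sum_i c i i)%:A.
Proof.
move=> cC.
have two : (2 : R) != 0 by rewrite pnatr_eq0.
apply: (scalerI two); rewrite -[2]/(1 + 1) scalerDl scale1r [X in X + _]exchange_big -big_split/=.
transitivity (\sum_l \sum_i c l i *: (gen i * gen l + gen l * gen i)).
  apply: eq_bigr => l _; rewrite -big_split/=; apply: eq_bigr => i _.
  by rewrite scalerDr cC.
transitivity (\sum_l (- 2 * c l l)%:A : Cl).
  apply: eq_bigr => l _; rewrite (bigD1 l)//= big1 => [|i /negPf il].
    by rewrite cliff_genC eqxx addr0 scalerA mulr1 mulrC.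
  by rewrite cliff_genC il mulr0 scale0r scaler0.
rewrite -scaler_suml scalerA; congr (_ *: _).
by rewrite -mulr_sumr; ring.
Qed.

Lemma continuous_sum_clifford (I : finType) (f : I -> 'rV[R]_n -> Cl) x :
  (forall k, {for x, continuous (f k)}) -> {for x, continuous (fun y => \sum_k f k y)}.
Proof.
move=> cf; elim: (index_enum I) => [|k s IHs].
  rewrite (_ : (fun y => _) = fun=> 0); last by apply/funext => y; rewrite big_nil.
  exact: (@cvg_cst _ _ _ (nbhs x)).
rewrite (_ : (fun y => _) = fun y => f k y + \sum_(k <- s) f k y).
  exact: (@cvgD _ _ _ (nbhs x) _ _ _ _ _ (cf k) IHs).
by apply/funext => y; rewrite big_cons.
Qed.

Lemma cvg_sum_clifford (T : Type) (F : set_system T) (FF : Filter F) (I : finType)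
    (f : I -> T -> Cl) (z : I -> Cl) :
  (forall k, f k x @[x --> F] --> z k) -> \sum_k f k x @[x --> F] --> \sum_k z k.
Proof.
move=> fz; elim: (index_enum I) => [|k s IHs].
  by rewrite big_nil; under eq_fun do rewrite big_nil; exact: cvg_cst.
rewrite big_cons; under eq_fun do rewrite big_cons.
exact: cvgD.
Qed.

Lemma continuous_scale_clifford (f : 'rV[R]_n -> R) (c : Cl) x :
  {for x, continuous f} -> {for x, continuous (fun y => f y *: c)}.
Proof. by move=> cf; exact: (@cvgZr_tmp _ _ _ (nbhs x) _ _ _ c cf). Qed.

Lemma is_derive_scale_clifford (f : 'rV[R]_n -> R) (c : Cl) x v df :
  is_derive x v f df -> is_derive x v (fun y => f y *: c) (df *: c).
Proof.
move=> [fd <-].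
have cvgf : h^-1 *: (((fun y => f y *: c) \o shift x) (h *: v) - f x *: c) @[h --> 0^'] --> 'D_v
  f x *: c.
  under eq_fun do rewrite /= -scalerBl scalerA.
  exact: cvgZr_tmp.
by split; [apply/cvg_ex; eexists; exact: cvgf|exact/cvg_lim].
Qed.

End CliffordCalculus.

Section CauchyTransform.
Context {R : realType} {n : nat} (n0 : (0 < n)%N).
Local Notation mu := (lebesgue_row R n).
Local Notation Cl := (clifford R n).
Local Notation gen := (@cliff_gen R n).
Implicit Types (x y : 'rV[R]_n) (i l : 'I_n) (F m : 'I_n -> 'rV[R]_n -> R).

(** The convolution of the Clifford-valued kernel, the sum of the K_l e_l, with the sum of the F_i
    e_i, which plays the role of the Dirac derivative of u. The kernel stands on the left, where the
    Dirac operator acts. *)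
Definition cauchy_stage (a : R) F x : Cl :=
  \sum_l \sum_i conv (kernel a l) (F i) x *: (gen l * gen i).

Lemma cauchy_stage_limit F : (forall i, interpolable (F i)) ->
  exists2 v : 'rV[R]_n -> Cl, continuous v &
    forall x, cauchy_stage (dyadic j) F x @[j --> \oo] --> v x.
Proof.
move=> iF.
have /choice[T TE] : forall li : 'I_n * 'I_n, exists T : 'rV[R]_n -> R, continuous T /\
    forall x, conv (kernel (dyadic j) li.1) (F li.2) x @[j --> \oo] --> T x.
  move=> [l i]; have [B [q [q0 q1 qB]]] := conv_kernel_step n0 (iF i).
  have [T cT TE] := @geometric_limit _ _ (fun j => conv (kernel (dyadic j) l) (F i)) B q q0 q1
    (fun j => continuous_conv (continuous_kernel (dyadic_gt0 j))
      (fun z => norm_kernel_le_half l z (dyadic_gt0 j) n0) (iF i).1) (qB l).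
  by exists T.
exists (fun x => \sum_l \sum_i T (l, i) x *: (gen l * gen i)).
  move=> x; apply: continuous_sum_clifford => l; apply: continuous_sum_clifford => i.
  exact/continuous_scale_clifford/(TE (l, i)).1.
move=> x; apply: cvg_sum_clifford => l; apply: cvg_sum_clifford => i.
apply: cvgZr_tmp; exact: (TE (l, i)).2 x.
Qed.

Lemma cauchy_stage_eq (a b d : R) F x : 0 < a -> 0 < b -> a <= d ^+ 2 -> b <= d ^+ 2 -> 0 < d ->
  (forall i y, enorm (x - y) < d -> F i y = 0) ->
  cauchy_stage a F x = cauchy_stage b F x.
Proof.
move=> a0 b0 ad bd d0 F0; rewrite /cauchy_stage.
apply: eq_bigr => l _; apply: eq_bigr => i _.
suff -> : conv (kernel a l) (F i) x = conv (kernel b l) (F i) x by [].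
apply: eq_Rintegral => y _; have [xy|xy] := ltP (enorm (x - y)) d.
  by rewrite F0// !mulr0.
have dd : d ^+ 2 <= enorm (x - y) ^+ 2 by rewrite ler_pXn2r ?nnegrE ?enorm_ge0// ltW.
by rewrite (kernel_eq l a0 b0 (le_trans ad dd) (le_trans bd dd)).
Qed.

Lemma dyadic_lt (e : R) : 0 < e -> exists N, forall j, (N <= j)%N -> dyadic j < e.
Proof.
move=> e0.
have /cvgrPdist_lt/(_ _ e0)[N _ NE] : geometric 1 (4^-1 : R) j @[j --> \oo] --> 0.
  by apply: cvg_geometric; rewrite ger0_norm ?invr_ge0// invf_lt1 ?ltr1n.
by exists N => j /NE; rewrite /= sub0r normrN mul1r ger0_norm// exprn_ge0.
Qed.

(** Once the smoothing radius is below d, the kernels matter only where they equal the Cauchy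
    kernel, so the sequence is eventually constant. This allows the limit to be differentiated where
    F vanishes. *)
Lemma cauchy_stage_cvg_eq (a d : R) F x : 0 < a -> a <= d ^+ 2 -> 0 < d ->
  (forall i y, enorm (x - y) < d -> F i y = 0) ->
  cauchy_stage (dyadic j) F x @[j --> \oo] --> cauchy_stage a F x.
Proof.
move=> a0 ad d0 F0; have [N NE] := dyadic_lt (exprn_gt0 2 d0).
apply: cvg_near_cst; exists N; first by [].
move=> j /= /NE jd.
by apply: (@cauchy_stage_eq _ _ d); rewrite ?dyadic_gt0// ltW.
Qed.

(** Integration by parts moves the derivative onto the kernel. The matrix [dkernel a i l] is
    symmetric, the kernel being a gradient field, so the products e_l e_i collapse and leave minus
    its trace, the divergence [bump a]. *)
Lemma cauchy_stage_parts (a : R) (f : 'rV[R]_n -> R) (df : 'I_n -> 'rV[R]_n -> R) (C N : R) x :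
  0 < a ->
  continuous f -> (forall z, `|f z| <= C) -> (forall z, N < enorm z -> f z = 0) ->
  (forall i, continuous (df i)) -> (forall i z, is_derive z (std_vec R i) f (df i z)) ->
  (forall i z, `|df i z| <= C) -> (forall i z, N < enorm z -> df i z = 0) ->
  cauchy_stage a df x = (- conv (bump a) f x)%:A.
Proof.
move=> a0 cf fC f0 cdf fd dfC df0.
have fi : mu.-integrable setT (EFin \o f).
  exact: integrable_bounded_support (continuous_measurable_row cf) fC f0.
pose C' : R := `|C| + (1 + n%:R) * (a / 2) `^ (- (n%:R / 2)) + (a / 2) `^ ((1 - n%:R) / 2).
have [C1 [C2 C3]] : C <= C' /\ (1 + n%:R) * (a / 2) `^ (- (n%:R / 2)) <= C' /\
    (a / 2) `^ ((1 - n%:R) / 2) <= C'.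
  have := ler_norm C; have := normr_ge0 C; have := powR_ge0 (a / 2) ((1 - n%:R) / 2).
  have : 0 <= (1 + n%:R) * (a / 2) `^ (- (n%:R / 2)) by rewrite mulr_ge0 ?powR_ge0 ?addr_ge0.
  by rewrite /C'; split; [|split]; lra.
have parts l i : conv (kernel a l) (df i) x = conv (dkernel a i l) f x.
  apply: (@conv_by_parts _ _ _ _ _ _ i C' N) => //.
  - exact: continuous_kernel.
  - by move=> z; apply: le_trans (norm_kernel_le_half _ _ a0 n0) C3.
  - exact: continuous_dkernel.
  - by move=> z; exact: is_derive_kernel.
  - by move=> z; apply: le_trans (norm_dkernel _ _ _ a0) C2.
  - by move=> z; exact: le_trans (fC z) C1.
  - by move=> z; exact: le_trans (dfC i z) C1.
  - exact: df0.
rewrite /cauchy_stage; under eq_bigr do under eq_bigr do rewrite parts.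
rewrite (@sum_sym_gen _ _ (fun l i => conv (dkernel a i l) f x)); last first.
  by move=> l i; apply: eq_Rintegral => y _; rewrite dkernelC.
congr ((- _)%:A); rewrite -Rintegral_sum_row => [|i].
  by apply: eq_Rintegral => y _; rewrite /bump mulr_suml.
exact: integrable_conv x (continuous_dkernel a0) (fun z => norm_dkernel _ _ z a0) fi.
Qed.

Lemma cauchy_stage_test (f : 'rV[R]_n -> R) (df : 'I_n -> 'rV[R]_n -> R) (C N : R) x :
  continuous f -> (forall z, `|f z| <= C) -> (forall z, N < enorm z -> f z = 0) ->
  (forall i, continuous (df i)) -> (forall i z, is_derive z (std_vec R i) f (df i z)) ->
  (forall i z, `|df i z| <= C) -> (forall i z, N < enorm z -> df i z = 0) ->
  cauchy_stage (dyadic j) df x @[j --> \oo] --> ((- (@bump_mass R n * f x))%:A : Cl).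
Proof.
move=> cf fC f0 cdf fd dfC df0.
under eq_fun => j do rewrite (cauchy_stage_parts x (dyadic_gt0 j) cf fC f0 cdf fd dfC df0).
apply: cvgZr_tmp; apply: cvgN.
have m0 := @bump_mass_gt0 R n n0.
apply/cvgrPdist_le => e e0.
have [d d0 dE] := conv_bump_approx x cf fC (divr_gt0 e0 m0).
have [J JE] := dyadic_lt d0.
exists J => // j /= /JE jd; rewrite distrC.
by apply: le_trans (dE _ (dyadic_gt0 j) jd) _; rewrite divfK// gt_eqF.
Qed.

Lemma cauchy_stage_derive (a : R) m x i : 0 < a ->
  (forall k, mu.-integrable setT (EFin \o m k)) ->
  is_derive x (std_vec R i) (cauchy_stage a m)
    (\sum_l \sum_k conv (dkernel a i l) (m k) x *: (gen l * gen k)).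
Proof.
move=> a0 im.
pose C' : R := (1 + n%:R) * (a / 2) `^ (- (n%:R / 2)) + (a / 2) `^ ((1 - n%:R) / 2).
have D l k : is_derive x (std_vec R i) (conv (kernel a l) (m k)) (conv (dkernel a i l) (m k) x).
  apply: (@is_derive_conv _ _ _ _ _ _ C') => //.
  - exact: continuous_kernel.
  - move=> z; apply: le_trans (norm_kernel_le_half _ _ a0 n0) _.
    by rewrite lerDr mulr_ge0 ?powR_ge0 ?addr_ge0.
  - by move=> z; exact: is_derive_kernel.
  - move=> z; apply: le_trans (norm_dkernel _ _ _ a0) _.
    by rewrite lerDl powR_ge0.
rewrite (_ : cauchy_stage a m = \sum_(l < n) \sum_(k < n)
    (fun y => conv (kernel a l) (m k) y *: (gen l * gen k))).
  by apply: is_derive_sum => l; apply: is_derive_sum => k; exact: is_derive_scale_clifford.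
apply/funext => y; rewrite fct_sumE; apply: eq_bigr => l _.
by rewrite fct_sumE.
Qed.

(** The symmetry of [dkernel] again reduces e_i e_l to minus the divergence, now convolved with
    [m k]. The bump at x is nonzero only for |x - y|^2 < a <= d^2, where [m k] vanishes. *)
Lemma cauchy_stage_dirac0 (a d : R) m x : 0 < a -> a <= d ^+ 2 -> 0 < d ->
  (forall k, mu.-integrable setT (EFin \o m k)) ->
  (forall k y, enorm (x - y) < d -> m k y = 0) ->
  \sum_i gen i * \sum_l \sum_k conv (dkernel a i l) (m k) x *: (gen l * gen k) = 0.
Proof.
move=> a0 ad d0 im m0.
transitivity (\sum_k (\sum_i \sum_l conv (dkernel a i l) (m k) x *: (gen i * gen l)) * gen k).
  under [RHS]eq_bigr => k _ do (rewrite mulr_suml; under eq_bigr do rewrite mulr_suml).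
  rewrite [RHS]exchange_big/=; apply: eq_bigr => i _.
  rewrite [RHS]exchange_big/= mulr_sumr; apply: eq_bigr => l _.
  rewrite mulr_sumr; apply: eq_bigr => k _.
  by rewrite -scalerAr -scalerAl mulrA.
rewrite big1// => k _; rewrite sum_sym_gen; last first.
  by move=> i l; apply: eq_Rintegral => y _; rewrite dkernelC.
rewrite -Rintegral_sum_row => [|i]; last first.
  exact: integrable_conv x (continuous_dkernel a0) (fun z => norm_dkernel _ _ z a0) (im k).
rewrite (@eq_Rintegral _ _ _ _ _ (cst 0)) => [|y _].
  by rewrite /Rintegral integral0_eq// oppr0 scale0r mul0r.
rewrite -mulr_suml; have [xy|xy] := ltP (enorm (x - y)) d; first by rewrite m0// mulr0.
have dd : d ^+ 2 <= enorm (x - y) ^+ 2 by rewrite ler_pXn2r ?nnegrE ?enorm_ge0// ltW.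
by have := bump0 a0 (le_trans ad dd); rewrite /bump => ->; rewrite mul0r.
Qed.

End CauchyTransform.

(** * Correcting a function to a monogenic one *)

Section CauchyCorrection.
Context {R : realType} {n : nat} (n2 : (2 <= n)%N).
Local Notation mu := (lebesgue_row R n).
Local Notation Cl := (clifford R n).
Local Notation gen := (@cliff_gen R n).
Implicit Types (x y : 'rV[R]_n) (i l : 'I_n) (F m : 'I_n -> 'rV[R]_n -> R).

Let n0 : (0 < n)%N. Proof. exact: ltnW. Qed.

(** For |y| <= N and |x| >= N + M the smoothed square of |x - y| is at least M^2, so the kernel is
    at most M^(1 - n) <= M^(-1); the last inequality is where n >= 2 enters. *)
Lemma conv_kernel_decay (f : 'rV[R]_n -> R) (N M : R) l x :
  mu.-integrable setT (EFin \o f) -> (forall y, N < enorm y -> f y = 0) ->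
  1 <= M -> N + M <= enorm x ->
  `|conv (kernel 1 l) f x| <= M^-1 * \int[mu]_y `|f y|.
Proof.
move=> fi f0 M1 Mx; have M0 : 0 < M by rewrite (lt_le_trans ltr01).
have ik := integrable_conv x (continuous_kernel ltr01)
  (fun z => norm_kernel_le_half l z ltr01 n0) fi.
apply: le_trans (le_normr_Rintegral measurableT ik) _.
rewrite -RintegralZl//; last exact: integrable_norm fi.
apply: le_Rintegral => //.
- exact: integrable_norm ik.
- exact: integrable_scaled_norm.
move=> y _; rewrite normrM; have [/f0 ->|yN] := ltP N (enorm y).
  by rewrite normr0 !mulr0.
rewrite ler_wpM2r//.
have xy : M <= enorm (x - y).
  have : enorm x <= enorm (x - y) + enorm y by rewrite (le_trans _ (enormD _ _))// subrK.
  by lra.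
have sm : M ^+ 2 <= smoothed 1 (enorm (x - y) ^+ 2).
  by apply: le_trans (smoothed_ge ltr01 _); rewrite ler_pXn2r ?nnegrE ?enorm_ge0// ltW.
apply: le_trans (norm_kernel_le l ltr01 n0 (exprn_gt0 2 M0) sm) _.
rewrite -(powR_mulrn 2 (ltW M0)) -powRrM -(powR_inv1 (ltW M0)).
apply: ler_powR => //.
rewrite (_ : 2%:R * _ = 1 - n%:R); last by field.
have : 2 <= n%:R :> R by rewrite ler_nat.
lra.
Qed.

(** Beyond |x| = N + 1 the limit equals the fixed stage a = 1, a finite sum of convolutions to which
    [conv_kernel_decay] applies. *)
Lemma cauchy_limit_at_infinity F (v : 'rV[R]_n -> Cl) (N : R) :
  (forall i, mu.-integrable setT (EFin \o F i)) ->
  (forall i y, N < enorm y -> F i y = 0) ->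
  (forall x, cauchy_stage (dyadic j) F x @[j --> \oo] --> v x) ->
  v @ @at_infinity R n --> 0.
Proof.
move=> iF F0 vE.
have vx x : N + 1 <= enorm x -> v x = cauchy_stage 1 F x.
  move=> xN; apply: (cvg_unique _ (vE x)) => //.
  apply: (@cauchy_stage_cvg_eq _ _ 1 1) => //; first by rewrite expr1n.
  move=> i y xy; apply: F0.
  have : enorm x <= enorm (x - y) + enorm y by rewrite (le_trans _ (enormD _ _))// subrK.
  by lra.
pose K : R := \sum_l \sum_i (\int[mu]_y `|F i y|) * `|gen l * gen i|.
have K0 : 0 <= K.
  by apply: sumr_ge0 => l _; apply: sumr_ge0 => i _; rewrite mulr_ge0// Rintegral_ge0.
have vK M x : 1 <= M -> N + M <= enorm x -> `|v x| <= M^-1 * K.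
  move=> M1 Mx; rewrite vx; last by lra.
  rewrite /K mulr_sumr; apply: le_trans (ler_norm_sum _ _ _) _; apply: ler_sum => l _.
  rewrite mulr_sumr; apply: le_trans (ler_norm_sum _ _ _) _; apply: ler_sum => i _.
  rewrite normrZ mulrA ler_wpM2r//.
  exact: (conv_kernel_decay l (iF i) (F0 i) M1 Mx).
apply/cvgrPdist_le => e e0.
pose M := 1 + K / e.
have Ke0 : 0 <= K / e by rewrite divr_ge0// ltW.
exists (N + M) => // x /= xM; rewrite sub0r normrN.
apply: le_trans (vK M x _ (ltW xM)) _; first by rewrite /M; lra.
rewrite mulrC ler_pdivrMr; last by rewrite /M; lra.
by rewrite /M mulrDr mulr1 mulrCA divff ?gt_eqF// mulr1; lra.
Qed.

Lemma monogenic_is_derive (S : set 'rV[R]_n) (w : 'rV[R]_n -> Cl) :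
  (forall x0, ~ S x0 -> exists Dw : 'I_n -> 'rV[R]_n -> Cl,
    [/\ \forall y \near x0, forall i, is_derive y (std_vec R i) w (Dw i y),
      forall i, {for x0, continuous (Dw i)} & \sum_i gen i * Dw i x0 = 0]) ->
  monogenic (~` S) w.
Proof.
move=> W; split => [i x0|x0] /W[Dw [/nbhs_enormP[d d0 wD] cD D0]];
  have xd : enorm (x0 - x0) < d by rewrite subrr enorm0.
  split; first by have [] := wD x0 xd i.
  apply/continuous_enormP => e e0.
  have [d' d'0 DE] := (continuous_enormP (Dw i) x0).1 (cD i) e e0.
  exists (Num.min d d'); first by rewrite lt_min d0.
  move=> y; rewrite lt_min => /andP[yd yd'].
  have [_ ->] := wD x0 xd i; have [_ ->] := wD y yd i.
  exact: DE.
rewrite -[RHS]D0 /dirac_op; apply: eq_bigr => i _.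
by have [_ ->] := wD x0 xd i.
Qed.

Lemma monogenic_near (S : set 'rV[R]_n) (w : 'rV[R]_n -> Cl) :
  (forall x0, ~ S x0 -> exists (d : R) (w' : 'rV[R]_n -> Cl) (Dw : 'I_n -> 'rV[R]_n -> Cl),
    [/\ 0 < d, forall y, enorm (x0 - y) < d -> w y = w' y,
      forall i x, is_derive x (std_vec R i) w' (Dw i x),
      forall i, {for x0, continuous (Dw i)} & \sum_i gen i * Dw i x0 = 0]) ->
  monogenic (~` S) w.
Proof.
move=> H; apply: monogenic_is_derive => x0 /H[d [w' [Dw [d0 ww' w'D cD D0]]]].
exists Dw; split => //; apply/nbhs_enormP; exists d => // y yd i.
apply: (@near_eq_is_derive _ _ _ w') => //.
apply/nbhs_enormP; exists (d - enorm (x0 - y)); first by rewrite subr_gt0.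
move=> z yz; apply/esym/ww'; apply: le_lt_trans (enorm_triangle y _ _) _.
by rewrite -ltrBrDl.
Qed.

(** F stands for the gradient of u off S. This is expressed through C^1 functions of bounded support
    that agree with u near a given point, because u and F may be irregular at S and the stages are
    computed by parts for such functions. *)
Theorem cauchy_correction (S : set 'rV[R]_n) (u : 'rV[R]_n -> R) F (N : R) :
  (forall i, interpolable (F i)) -> (forall i y, N < enorm y -> F i y = 0) ->
  (forall x0, ~ S x0 -> exists (f : 'rV[R]_n -> R) (df : 'I_n -> 'rV[R]_n -> R) (C N d : R),
    [/\ continuous f, forall z, `|f z| <= C & forall z, N < enorm z -> f z = 0] /\
    [/\ forall i, continuous (df i), forall i z, is_derive z (std_vec R i) f (df i z),
      forall i z, `|df i z| <= C & forall i z, N < enorm z -> df i z = 0] /\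
    [/\ 0 < d, forall y, enorm (x0 - y) < d -> f y = u y &
       forall i y, enorm (x0 - y) < d -> df i y = F i y]) ->
  exists v : 'rV[R]_n -> Cl, [/\ continuous v, v @ @at_infinity R n --> 0 &
    monogenic (~` S) (fun x => (u x)%:A - v x)].
Proof.
move=> iF F0 test.
have [v0 cv0 v0E] := cauchy_stage_limit n0 iF.
have m0 : 0 < @bump_mass R n by exact: bump_mass_gt0.
(* Plays the role of the reciprocal of the area of the unit sphere. The sign in [- c] compensates
   for e_i e_i = -1. *)
pose c : R := (@bump_mass R n)^-1.
exists (fun x => - c *: v0 x); split.
- by move=> x; apply: (@cvgZl_tmp _ _ _ (nbhs x)); exact: cv0.
- rewrite -(scaler0 _ (- c)); apply: cvgZl_tmp.
  exact: cauchy_limit_at_infinity (fun i => (iF i).1) F0 v0E.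
apply: monogenic_near => x0 /test[f [df [C [N' [d [[cf fC f0] [[cdf fd dfC df0] [d0 fu dfF]]]]]]]].
pose m i y : R := F i y - df i y.
have idf i : mu.-integrable setT (EFin \o df i).
  exact: integrable_bounded_support (continuous_measurable_row (cdf i)) (dfC i) (df0 i).
have im i : mu.-integrable setT (EFin \o m i).
  by have := integrableB measurableT (iF i).1 (idf i); congr (mu.-integrable _ _).
have d20 : 0 < d / 2 by rewrite divr_gt0.
have m0' x : enorm (x0 - x) < d / 2 -> forall i y, enorm (x - y) < d / 2 -> m i y = 0.
  move=> xd i y yd; rewrite /m dfF ?subrr//.
  by apply: le_lt_trans (enorm_triangle x _ _) _; lra.
(* For x within d / 2 of x0, [m] vanishes within d / 2 of x; the stage with this parameter is
   therefore already the limit for [m]. *)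
pose a : R := (d / 2) ^+ 2.
have a0 : 0 < a by exact: exprn_gt0.
have vE x : enorm (x0 - x) < d / 2 ->
    (u x)%:A - - c *: v0 x = c *: cauchy_stage a m x.
  move=> xd.
  (* In F = df + m, the part from df converges to minus the mass times f, and the part from m is
     eventually constant. Since f = u near x0, u - v is there c times a fixed stage of m. *)
  have E : v0 x = (- (@bump_mass R n * f x))%:A + cauchy_stage a m x.
    have L1 := @cauchy_stage_test _ _ n0 f df C N' x cf fC f0 cdf fd dfC df0.
    have L2 := @cauchy_stage_cvg_eq _ _ a (d / 2) m x a0 (lexx _) d20 (m0' x xd).
    have SE : (fun j => cauchy_stage (dyadic j) F x) = (fun j => cauchy_stage (dyadic j) df x +
      cauchy_stage (dyadic j) m x); last first.
      have L3 := v0E x; rewrite SE in L3.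
      exact: (cvg_unique _ L3 (cvgD L1 L2)).
    apply/funext => j; rewrite /cauchy_stage -big_split; apply: eq_bigr => l _.
    rewrite -big_split; apply: eq_bigr => i _ /=; rewrite -scalerDl.
    suff -> : conv (kernel (dyadic j) l) (F i) x =
       conv (kernel (dyadic j) l) (df i) x + conv (kernel (dyadic j) l) (m i) x by [].
    have ck := integrable_conv x (continuous_kernel (dyadic_gt0 j))
      (fun z => norm_kernel_le_half l z (dyadic_gt0 j) n0).
    rewrite /conv -RintegralD//; [|exact: ck (idf i)|exact: ck (im i)].
    by apply: eq_Rintegral => y _; rewrite /m; ring.
  rewrite E scaleNr opprK scalerDr addrA scalerA -scalerDl.
  rewrite fu; last by apply: lt_trans xd _; lra.
  by rewrite /c mulrN mulrA mulVf ?gt_eqF// mul1r subrr scale0r add0r.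
exists (d / 2), (fun x => c *: cauchy_stage a m x),
  (fun i x => c *: \sum_l \sum_k conv (dkernel a i l) (m k) x *: (gen l * gen k)); split => //.
- by move=> i x; apply: is_deriveZ; exact: cauchy_stage_derive.
- move=> i; apply: (@cvgZl_tmp _ _ _ (nbhs x0)).
  apply: continuous_sum_clifford => l; apply: continuous_sum_clifford => k.
  apply: continuous_scale_clifford.
  exact: continuous_conv (continuous_dkernel a0) (fun z => norm_dkernel _ _ z a0) (im k) x0.
under eq_bigr do rewrite -scalerAr.
rewrite -scaler_sumr (@cauchy_stage_dirac0 _ _ a (d / 2)) ?scaler0//.
by apply: m0'; rewrite subrr enorm0.
Qed.

End CauchyCorrection.

(** * Smooth extension from a closed set *)

Section Extension.
Context {R : realType} {n : nat} (S : set 'rV[R]_n) (S0 : S !=set0).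
Local Notation mu := (lebesgue_row R n).
Local Notation d x := (edist x S).
Implicit Types (x y : 'rV[R]_n) (i : 'I_n) (G : 'rV[R]_n -> R).

(* weight x y > 0 exactly when |x - y| < d(y)/2, which makes d(x) and d(y) comparable: averaging against it is
   a Whitney extension with the partition of unity replaced by a continuous family of bumps.  The scale factor
   d(y) is kept inside, undivided, so that weight x y = 0 for y in S, where d(y) = 0. *)
Definition weight x y := pospart (d y ^+ 2 - 4 * enorm (x - y) ^+ 2) ^+ 2.

Definition dweight i x y :=
  2 * pospart (d y ^+ 2 - 4 * enorm (x - y) ^+ 2) * (- 8 * (x - y) ord0 i).

Lemma weight_out x y : d y <= 2 * enorm (x - y) ->
  pospart (d y ^+ 2 - 4 * enorm (x - y) ^+ 2) = 0.
Proof.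
move=> dxy; rewrite pospart0// subr_le0 (_ : 4 * _ = (2 * enorm (x - y)) ^+ 2).
  by rewrite ler_pXn2r ?nnegrE ?mulr_ge0 ?enorm_ge0 ?edist_ge0.
by ring.
Qed.

Lemma weight_in x y : 2 * enorm (x - y) < d y ->
  [/\ d y <= 2 * d x, 2 * d x <= 3 * d y & enorm (x - y) <= d x].
Proof.
by move=> xy; have := edistD S0 x y; have := edistD S0 y x; rewrite [enorm (y - x)]enormBC => h1
  h2; split; lra.
Qed.

Lemma weight_pospart_le x y : 2 * enorm (x - y) < d y ->
  0 <= pospart (d y ^+ 2 - 4 * enorm (x - y) ^+ 2) <= 4 * d x ^+ 2.
Proof.
move=> xy; rewrite pospart_ge0/=.
have [h1 h2 h3] := weight_in xy; have e0 := enorm_ge0 (x - y).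
rewrite pospartE; first by nra.
by rewrite subr_ge0; nra.
Qed.

Lemma cube_enorm x y (a : R) : enorm (x - y) <= a -> cube x a y.
Proof. by move=> xy i; have := ler_coord_enorm (x - y) i; rewrite !mxE => /le_trans; apply. Qed.

Lemma weight_le x y : `|weight x y| <= 16 * d x ^+ 4 * \1_(cube x (d x)) y.
Proof.
have d0 := edist_ge0 S0 x.
have [xy|xy] := ltP (2 * enorm (x - y)) (d y); last first.
  by rewrite /weight weight_out// expr0n normr0 mulr_ge0// mulr_ge0// exprn_ge0.
have [_ _ /cube_enorm xd] := weight_in xy; have /andP[p0 p1] := weight_pospart_le xy.
rewrite indicE mem_set// mulr1 ger0_norm ?sqr_ge0//.
rewrite (_ : 16 * _ = (4 * d x ^+ 2) ^+ 2); last by ring.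
by rewrite ler_pXn2r ?nnegrE// (le_trans p0).
Qed.

Lemma dweight_le i x y : `|dweight i x y| <= 64 * d x ^+ 3 * \1_(cube x (d x)) y.
Proof.
have d0 := edist_ge0 S0 x.
have [xy|xy] := ltP (2 * enorm (x - y)) (d y); last first.
  by rewrite /dweight weight_out// mulr0 mul0r normr0 mulr_ge0// mulr_ge0// exprn_ge0.
have [_ _ xd] := weight_in xy; have /andP[p0 p1] := weight_pospart_le xy.
rewrite indicE (mem_set (cube_enorm xd)) mulr1 /dweight 3!normrM (ger0_norm p0).
rewrite normrN !normr_nat.
rewrite (_ : 64 * _ = 2 * (4 * d x ^+ 2) * (8 * d x)); last by ring.
rewrite ler_pM ?mulr_ge0// ?ler_wpM2l//.
exact: le_trans (ler_coord_enorm _ _) xd.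
Qed.

Lemma weight_ge0 x y : 0 <= weight x y. Proof. exact: sqr_ge0. Qed.

Lemma is_derive_weight i x y : is_derive x (std_vec R i) (weight ^~ y) (dweight i x y).
Proof.
have D1 : is_derive (x - y) (std_vec R i) (fun z : 'rV[R]_n => d y ^+ 2 - 4 * enorm z ^+ 2)
    ((fun z : 'rV[R]_n => - 8 * z ord0 i) (x - y)).
  have D := is_deriveM_row (is_derive_cst (4 : R) (x - y) (std_vec R i)) (is_derive_sqr_enorm i
    (x - y)).
  apply: is_derive_eq (is_deriveB (is_derive_cst (d y ^+ 2) _ _) D) _.
  by rewrite /=; ring.
have D2 := @is_derive_subr R n (fun z => d y ^+ 2 - 4 * enorm z ^+ 2) (fun z => - 8 * z ord0 i) _
  x y D1.
exact: is_derive_comp1 (is_derive_sqr_pospart (d y ^+ 2 - 4 * enorm (x - y) ^+ 2)) D2.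
Qed.

Let continuous_arg x : continuous (fun y => d y ^+ 2 - 4 * enorm (x - y) ^+ 2).
Proof.
rewrite (_ : (fun y => _) = fun y => d y * d y + (- 4) * enorm (x - y) ^+ 2); last first.
  by apply/funext => y; ring.
apply: continuousD_row; first by apply: continuousM_row; exact: continuous_edist.
apply: continuousM_row; first exact: continuous_cst_row.
exact: (@continuous_subl R n (fun z => enorm z ^+ 2) x (@continuous_sqr_enorm R n)).
Qed.

Let continuous_argl y : continuous (fun x => d y ^+ 2 - 4 * enorm (x - y) ^+ 2).
Proof.
rewrite (_ : (fun x => _) = fun x => d y ^+ 2 + (- 4) * enorm (x - y) ^+ 2); last first.
  by apply/funext => x; ring.
apply: continuousD_row; first exact: continuous_cst_row.
apply: continuousM_row; first exact: continuous_cst_row.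
exact: (@continuous_subr R n (fun z => enorm z ^+ 2) y (@continuous_sqr_enorm R n)).
Qed.

Let continuous_pospart_row (f : 'rV[R]_n -> R) : continuous f -> continuous (fun y => pospart (f
  y)).
Proof.
by move=> cf x; apply: (@continuous_comp _ _ _ f (@pospart R)); [exact: cf|exact:
  continuous_pospart].
Qed.

Lemma measurable_weight x : measurable_fun setT (weight x).
Proof.
apply: continuous_measurable_row.
by apply: continuousM_row; apply: continuous_pospart_row; exact: continuous_arg.
Qed.

Lemma measurable_dweight i x : measurable_fun setT (dweight i x).
Proof.
apply: continuous_measurable_row; apply: continuousM_row.
  apply: continuousM_row; first exact: continuous_cst_row.
  by apply: continuous_pospart_row; exact: continuous_arg.
apply: continuousM_row; first exact: continuous_cst_row.
exact: (@continuous_subl R n (fun z => z ord0 i) x (@continuous_coord R n i)).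
Qed.

Lemma continuous_weight y : continuous (weight ^~ y).
Proof. by apply: continuousM_row; apply: continuous_pospart_row; exact: continuous_argl. Qed.

Lemma continuous_dweight i y : continuous (dweight i ^~ y).
Proof.
apply: continuousM_row.
  apply: continuousM_row; first exact: continuous_cst_row.
  by apply: continuous_pospart_row; exact: continuous_argl.
apply: continuousM_row; first exact: continuous_cst_row.
exact: (@continuous_subr R n (fun z => z ord0 i) y (@continuous_coord R n i)).
Qed.

Definition wsum G x := \int[mu]_y (weight x y * G y).
Definition dwsum i G x := \int[mu]_y (dweight i x y * G y).

Section BoundedData.
Variables (G : 'rV[R]_n -> R) (B : R).
Hypothesis mG : measurable_fun setT G.
Hypothesis GB : forall y, `|G y| <= B.

Let B0 : 0 <= B. Proof. exact: le_trans (GB 0). Qed.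

Lemma integrable_weight x : mu.-integrable setT (EFin \o (fun y => weight x y * G y)).
Proof.
apply: (integrable_le _ _ (integrable_cube x (16 * d x ^+ 4 * B) (d x))).
  by apply: measurable_funM => //; exact: measurable_weight.
by move=> y; rewrite normrM mulrAC; apply: ler_pM => //; exact: weight_le.
Qed.

Lemma integrable_dweight i x : mu.-integrable setT (EFin \o (fun y => dweight i x y * G y)).
Proof.
apply: (integrable_le _ _ (integrable_cube x (64 * d x ^+ 3 * B) (d x))).
  by apply: measurable_funM => //; exact: measurable_dweight.
by move=> y; rewrite normrM mulrAC; apply: ler_pM => //; exact: dweight_le.
Qed.

(** Moving a point by at most 1 changes d by at most 1; this turns the bounds at z into one majorant
    on the unit ball about x, as dominated convergence requires. *)
Let near_cube x z y (K : R) (k : nat) : 0 <= K -> enorm (x - z) <= 1 ->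
  K * d z ^+ k * \1_(cube z (d z)) y <= K * (d x + 1) ^+ k * \1_(cube x (d x + 2)) y.
Proof.
move=> K0 xz; have dz : d z <= d x + 1.
  by rewrite (le_trans (edistD S0 z x))// lerD2l enormBC.
have dz0 := edist_ge0 S0 z; have dx0 := edist_ge0 S0 x.
have dx1 : 0 <= d x + 1 by rewrite addr_ge0.
apply: ler_pM => //; first by rewrite mulr_ge0// exprn_ge0.
  by rewrite ler_wpM2l// lerXn2r ?nnegrE.
rewrite !indicE; have [yz|//] := boolP (y \in cube z (d z)).
rewrite mem_set// => i; have := set_mem yz i.
have := ler_coord_enorm (x - z) i; rewrite !mxE => xi zi.
rewrite -(subrKA (z ord0 i)) (le_trans (ler_normD _ _))//.
by have := le_trans xi xz; lra.
Qed.

Lemma is_derive_wsum i x : is_derive x (std_vec R i) (wsum G) (dwsum i G x).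
Proof.
apply: (@is_derive_Rintegral _ _ (fun x y => weight x y * G y) (fun x y => dweight i x y * G y)
  x _ 1 (fun y => 64 * (d x + 1) ^+ 3 * B * \1_(cube x (d x + 2)) y)) => //.
- by move=> t _; exact: integrable_weight.
- move=> t y _.
  apply: is_derive_eq (is_deriveM_row (is_derive_weight i _ y) (is_derive_cst (G y) _ _)) _.
  by rewrite mulr0 addr0.
- move=> t y t1; rewrite normrM [leRHS]mulrAC; apply: ler_pM => //.
  apply: le_trans (dweight_le _ _ _) _; apply: near_cube => //.
  by rewrite opprD addrCA subrr addr0 enormN enormZ enorm_std_vec mulr1 ltW.
- exact: integrable_cube.
Qed.

Lemma continuous_wsum : continuous (wsum G).
Proof.
move=> x; apply: (@continuous_Rintegral _ _ (fun x y => weight x y * G y) x 1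
  (fun y => 16 * (d x + 1) ^+ 4 * B * \1_(cube x (d x + 2)) y)) => //.
- by move=> z _; exact: integrable_measurable (integrable_weight z).
- move=> z y xz; rewrite normrM [leRHS]mulrAC; apply: ler_pM => //.
  apply: le_trans (weight_le _ _) _; apply: near_cube => //.
  exact: ltW.
- exact: integrable_cube.
- by move=> y; apply: continuousM_row; [exact: continuous_weight|exact: continuous_cst_row].
Qed.

Lemma continuous_dwsum i : continuous (dwsum i G).
Proof.
move=> x; apply: (@continuous_Rintegral _ _ (fun x y => dweight i x y * G y) x 1
  (fun y => 64 * (d x + 1) ^+ 3 * B * \1_(cube x (d x + 2)) y)) => //.
- by move=> z _; exact: integrable_measurable (integrable_dweight i z).
- move=> z y xz; rewrite normrM [leRHS]mulrAC; apply: ler_pM => //.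
  apply: le_trans (dweight_le _ _ _) _; apply: near_cube => //.
  exact: ltW.
- exact: integrable_cube.
- by move=> y; apply: continuousM_row; [exact: continuous_dweight|exact: continuous_cst_row].
Qed.

End BoundedData.

End Extension.

(** * Normalised averages and their derivatives *)

Section WeightedAverage.
Context {R : realType} {n : nat} (n0 : (0 < n)%N) (S : set 'rV[R]_n) (S0 : S !=set0)
  (cS : closed S).
Local Notation mu := (lebesgue_row R n).
Local Notation d x := (edist x S).
Implicit Types (x y : 'rV[R]_n) (i : 'I_n) (G : 'rV[R]_n -> R).

Definition wtotal x := wsum S (fun=> 1) x.
Definition dwtotal i x := dwsum S i (fun=> 1) x.

Let m1 : measurable_fun setT (fun _ : 'rV[R]_n => 1 : R). Proof. exact: measurable_cst. Qed.
Let B1 (y : 'rV[R]_n) : `|1 : R| <= 1. Proof. by rewrite normr1. Qed.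

(** On the cube of half-side d(x) / (8 n) about x, |x - y| <= d(x) / 8, hence d(y) >= 7/8 d(x) and
    the weight is at least (d(x)^2 / 2)^2. The volume (d(x) / (4 n))^n supplies the other factor. *)
Definition wconst : R := (4 * n%:R)^-1 ^+ n / 4.

Lemma wconst_gt0 : 0 < wconst.
Proof. by rewrite divr_gt0// exprn_gt0// invr_gt0 mulr_gt0// ltr0n. Qed.

Lemma wtotal_ge x : wconst * d x ^+ (n + 4) <= wtotal x.
Proof.
have d0 := edist_ge0 S0 x.
have n0' : 0 < n%:R :> R by rewrite ltr0n.
pose t := d x / (8 * n%:R).
have t0 : 0 <= t by rewrite divr_ge0// mulr_ge0// ltW.
rewrite (_ : wconst * _ = d x ^+ 4 / 4 * (2 * t) ^+ n); last first.
  rewrite (_ : 2 * t = (4 * n%:R)^-1 * d x); last by rewrite /t; field; rewrite gt_eqF.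
  by rewrite /wconst exprMn exprD; ring.
rewrite -(Rintegral_cube x t0) -RintegralZl//; last first.
  by have := integrable_cube x 1 t; congr (mu.-integrable _ _); apply/funext => y /=; rewrite mul1r.
apply: le_Rintegral => //.
- exact: integrable_cube.
- exact: integrable_weight S0 _ _ m1 B1 x.
move=> y _; rewrite mulr1 indicE; have [yt|_] := boolP (y \in _); last first.
  by rewrite mulr0 weight_ge0.
have xy : enorm (x - y) <= d x / 8.
  rewrite -(@ler_pXn2r _ 2) ?nnegrE ?enorm_ge0 ?divr_ge0// sqr_enorm.
  rewrite (@le_trans _ _ (\sum_(i < n) t ^+ 2))//.
    apply: ler_sum => i _; have := set_mem yt i; rewrite !mxE => yi.
    by rewrite -(real_normK (num_real _)) ler_pXn2r ?nnegrE.
  rewrite sumr_const card_ord -[leLHS]mulr_natl.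
  have -> : n%:R * t ^+ 2 = n%:R^-1 * (d x / 8) ^+ 2 by rewrite /t; field; rewrite gt_eqF.
  by rewrite ler_piMl ?sqr_ge0// invf_le1// ler1n.
have dy : d x <= d y + enorm (x - y) by exact: edistD.
have e0 := enorm_ge0 (x - y).
have h : d x ^+ 2 / 2 <= d y ^+ 2 - 4 * enorm (x - y) ^+ 2.
  have h1 : (7 / 8 * d x) ^+ 2 <= d y ^+ 2.
    by rewrite ler_pXn2r ?nnegrE ?mulr_ge0 ?divr_ge0 ?edist_ge0//; lra.
  have h2 : enorm (x - y) ^+ 2 <= (d x / 8) ^+ 2 by rewrite ler_pXn2r ?nnegrE// divr_ge0.
  have h3 : 0 <= d x ^+ 2 by exact: sqr_ge0.
  have e1 : (7 / 8 * d x) ^+ 2 = 49 / 64 * d x ^+ 2 by field.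
  have e2 : (d x / 8) ^+ 2 = 1 / 64 * d x ^+ 2 by field.
  by move: h1 h2; rewrite e1 e2; lra.
have h0 : 0 <= d x ^+ 2 / 2 by rewrite divr_ge0// sqr_ge0.
rewrite mulr1 /weight pospartE; last exact: le_trans h.
rewrite (_ : d x ^+ 4 / 4 = (d x ^+ 2 / 2) ^+ 2); last by field.
by rewrite ler_pXn2r ?nnegrE// (le_trans h0).
Qed.

Lemma wtotal_gt0 x : ~ S x -> 0 < wtotal x.
Proof.
move=> /(edist_gt0 S0 cS) dx; apply: lt_le_trans (wtotal_ge x).
by rewrite mulr_gt0 ?wconst_gt0// exprn_gt0.
Qed.

Definition wavg G x := wsum S G x / wtotal x.
Definition dwavg i G x :=
  (dwsum S i G x * wtotal x - wsum S G x * dwtotal i x) / wtotal x ^+ 2.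

Section BoundedData.
Variables (G : 'rV[R]_n -> R) (B : R).
Hypothesis mG : measurable_fun setT G.
Hypothesis GB : forall y, `|G y| <= B.

Lemma is_derive_wavg i x : ~ S x -> is_derive x (std_vec R i) (wavg G) (dwavg i G x).
Proof.
move=> /wtotal_gt0 W0; have W0' : wtotal x != 0 by rewrite gt_eqF.
have D1 := is_derive_wsum S0 mG GB i x.
have D2 := is_derive_wsum S0 m1 B1 i x.
have D3 : is_derive x (std_vec R i) (fun x => (wtotal x)^-1) (- (wtotal x) ^- 2 * dwtotal i x).
  split; first exact: derivableV (W0') _.
  by rewrite (deriveV W0')//; have [_ ->] := D2.
apply: is_derive_eq (is_deriveM_row D1 D3) _.
by rewrite /dwavg /dwtotal; field.
Qed.

Let continuousV_at (f : 'rV[R]_n -> R) x : f x != 0 -> {for x, continuous f} ->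
  {for x, continuous (fun y => (f y)^-1)}.
Proof. by move=> f0 cf; exact: (@cvgV _ _ (nbhs x)). Qed.

Lemma continuous_wavg x : ~ S x -> {for x, continuous (wavg G)}.
Proof.
move=> /wtotal_gt0 W0; apply: (@cvgM _ _ (nbhs x)).
  exact: (continuous_wsum S0 mG GB).
apply: continuousV_at; first by rewrite gt_eqF.
exact: (continuous_wsum S0 m1 B1).
Qed.

Lemma continuous_dwavg i x : ~ S x -> {for x, continuous (dwavg i G)}.
Proof.
move=> /wtotal_gt0 W0; apply: (@cvgM _ _ (nbhs x)).
  apply: (@cvgB _ _ _ (nbhs x)); apply: (@cvgM _ _ (nbhs x)).
  - exact: (continuous_dwsum S0 mG GB).
  - exact: (continuous_wsum S0 m1 B1).
  - exact: (continuous_wsum S0 mG GB).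
  - exact: (continuous_dwsum S0 m1 B1).
apply: continuousV_at; first by rewrite expf_neq0// gt_eqF.
apply: (@cvgM _ _ (nbhs x)); exact: (continuous_wsum S0 m1 B1).
Qed.

Let wsum_sub x (a : R) : wsum S (fun y => G y - a) x = wsum S G x - a * wtotal x.
Proof.
rewrite /wtotal /wsum -RintegralZl//; last exact: integrable_weight S0 _ _ m1 B1 x.
rewrite -RintegralB//.
- by apply: eq_Rintegral => y _; ring.
- exact: integrable_weight S0 _ _ mG GB x.
- have := integrableZl measurableT a (integrable_weight S0 m1 B1 x).
  by congr (mu.-integrable _ _).
Qed.

Let dwsum_sub i x (a : R) : dwsum S i (fun y => G y - a) x = dwsum S i G x - a * dwtotal i x.
Proof.
rewrite /dwtotal /dwsum -RintegralZl//; last exact: integrable_dweight S0 _ _ m1 B1 i x.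
rewrite -RintegralB//.
- by apply: eq_Rintegral => y _; ring.
- exact: integrable_dweight S0 _ _ mG GB i x.
- have := integrableZl measurableT a (integrable_dweight S0 m1 B1 i x).
  by congr (mu.-integrable _ _).
Qed.

Let mGa (a : R) : measurable_fun setT (fun y => G y - a).
Proof. by apply: measurable_funB. Qed.

Let GBa (a : R) y : `|G y - a| <= B + `|a|.
Proof. by rewrite (le_trans (ler_normB _ _))// lerD. Qed.

Lemma wsum_bound x (a M : R) : (forall y, 2 * enorm (x - y) < d y -> `|G y - a| <= M) ->
  `|wsum S G x - a * wtotal x| <= M * wtotal x.
Proof.
move=> GM; rewrite -wsum_sub.
have ia := integrable_weight S0 (mGa a) (GBa a) x.
apply: le_trans (le_normr_Rintegral measurableT ia) _.
rewrite /wtotal /wsum -RintegralZl//; last exact: integrable_weight S0 _ _ m1 B1 x.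
apply: le_Rintegral => //; first exact: integrable_norm ia.
  have := integrableZl measurableT M (integrable_weight S0 m1 B1 x).
  by congr (mu.-integrable _ _).
move=> y _; rewrite normrM mulr1 (ger0_norm (weight_ge0 _ _ _)).
have [xy|xy] := ltP (2 * enorm (x - y)) (d y).
  by rewrite mulrC ler_wpM2r ?weight_ge0// GM.
by rewrite /weight weight_out// expr0n mul0r mulr0.
Qed.

Lemma dwsum_bound i x (a M : R) : 0 <= M ->
  (forall y, 2 * enorm (x - y) < d y -> `|G y - a| <= M) ->
  `|dwsum S i G x - a * dwtotal i x| <= M * (64 * 2 ^+ n * d x ^+ (n + 3)).
Proof.
move=> M0 GM; rewrite -dwsum_sub.
have ia := integrable_dweight S0 (mGa a) (GBa a) i x.
apply: le_trans (le_normr_Rintegral measurableT ia) _.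
have d0 := edist_ge0 S0 x.
rewrite (_ : M * _ = 64 * d x ^+ 3 * M * (2 * d x) ^+ n); last by rewrite exprD exprMn; ring.
rewrite -(Rintegral_cube x d0) -RintegralZl//; last first.
  by have := integrable_cube x 1 (d x); congr (mu.-integrable _ _); apply/funext => y /=; rewrite
    mul1r.
apply: le_Rintegral => //; first exact: integrable_norm ia.
  exact: integrable_cube.
move=> y _; rewrite normrM mulrAC.
have [xy|xy] := ltP (2 * enorm (x - y)) (d y).
  by apply: ler_pM => //; [exact: dweight_le|exact: GM].
rewrite /dweight weight_out// mulr0 mul0r normr0 mul0r.
by rewrite !mulr_ge0// exprn_ge0.
Qed.

Lemma wavg_bound x (a M : R) : ~ S x ->
  (forall y, 2 * enorm (x - y) < d y -> `|G y - a| <= M) -> `|wavg G x - a| <= M.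
Proof.
move=> /wtotal_gt0 W0 GM; have W0' : wtotal x != 0 by rewrite gt_eqF.
rewrite (_ : _ - a = (wsum S G x - a * wtotal x) / wtotal x); last first.
  by rewrite /wavg mulrBl mulfK.
by rewrite normrM normfV (gtr0_norm W0) ler_pdivrMr// wsum_bound.
Qed.

End BoundedData.

(** Twice the constant of [dwsum_bound], once for each term of the quotient rule, over the constant
    in the lower bound of [wtotal]. *)
Definition davg_const : R := 128 * 2 ^+ n / wconst.

Lemma davg_const_ge0 : 0 <= davg_const.
Proof. by rewrite divr_ge0 ?(ltW wconst_gt0)// mulr_ge0// exprn_ge0. Qed.

(** The average of a constant has derivative 0, so a may be subtracted from G in both terms of the
    numerator. There remains the bound M for G - a on the support of the weight, times d^(n + 3) /
    d^(n + 4). *)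
Lemma dwavg_bound G (B : R) i x (a M : R) : measurable_fun setT G ->
  (forall y, `|G y| <= B) -> ~ S x -> 0 <= M ->
  (forall y, 2 * enorm (x - y) < d y -> `|G y - a| <= M) ->
  `|dwavg i G x| <= davg_const * M / d x.
Proof.
move=> mG GB Sx M0 GM; have W0 := wtotal_gt0 Sx; have d0 := edist_gt0 S0 cS Sx.
have W0' : wtotal x != 0 by rewrite gt_eqF.
pose K := 64 * 2 ^+ n * d x ^+ (n + 3).
have K0 : 0 <= K by rewrite !mulr_ge0// exprn_ge0// ltW.
have h1 := wsum_bound mG GB GM.
have h2 := dwsum_bound mG GB i M0 GM.
have h3 : `|dwtotal i x| <= K.
  have G1 y : 2 * enorm (x - y) < d y -> `|(1 : R) - 0| <= 1 by rewrite subr0 normr1.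
  by have := dwsum_bound m1 B1 i ler01 G1; rewrite mul0r subr0 mul1r.
have -> : dwavg i G x = ((dwsum S i G x - a * dwtotal i x) * wtotal x -
    (wsum S G x - a * wtotal x) * dwtotal i x) / wtotal x ^+ 2.
  by rewrite /dwavg; congr (_ / _); ring.
rewrite normrM normfV (ger0_norm (sqr_ge0 _)) ler_pdivrMr ?exprn_gt0//.
apply: le_trans (ler_normB _ _) _; rewrite !normrM (gtr0_norm W0).
apply: (@le_trans _ _ (M * K * wtotal x + M * wtotal x * K)).
  apply: lerD; first by rewrite ler_wpM2r// ltW.
  by apply: ler_pM.
have -> : M * K * wtotal x + M * wtotal x * K = 2 * M * K * wtotal x by ring.
rewrite [wtotal x ^+ 2]expr2 [leRHS]mulrA ler_wpM2r ?(ltW W0)//.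
have wc := wconst_gt0.
have -> : davg_const * M / d x = 2 * M * K / (wconst * d x ^+ (n + 4)).
  rewrite /davg_const /K !exprD; field.
  by rewrite !(gt_eqF wc) ?(gt_eqF d0) ?expf_neq0// ?gt_eqF.
rewrite [leRHS]mulrAC ler_pdivlMr; last by rewrite mulr_gt0// exprn_gt0.
by rewrite ler_wpM2l ?wtotal_ge// mulr_ge0// mulr_ge0.
Qed.

Lemma wavg_eq0 G x : (forall y, 2 * enorm (x - y) < d y -> G y = 0) -> wavg G x = 0.
Proof.
move=> G0; rewrite /wavg /wsum (@eq_Rintegral _ _ _ _ _ (cst 0)) => [|y _].
  by rewrite /Rintegral integral0_eq// mul0r.
have [xy|xy] := ltP (2 * enorm (x - y)) (d y); first by rewrite G0// mulr0.
by rewrite /weight weight_out// expr0n mul0r.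
Qed.

Lemma dwavg_eq0 i G x : (forall y, 2 * enorm (x - y) < d y -> G y = 0) -> dwavg i G x = 0.
Proof.
move=> G0; have : wavg G x = 0 by exact: wavg_eq0.
rewrite /dwavg /dwsum (@eq_Rintegral _ _ _ _ _ (cst 0)) => [|y _].
  (* A zero average means that [wsum S G x] or [wtotal x] is 0. In the second case, which occurs on
     S, the quotient is 0 because the inverse of 0 is 0. *)
  rewrite /Rintegral integral0_eq// /wavg => /eqP; rewrite mulf_eq0 invr_eq0.
  by case/orP => /eqP ->; rewrite ?mul0r ?mulr0 ?subrr ?mul0r// expr0n/= invr0 mulr0.
have [xy|xy] := ltP (2 * enorm (x - y)) (d y); first by rewrite G0// mulr0.
by rewrite /dweight weight_out// mulr0 !mul0r.
Qed.

Lemma wavg_ext G G' x : (forall y, 2 * enorm (x - y) < d y -> G y = G' y) ->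
  wavg G x = wavg G' x /\ forall i, dwavg i G x = dwavg i G' x.
Proof.
move=> GG.
have E1 : wsum S G x = wsum S G' x.
  apply: eq_Rintegral => y _; have [xy|xy] := ltP (2 * enorm (x - y)) (d y).
    by rewrite GG.
  by rewrite /weight weight_out// expr0n !mul0r.
have E2 i : dwsum S i G x = dwsum S i G' x.
  apply: eq_Rintegral => y _; have [xy|xy] := ltP (2 * enorm (x - y)) (d y).
    by rewrite GG.
  by rewrite /dweight weight_out// mulr0 !mul0r.
by split => [|i]; rewrite /wavg /dwavg E1 ?E2.
Qed.

End WeightedAverage.

(** * Hölder data *)

Section Power.
Context {R : realType}.
Implicit Types a b t nu e : R.

Lemma powR_small nu e : 0 < nu -> 0 < e ->
  exists2 d, 0 < d & forall t, 0 <= t -> t < d -> t `^ nu < e.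
Proof.
move=> nu0 e0; exists (e `^ nu^-1); first exact: powR_gt0.
move=> t t0 te; have -> : e = (e `^ nu^-1) `^ nu.
  by rewrite -powRrM mulVf ?gt_eqF// powRr1// ltW.
by apply: gt0_ltr_powR => //; rewrite nnegrE// powR_ge0.
Qed.

(** The fractions a / (a + b) and b / (a + b) lie in [0, 1], so each is at most its power nu, and
    they add up to 1. Thus |x - y|^nu is a metric, on which McShane's formula relies. *)
Lemma powR_subadditive nu a b : 0 < nu -> nu <= 1 -> 0 <= a -> 0 <= b ->
  (a + b) `^ nu <= a `^ nu + b `^ nu.
Proof.
move=> nu0 nu1 a0 b0; have [ab|ab] := eqVneq (a + b) 0.
  by rewrite ab powR0 ?gt_eqF// addr_ge0// powR_ge0.
have s0 : 0 < a + b by rewrite lt_neqAle eq_sym ab addr_ge0.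
have h c : 0 <= c -> c <= a + b -> c / (a + b) * (a + b) `^ nu <= c `^ nu.
  rewrite le_eqVlt => /predU1P[<-|c0] cs; first by rewrite !mul0r powR_ge0.
  rewrite -[X in _ <= X `^ _](divfK ab c) powRM ?divr_ge0 ?(ltW s0) ?(ltW c0)//.
  rewrite ler_wpM2r ?powR_ge0//; apply: ger1_powR => //.
  by rewrite divr_gt0//= ler_pdivrMr// mul1r.
rewrite -[leLHS]mul1r -(divff ab) mulrDl mulrDl.
by apply: lerD; apply: h => //; rewrite ?lerDl ?lerDr.
Qed.

End Power.

Section HolderExtension.
Context {R : realType} {n : nat} (S : set 'rV[R]_n) (S0 : S !=set0).
Implicit Types (x y s t : 'rV[R]_n).

Lemma holder_within_continuous (f : 'rV[R]_n -> R) (M nu : R) x : 0 < nu ->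
  (forall y, `|f x - f y| <= M * enorm (x - y) `^ nu) -> {for x, continuous f}.
Proof.
move=> nu0 fM; apply/continuous_enormP => e e0.
have M0 : 0 < `|M| + 1 by rewrite ltr_wpDl.
have [d d0 dE] := powR_small nu0 (divr_gt0 e0 M0).
exists d => // y /(dE _ (enorm_ge0 _)); rewrite ltr_pdivlMr// => xy.
apply: le_lt_trans (fM y) _; apply: le_lt_trans xy.
by rewrite mulrC ler_wpM2l ?powR_ge0// (le_trans (ler_norm _))// lerDl.
Qed.

Variables (g : 'rV[R]_n -> R) (M nu : R).
Hypotheses (M0 : 0 <= M) (nu0 : 0 < nu) (nu1 : nu <= 1).
Hypothesis gM : forall x y, S x -> S y -> `|g x - g y| <= M * enorm (x - y) `^ nu.

Definition mcshane y := inf [set g s + M * enorm (y - s) `^ nu | s in S].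

Let powR_triangle x y s :
  M * enorm (x - s) `^ nu <= M * enorm (x - y) `^ nu + M * enorm (y - s) `^ nu.
Proof.
rewrite -mulrDr ler_wpM2l//; apply: le_trans (powR_subadditive nu0 nu1 _ _).
- apply: ge0_ler_powR; rewrite ?(ltW nu0)// ?nnegrE ?addr_ge0 ?enorm_ge0//.
  exact: enorm_triangle.
- exact: enorm_ge0.
- exact: enorm_ge0.
Qed.

Let lower y s t : S s -> S t -> g s - M * enorm (y - s) `^ nu <= g t + M * enorm (y - t) `^ nu.
Proof.
move=> Ss St; have := powR_triangle s y t; rewrite [enorm (s - y)]enormBC => h.
rewrite lerBlDr -addrA -lerBlDl; apply: le_trans (ler_norm _) _.
by apply: le_trans (gM Ss St) _; rewrite [leRHS]addrC.
Qed.

Let inf_nonempty y : [set g s + M * enorm (y - s) `^ nu | s in S] !=set0.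
Proof. by case: S0 => s Ss; exists (g s + M * enorm (y - s) `^ nu); exists s. Qed.

Let lb y : has_lbound [set g s + M * enorm (y - s) `^ nu | s in S].
Proof.
case: S0 => s Ss; exists (g s - M * enorm (y - s) `^ nu) => _ [t St <-].
exact: lower.
Qed.

Lemma mcshane_near y s : S s -> `|mcshane y - g s| <= M * enorm (y - s) `^ nu.
Proof.
move=> Ss; rewrite ler_distl; apply/andP; split.
  by apply: lb_le_inf => // _ [t St <-]; exact: lower.
by apply: ge_inf => //; exists s.
Qed.

Let mcshane_le x y : mcshane x <= mcshane y + M * enorm (x - y) `^ nu.
Proof.
rewrite -lerBlDr; apply: lb_le_inf => // _ [s Ss <-]; rewrite lerBlDr.
apply: (@le_trans _ _ (g s + M * enorm (x - s) `^ nu)); first by apply: ge_inf => //; exists s.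
by rewrite -addrA lerD2l addrC; exact: powR_triangle.
Qed.

Lemma continuous_mcshane : continuous mcshane.
Proof.
move=> x; apply: (@holder_within_continuous _ M nu) => // y.
have := mcshane_le x y; have := mcshane_le y x; rewrite [enorm (y - x)]enormBC.
move: (M * _) (mcshane x) (mcshane y) => c a b h1 h2.
by rewrite ler_norml; apply/andP; split; lra.
Qed.

End HolderExtension.

(** * The two sides of S *)

Section Sides.
Context {R : realType} {n : nat} (S U V : set 'rV[R]_n).
Hypotheses (oU : open U) (oV : open V) (UV0 : forall x, U x -> V x -> False)
  (UVS : forall x, ~ S x -> U x \/ V x).
Implicit Types (x y : 'rV[R]_n).

(** A segment that avoids S is covered by the disjoint open sets U and V; being connected, it lies
    in the one that contains y. *)
Lemma segment_same_side x y :
  (forall t : R, 0 <= t -> t <= 1 -> ~ S (y + t *: (x - y))) -> U y -> U x.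
Proof.
move=> yxS Uy; pose f (t : R) : 'rV[R]_n := y + t *: (x - y).
have cf : continuous f.
  by move=> t; apply: cvgD; [exact: cvg_cst|apply: cvgZr_tmp; exact: cvg_id].
pose A := f @` `[0, 1].
have cA : connected A.
  apply: connected_continuous_connected; first exact: segment_connected.
  exact: continuous_subspaceT.
have A0 : A y by exists 0; [rewrite /= in_itv/= lexx ler01|rewrite /f scale0r addr0].
have A1 : A x by exists 1; [rewrite /= in_itv/= lexx ler01|rewrite /f scale1r addrC subrK].
have AS z : A z -> ~ S z.
  by move=> [t]; rewrite /= in_itv/= => /andP[t0 t1] <-; exact: yxS.
have E : A `&` U = A.
  apply: cA; first by exists y.
  - by exists U.
  - exists (~` V); first exact: open_closedC.
    apply/seteqP; split => z [Az]; first by move=> Uz; split => // /(UV0 Uz).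
    by move=> nVz; split => //; have [|/nVz] := UVS (AS z Az).
by have : A x := A1; rewrite -E => -[].
Qed.

Lemma ball_same_side x y : U y -> enorm (x - y) < edist y S -> U x.
Proof.
move=> Uy xy; apply: segment_same_side Uy => t t0 t1 /(edist_le y).
rewrite opprD addNKr enormN enormZ ger0_norm// leNgt => /negP; apply.
by apply: le_lt_trans xy; rewrite ler_piMl// enorm_ge0.
Qed.

End Sides.

(** * The jump problem *)

Lemma within_continuous_enorm {R : realType} {n : nat} (W : normedModType R)
    (A : set 'rV[R]_n) (f : 'rV[R]_n -> W) :
  (forall x, A x -> forall e : R, 0 < e ->
    exists2 d, 0 < d & forall y, A y -> enorm (x - y) < d -> `|f x - f y| < e) ->
  {within A, continuous f}.
Proof.
move=> h; apply/subspace_continuousP => x Ax.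
apply/(@cvgrPdist_lt _ _ _ (within A (nbhs x)) _) => e /(h x Ax)[d d0 dE].
rewrite near_withinE; apply/nbhs_enormP; exists d => // y xy Ay.
exact: dE.
Qed.

Section ScalarJump.
Context {R : realType} {n : nat} (n2 : (2 <= n)%N) (S U V : set 'rV[R]_n).
Local Notation mu := (lebesgue_row R n).
Local Notation d x := (edist x S).
Local Notation Cl := (clifford R n).
Implicit Types (x y s : 'rV[R]_n) (i : 'I_n).

Hypotheses (S0 : S !=set0) (cS : closed S) (oU : open U) (oV : open V)
  (UV0 : forall x, U x -> V x -> False) (UVS : forall x, ~ S x -> U x \/ V x)
  (US : forall x, U x -> ~ S x).
Variables (N0 : R).
Hypothesis SN0 : forall s, S s -> enorm s <= N0.
Variables (g : 'rV[R]_n -> R) (M nu : R).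
Hypotheses (M0 : 0 <= M) (nu0 : 0 < nu) (nu1 : nu <= 1).
Hypothesis gM : forall x y, S x -> S y -> `|g x - g y| <= M * enorm (x - y) `^ nu.
Variables (del : R) (D : set 'rV[R]_n) (p : R).
Hypotheses (del0 : 0 < del) (mD : measurable D) (UD : forall x, U x -> d x < 2 * del -> D x)
  (np : n%:R * (1 - nu) < p) (pD : (dist_integral S p D < +oo)%E).

Let n0 : (0 < n)%N. Proof. exact: ltnW. Qed.

(** The data are cut off at distance [del]. Averaging spreads them only over points with d < 2
    [del], since d(y) >= 2/3 d(x) on the support of the weight; this is why [D] is to contain the
    wider layer. *)
Let layer := [set y | U y /\ d y < del].

(** The cut-off may be a sharp indicator because the average of a bounded measurable function is C^1
    off S. *)
Definition layer_data y := mcshane S g M nu y * \1_layer y.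
Local Notation G := layer_data.

Let mlayer : measurable layer.
Proof.
rewrite (_ : layer = U `&` ((fun y => d y) @^-1` [set t | t < del]))//.
apply: open_measurable_row; apply: openI => //.
apply: open_comp; last exact: open_lt.
by move=> x _; exact: continuous_edist.
Qed.

Let mG : measurable_fun setT G.
Proof.
apply: measurable_funM; last exact: measurable_indic.
by apply: continuous_measurable_row; exact: continuous_mcshane.
Qed.

Let N0_ge0 : 0 <= N0.
Proof. by case: S0 => s /SN0; apply: le_trans; exact: enorm_ge0. Qed.

Let powR_le (a b : R) : 0 <= a -> a <= b -> a `^ nu <= b `^ nu.
Proof. by move=> a0 ab; apply: ge0_ler_powR; rewrite ?nnegrE ?(ltW nu0)// (le_trans a0). Qed.

Let G_near y s : U y -> d y < del -> S s -> `|G y - g s| <= M * enorm (y - s) `^ nu.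
Proof.
move=> Uy yd Ss; rewrite /G indicE mem_set// mulr1.
by apply: (mcshane_near S0 M0 nu0 nu1 gM).
Qed.

Let G_out y : ~ U y \/ del <= d y -> G y = 0.
Proof.
move=> nl; rewrite /G indicE memNset ?mulr0// => -[Uy]; case: nl => // yd.
by rewrite ltNge yd.
Qed.

Let G_bounded : exists B : R, forall y, `|G y| <= B.
Proof.
case: S0 => s0 Ss0; exists (`|g s0| + M * (2 * N0) `^ nu + M * del `^ nu) => y.
have [[Uy yd]|nl] := pselect (layer y); last first.
  rewrite G_out ?normr0 ?addr_ge0 ?mulr_ge0 ?powR_ge0//.
  by have [Uy|] := pselect (U y); [right; rewrite leNgt; apply/negP => yd; exact: nl|left].
have [s Ss ys] := edist_lt S0 yd.
have h1 := le_trans (G_near Uy yd Ss) (ler_wpM2l M0 (powR_le (enorm_ge0 _) (ltW ys))).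
have h2 : `|g s - g s0| <= M * (2 * N0) `^ nu.
  apply: le_trans (gM Ss Ss0) _; rewrite ler_wpM2l// powR_le ?enorm_ge0//.
  rewrite (le_trans (enormD _ _))// enormN mulr_natl mulr2n.
  by rewrite lerD ?SN0.
rewrite -(subrK (g s) (G y)) -[X in _ + X](subrK (g s0)).
apply: le_trans (ler_normD _ _) _; rewrite [leRHS]addrC; apply: lerD h1 _.
by apply: le_trans (ler_normD _ _) _; rewrite addrC; exact: lerD.
Qed.

Let B : R := sval (cid G_bounded).
Let GB y : `|G y| <= B. Proof. by rewrite /B; case: cid. Qed.
Let B0 : 0 <= B. Proof. exact: le_trans (GB 0). Qed.

Definition layer_avg := wavg S G.
Local Notation u := layer_avg.
Let F i := dwavg S i G.

(** The open ball of radius d(y) about y avoids S and contains x. Averaging therefore never mixes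
    the two sides, and u vanishes off U. *)
Let side x y : 2 * enorm (x - y) < d y -> U x <-> U y.
Proof.
move=> xy; have e0 := enorm_ge0 (x - y).
have xy' : enorm (x - y) < d y by lra.
have nSy : ~ S y by move=> Sy; move: xy'; rewrite (edist0 S0 Sy) ltNge e0.
split; last by move=> Uy; exact: (ball_same_side oU oV UV0 UVS Uy xy').
move=> Ux; have [//|Vy] := UVS nSy; exfalso.
have VU0 z : V z -> U z -> False by move=> Vz Uz; exact: UV0 Vz.
have VUS z : ~ S z -> V z \/ U z by move=> /UVS[]; [right|left].
exact: UV0 Ux (ball_same_side oV oU VU0 VUS Vy xy').
Qed.

Let out x : ~ U x \/ 2 * del <= d x -> forall y, 2 * enorm (x - y) < d y -> G y = 0.
Proof.
move=> xo y xy; apply: G_out; have [_ h _] := weight_in S0 xy.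
case: xo => [nUx|xd]; first by left => /(side xy).
by right; have := del0; lra.
Qed.

Let u0 x : ~ U x \/ 2 * del <= d x -> u x = 0.
Proof. by move=> /out; exact: wavg_eq0. Qed.

Let F0 i x : ~ U x \/ 2 * del <= d x -> F i x = 0.
Proof. by move=> /out; exact: dwavg_eq0. Qed.

Let N : R := N0 + 2 * del.

Let far x : N < enorm x -> 2 * del <= d x.
Proof.
move=> xN; apply: edist_ge => // s /SN0 sN.
have : enorm x <= enorm (x - s) + enorm s by rewrite (le_trans _ (enormD _ _))// subrK.
by move: xN; rewrite /N; lra.
Qed.

(** Gives the boundary value of u. A point y averaged at x satisfies |x - y| <= d(x) <= |x - s|, so
    it lies within 2 |x - s| of s, and the closeness of x to s keeps y inside the layer. *)
Let u_near x s : U x -> enorm (x - s) < del / 2 -> S s -> `|u x - g s| <= M * (2 * enorm (x - s))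
  `^ nu.
Proof.
move=> Ux xs Ss; apply: (wavg_bound n0 S0 cS mG GB (US Ux)) => y xy.
have [h1 _ h3] := weight_in S0 xy; have h4 := edist_le x Ss.
have yd : d y < del by lra.
apply: le_trans (G_near ((side xy).1 Ux) yd Ss) _; rewrite ler_wpM2l// powR_le ?enorm_ge0//.
have : enorm (y - s) <= enorm (y - x) + enorm (x - s) by exact: enorm_triangle.
by rewrite [enorm (y - x)]enormBC; lra.
Qed.

Let avg_bound : exists K : R, 0 <= K /\ forall i x (a M' : R), ~ S x -> 0 <= M' ->
  (forall y, 2 * enorm (x - y) < d y -> `|G y - a| <= M') -> `|F i x| <= K * M' / d x.
Proof.
exists (@davg_const R n); split; first exact: davg_const_ge0.
by move=> i x a M' Sx M'0 GM'; exact: (dwavg_bound n0 S0 cS i mG GB Sx M'0 GM').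
Qed.

Let K : R := sval (cid avg_bound).
Let K0 : 0 <= K. Proof. by rewrite /K; case: cid => ? []. Qed.
Let F_bound i x (a M' : R) : ~ S x -> 0 <= M' ->
  (forall y, 2 * enorm (x - y) < d y -> `|G y - a| <= M') -> `|F i x| <= K * M' / d x.
Proof. exact: (svalP (cid avg_bound)).2. Qed.

(** The first term is for d(x) < [del] / 2: averaged points then lie within 3 d(x) of a point s of S
    at distance less than 2 d(x) from x. The second is for d(x) >= [del] / 2, where 1 <= ([del] /
    2)^(-nu) d(x)^nu. *)
Let A : R := K * (M * 3 `^ nu + B * (del / 2) `^ (- nu)).

Let A0 : 0 <= A.
Proof. by rewrite mulr_ge0// addr_ge0// mulr_ge0// powR_ge0. Qed.

Let F_le i x : U x -> `|F i x| <= A * d x `^ (nu - 1).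
Proof.
move=> Ux; have nSx := US Ux; have dx := edist_gt0 S0 cS nSx.
have dn : d x != 0 by rewrite gt_eqF.
have E : d x `^ nu / d x = d x `^ (nu - 1).
  by rewrite powRB ?dn ?implybT// powRr1// ltW.
have [xd|xd] := ltP (d x) (del / 2); last first.
  apply: le_trans (F_bound i (a := 0) nSx B0 _) _.
    by move=> y _; rewrite subr0; exact: GB.
  rewrite /A mulrDr mulrDl -[leLHS]add0r; apply: lerD.
    apply: mulr_ge0; last exact: powR_ge0.
    by apply: mulr_ge0 => //; apply: mulr_ge0 => //; exact: powR_ge0.
  rewrite -E -!mulrA ler_wpM2l// ler_wpM2l// mulrA.
  rewrite -[leLHS]mul1r ler_wpM2r ?invr_ge0 ?(ltW dx)//.
  rewrite powRN mulrC ler_pdivlMr ?powR_gt0 ?divr_gt0// mul1r.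
  by rewrite powR_le// ltW// divr_gt0.
have dx2 : d x < 2 * d x by lra.
have [s Ss xs] := edist_lt S0 dx2.
have M1 : 0 <= M * (3 * d x) `^ nu by rewrite mulr_ge0// powR_ge0.
apply: le_trans (F_bound i (a := g s) nSx M1 _) _.
  move=> y xy; have [h1 _ h3] := weight_in S0 xy.
  have yd : d y < del by lra.
  apply: le_trans (G_near ((side xy).1 Ux) yd Ss) _; rewrite ler_wpM2l// powR_le ?enorm_ge0//.
  have : enorm (y - s) <= enorm (y - x) + enorm (x - s) by exact: enorm_triangle.
  by rewrite [enorm (y - x)]enormBC; lra.
rewrite /A mulrDr mulrDl -[leLHS]addr0; apply: lerD; last first.
  apply: mulr_ge0; last exact: powR_ge0.
  by apply: mulr_ge0 => //; apply: mulr_ge0 => //; exact: powR_ge0.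
rewrite powRM ?(ltW dx)// -E.
by rewrite le_eqVlt; apply/orP; left; apply/eqP; ring.
Qed.

Let mF i : measurable_fun setT (F i).
Proof.
have m1 : measurable_fun setT (fun _ : 'rV[R]_n => 1 : R) by exact: measurable_cst.
have B1 (y : 'rV[R]_n) : `|1 : R| <= 1 by rewrite normr1.
have mW := continuous_measurable_row (continuous_wsum S0 m1 B1).
rewrite (_ : F i = fun x => (dwsum S i G x * wtotal S x - wsum S G x * dwtotal S i x) *
    (wtotal S x ^+ 2) `^ (-1)); last first.
  by apply/funext => x; rewrite powR_inv1// sqr_ge0.
have mdG : measurable_fun setT (dwsum S i G).
  by apply: continuous_measurable_row; exact: (@continuous_dwsum R n S S0 G B mG GB i).
have md1 : measurable_fun setT (dwtotal S i).
  by apply: continuous_measurable_row; exact: (@continuous_dwsum R n S S0 (fun=> 1) 1 m1 B1 i).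
have mwG : measurable_fun setT (wsum S G).
  by apply: continuous_measurable_row; exact: (@continuous_wsum R n S S0 G B mG GB).
apply: measurable_funM.
  by apply: measurable_funB; apply: measurable_funM.
apply: (@measurableT_comp _ _ _ _ _ _ (@powR R ^~ (-1)) _ (fun x => wtotal S x ^+ 2)).
  exact: measurable_powR.
exact: measurable_funX.
Qed.

Let h x := \1_D x * d x `^ (- p).

Let ih : mu.-integrable setT (EFin \o h).
Proof.
have md : measurable_fun setT (fun x => d x `^ (- p)).
  apply: (@measurableT_comp _ _ _ _ _ _ (@powR R ^~ (- p)) _ (fun x => d x)).
    exact: measurable_powR.
  by apply: continuous_measurable_row; exact: continuous_edist.
have iD : mu.-integrable D (EFin \o (fun x => d x `^ (- p))).
  apply/integrableP; split.
    by apply/measurable_EFinP; exact: measurable_funTS.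
  rewrite (eq_integral (fun x => (d x `^ (- p))%:E)); first exact: pD.
  by move=> x _; rewrite gee0_abs// lee_fin powR_ge0.
move/(integrable_mkcond _ mD) : iD; congr (mu.-integrable _ _).
apply/funext => x; rewrite /= patchE /h indicE.
by case: ifPn => _; rewrite ?mul1r ?mul0r.
Qed.

(** Put c = d^(nu - 1). Either c <= t, or c = c^(1 - q) c^q <= t^(1 - q) c^q because q >= 1. For nu
    < 1 the choice of q makes c^q = d^(-p); for nu = 1 one has c^q = 1, absorbed by the summand 1,
    and any q > n would do. *)
Let interpolation t x : 0 < t -> 0 < d x ->
  d x `^ (nu - 1) <= t + t `^ (1 - (if nu == 1 then n.+1%:R else p / (1 - nu))) * (1 + d x `^ (-
    p)).
Proof.
move=> t0 dx; set q := (if _ then _ else _).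
have c0 : 0 < d x `^ (nu - 1) by rewrite powR_gt0.
have w0 : 0 <= 1 + d x `^ (- p) by rewrite addr_ge0 ?powR_ge0.
have [ct|tc] := leP (d x `^ (nu - 1)) t.
  by rewrite (le_trans ct)// lerDl mulr_ge0// powR_ge0.
have n1 : 1 <= n%:R :> R by rewrite ler1n.
have nu1' : 0 <= 1 - nu by rewrite subr_ge0.
have q1 : 1 - q <= 0.
  rewrite /q; case: (eqVneq nu 1) => [_|nun]; first by rewrite -natr1; lra.
  have nuP : 0 < 1 - nu by rewrite lt_neqAle nu1' andbT eq_sym subr_eq0 eq_sym.
  rewrite subr_le0 ler_pdivlMr// mul1r (le_trans _ (ltW np))//.
  by rewrite ler_peMl.
have cq : (d x `^ (nu - 1)) `^ q <= 1 + d x `^ (- p).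
  rewrite /q; case: (eqVneq nu 1) => [->|nun].
    by rewrite subrr powRr0 powR1 lerDl powR_ge0.
  rewrite -powRrM (_ : (nu - 1) * _ = - p) ?lerDr//; field.
  by rewrite subr_eq0 eq_sym.
have -> : d x `^ (nu - 1) = (d x `^ (nu - 1)) `^ (1 - q) * (d x `^ (nu - 1)) `^ q.
  by rewrite -powRD ?(gt_eqF c0) ?implybT// subrK powRr1// ltW.
rewrite -[leLHS]add0r; apply: lerD; first exact: ltW.
by apply: ler_pM; rewrite ?powR_ge0// powR_neg_le// ltW.
Qed.

Let iF i : interpolable (F i).
Proof.
(* The indicator of a cube that contains the support of [F i] stands for the summand 1 of
   [interpolation], which is not integrable on the whole space. *)
pose w x := \1_(cube 0 N) x + h x.
have h0 x : 0 <= h x by rewrite mulr_ge0// powR_ge0.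
have w0 x : 0 <= w x by rewrite addr_ge0.
have iw : mu.-integrable setT (EFin \o w).
  have := integrableD measurableT (integrable_cube 0 1 N) ih; congr (mu.-integrable _ _).
  by apply/funext => x; rewrite /= mul1r.
pose q : R := if nu == 1 then n.+1%:R else p / (1 - nu).
have Fw t x : 0 < t -> `|F i x| <= A * (t + t `^ (1 - q) * w x).
  move=> t0; have rhs0 : 0 <= A * (t + t `^ (1 - q) * w x).
    by rewrite mulr_ge0// addr_ge0 ?(ltW t0)// mulr_ge0// powR_ge0.
  have [Ux|nUx] := pselect (U x); last by rewrite F0 ?normr0//; left.
  have [xd|xd] := leP (2 * del) (d x); first by rewrite F0 ?normr0//; right.
  have xN : x \in cube 0 N.
    rewrite mem_set//; apply: cube_enorm; rewrite sub0r enormN leNgt.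
    by apply/negP => /far; rewrite leNgt xd.
  have dx := edist_gt0 S0 cS (US Ux).
  rewrite (le_trans (F_le i Ux))// ler_wpM2l// /w /h !indicE xN (mem_set (UD Ux xd)) mul1r.
  exact: interpolation.
split; last first.
  exists w, A, q; split => //.
  rewrite /q; case: (eqVneq nu 1) => [_|nun]; first by rewrite ltr_nat.
  by rewrite ltr_pdivlMr// lt_neqAle subr_ge0 nu1 andbT eq_sym subr_eq0 eq_sym.
apply: (@integrable_le _ _ _ (fun x => A * (\1_(cube 0 N) x + w x))) => //.
  move=> x; have [xN|xN] := boolP (x \in cube 0 N).
    apply: le_trans (Fw 1 x ltr01) _.
    by rewrite powR1 mul1r indicE xN.
  have -> : F i x = 0.
    apply: F0; right; apply: far.
    rewrite ltNge; apply/negP => xN'; move: xN; rewrite notin_setE; apply.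
    by apply: cube_enorm; rewrite sub0r enormN.
  by rewrite normr0 mulr_ge0// addr_ge0.
have i1 : mu.-integrable setT (EFin \o (fun x => \1_(cube 0 N) x + w x)).
  have := integrableD measurableT (integrable_cube 0 1 N) iw; congr (mu.-integrable _ _).
  by apply/funext => x; rewrite /= mul1r.
by have := integrableZl measurableT A i1; congr (mu.-integrable _ _).
Qed.

(** Deleting the data at distance less than e = d(x0) / 8 from S makes the averages vanish where d <
    e / 2, so they become C^1 across S with bounded derivatives. Nothing changes where d >= 2 e, in
    particular within 2 e of x0. *)
Let test_function x0 : ~ S x0 -> exists (f : 'rV[R]_n -> R) (df : 'I_n -> 'rV[R]_n -> R) (C N r :
  R),
    [/\ continuous f, forall z, `|f z| <= C & forall z, N < enorm z -> f z = 0] /\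
    [/\ forall i, continuous (df i), forall i z, is_derive z (std_vec R i) f (df i z),
      forall i z, `|df i z| <= C & forall i z, N < enorm z -> df i z = 0] /\
    [/\ 0 < r, forall y, enorm (x0 - y) < r -> f y = u y &
       forall i y, enorm (x0 - y) < r -> df i y = F i y].
Proof.
move=> Sx0; have dx0 := edist_gt0 S0 cS Sx0.
pose e := d x0 / 8; have e0 : 0 < e by rewrite divr_gt0.
pose G1 y := G y * \1_[set y | e <= d y] y.
have mG1 : measurable_fun setT G1.
  apply: measurable_funM => //; apply: measurable_indic.
  rewrite (_ : [set y | _] = ~` ((fun y => d y) @^-1` [set t | t < e])); last first.
    by apply/seteqP; split => y /=; [move=> ey; apply/negP; rewrite -leNgt|move/negP; rewrite
      -leNgt].
  apply: measurableC; apply: open_measurable_row.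
  by apply: open_comp; [move=> x _; exact: continuous_edist|exact: open_lt].
have G1B y : `|G1 y| <= B.
  rewrite normrM -[leRHS]mulr1; apply: ler_pM => //.
  by rewrite indicE; case: (_ \in _); rewrite ?normr1 ?normr0.
have G1near x : d x < e / 2 -> forall y, 2 * enorm (x - y) < d y -> G1 y = 0.
  move=> xe y xy; have [h1 _ _] := weight_in S0 xy.
  rewrite /G1 indicE memNset ?mulr0//= => ey; move: ey; apply/negP; rewrite -ltNge; lra.
have G1far x : N < enorm x -> forall y, 2 * enorm (x - y) < d y -> G1 y = 0.
  by move=> /far xN y xy; rewrite /G1 (out (or_intror xN) xy) mul0r.
have G1in x : 2 * e <= d x -> forall y, 2 * enorm (x - y) < d y -> G1 y = G y.
  move=> ex y xy; have [_ h2 _] := weight_in S0 xy.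
  rewrite /G1 indicE mem_set ?mulr1//=; lra.
have nearS x : S x -> d x < e / 2 by move=> Sx; rewrite (edist0 S0 Sx) divr_gt0.
have farS x : e / 2 <= d x -> ~ S x by move=> xe /nearS; rewrite ltNge xe.
have small x y : d x < e / 2 -> enorm (x - y) < e / 2 - d x -> d y < e / 2.
  by move=> xe xy; have := edistD S0 y x; rewrite [enorm (y - x)]enormBC; lra.
have f0 x : d x < e / 2 -> wavg S G1 x = 0 by move=> /G1near; exact: wavg_eq0.
have df0 i x : d x < e / 2 -> dwavg S i G1 x = 0 by move=> /G1near; exact: dwavg_eq0.
have local_cont (k : 'rV[R]_n -> R) : (forall x, d x < e / 2 -> k x = 0) ->
    (forall x, ~ S x -> {for x, continuous k}) -> continuous k.
  move=> k0 kc x; have [xe|/farS] := ltP (d x) (e / 2); last exact: kc.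
  apply/continuous_enormP => t t0; exists (e / 2 - d x); first by rewrite subr_gt0.
  by move=> y xy; rewrite !k0 ?subrr ?normr0//; exact: small xy.
have [c [c0 cb]] : exists c : R, 0 <= c /\ forall i x, ~ S x -> `|dwavg S i G1 x| <= c * B / d x.
  exists (@davg_const R n); split; first exact: davg_const_ge0.
  move=> i x xS; apply: (dwavg_bound n0 S0 cS i (a := 0) mG1 G1B xS B0) => y _.
  by rewrite subr0.
have cB0 : 0 <= c * B by exact: mulr_ge0.
pose C : R := B + c * B / (e / 2).
have C1 : 0 <= c * B / (e / 2) by apply: divr_ge0 => //; rewrite divr_ge0 ?(ltW e0).
have C0 : 0 <= C by exact: addr_ge0.
exists (wavg S G1), (fun i => dwavg S i G1), C, N, (2 * e); split; [split|split; split] => //.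
- apply: local_cont => // x Sx; exact: (continuous_wavg n0 S0 cS mG1 G1B Sx).
- move=> x; have [xe|/farS xS] := ltP (d x) (e / 2); first by rewrite f0// normr0.
  have : `|wavg S G1 x - 0| <= B.
    by apply: (wavg_bound n0 S0 cS mG1 G1B xS) => y _; rewrite subr0.
  by rewrite subr0 => /le_trans; apply; rewrite /C lerDl.
- by move=> x /G1far; exact: wavg_eq0.
- move=> i; apply: local_cont => // x; first exact: df0.
  by move=> Sx; exact: (continuous_dwavg n0 S0 cS mG1 G1B Sx).
- move=> i x; have [xe|/farS xS] := ltP (d x) (e / 2); last first.
    exact: (is_derive_wavg n0 S0 cS mG1 G1B i xS).
  have nf : \near x, cst 0 x = wavg S G1 x.
    apply/nbhs_enormP; exists (e / 2 - d x); first by rewrite subr_gt0.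
    by move=> y xy; rewrite f0//; exact: small xy.
  by rewrite df0//; exact: near_eq_is_derive nf (is_derive_cst 0 x (std_vec R i)).
- move=> i x; have [xe|xe] := ltP (d x) (e / 2); first by rewrite df0// normr0.
  have xS := farS _ xe.
  apply: le_trans (cb i x xS) _; rewrite -[leLHS]add0r /C; apply: lerD => //.
  rewrite ler_wpM2l//.
  by rewrite lef_pV2 ?posrE ?divr_gt0// (edist_gt0 S0 cS xS).
- by move=> i x /G1far; exact: dwavg_eq0.
- by rewrite mulr_gt0.
- move=> y xy; have ey : 2 * e <= d y.
    by have := edistD S0 x0 y; move: xy; rewrite /e; lra.
  by have [-> _] := wavg_ext S0 (G1in _ ey).
- move=> i y xy; have ey : 2 * e <= d y.
    by have := edistD S0 x0 y; move: xy; rewrite /e; lra.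
  by have [_ ->] := wavg_ext S0 (G1in _ ey).
Qed.

Let u_continuous x : U x -> {for x, continuous u}.
Proof. by move=> /US Sx; exact: (continuous_wavg n0 S0 cS mG GB Sx). Qed.

(** [w] completes u by g on S, so its continuity says that g is the boundary value of u from [U]. As
    u vanishes on [V] and v is continuous everywhere, u - v has jump g. *)
Theorem scalar_jump : exists (u w : 'rV[R]_n -> R) (v : 'rV[R]_n -> Cl),
  [/\ (forall x, V x -> u x = 0) /\ (exists N, forall x, N < enorm x -> u x = 0),
     (forall x, U x -> w x = u x) /\ (forall s, S s -> w s = g s),
     {within U `|` S, continuous w},
     continuous v /\ v x @[x --> @at_infinity R n] --> 0 &
     monogenic (~` S) (fun x => (u x)%:A - v x)].
Proof.
have [v [cv vi vm]] := @cauchy_correction R n n2 S u F N iF (fun i y yN => F0 i (or_intror (far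
  yN))) test_function.
pose w x : R := if `[<S x>] then g x else u x.
have wS s : S s -> w s = g s by move=> Ss; rewrite /w asboolT.
have wU x : U x -> w x = u x by move=> /US Sx; rewrite /w asboolF.
exists u, w, v; split => //.
  split; first by move=> x Vx; apply: u0; left => Ux; exact: UV0 Ux Vx.
  by exists N => x /far xN; apply: u0; right.
apply: within_continuous_enorm => x [Ux|Sx] e e0.
  have [r r0 rE] := (continuous_enormP u x).1 (u_continuous Ux) e e0.
  have /nbhs_enormP[r' r'0 r'U] : nbhs x U by exact: open_nbhs_nbhs.
  exists (Num.min r r'); first by rewrite lt_min r0.
  move=> y _; rewrite lt_min => /andP[yr /r'U Uy].
  by rewrite !wU//; exact: rE.
have M1 : 0 < M + 1 by rewrite ltr_wpDl.
have [r r0 rE] := powR_small nu0 (divr_gt0 e0 M1).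
exists (Num.min (r / 2) (del / 2)); first by rewrite lt_min !divr_gt0.
move=> y yUS; rewrite lt_min => /andP[yr yd]; rewrite (wS x Sx) distrC.
have yr2 : 2 * enorm (x - y) < r by rewrite mulrC -ltr_pdivlMr.
have e2 : 0 <= 2 * enorm (x - y) by rewrite mulr_ge0// enorm_ge0.
have bound : `|w y - g x| <= M * (2 * enorm (x - y)) `^ nu.
  case: yUS => [Uy|Sy].
    by rewrite wU// enormBC; apply: u_near => //; rewrite enormBC.
  rewrite wS//; apply: le_trans (gM Sy Sx) _; rewrite ler_wpM2l// enormBC powR_le ?enorm_ge0//.
  by rewrite mulr_natl mulr2n lerDl enorm_ge0.
apply: le_lt_trans bound _; have := rE _ e2 yr2; rewrite ltr_pdivlMr// => h1.
apply: le_lt_trans h1; rewrite mulrC ler_wpM2l ?powR_ge0//.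
by rewrite lerDl.
Qed.

End ScalarJump.

(** * From real to Clifford-valued data *)

Section CliffordRight.
Context {R : realType} {n : nat}.
Local Notation Cl := (clifford R n).
Implicit Types (z a : Cl) (A : {set 'I_n}) (f : 'rV[R]_n -> Cl).

Lemma clifford_decomposition z : z = \sum_A coord A z *: cliff_basis R A.
Proof.
have coord_sum (r : seq {set 'I_n}) (F : {set 'I_n} -> Cl) B :
    coord B (\sum_(A <- r) F A) = \sum_(A <- r) coord B (F A).
  elim: r => [|A r IHr]; last by rewrite !big_cons coordD IHr.
  by rewrite !big_nil /coord ffunE.
apply: coordP => B; rewrite coord_sum (bigD1 B)//= big1 => [|A /negPf AB].
  by rewrite coordZ Defs.coord_basis eqxx mulr1 addr0.
by rewrite coordZ Defs.coord_basis eq_sym AB mulr0.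
Qed.

Lemma coordB A z a : coord A (z - a) = coord A z - coord A a.
Proof. by rewrite coordD -scaleN1r coordZ mulN1r. Qed.

Lemma norm_coord_le A z : `|coord A z| <= `|z|.
Proof.
rewrite cliff_normE -[leLHS]sqrtr_sqr; apply: ler_wsqrtr; rewrite (bigD1 A)//= lerDl.
by apply: sumr_ge0 => B _; exact: sqr_ge0.
Qed.

(** Right multiplication is linear in z and each coordinate of z is at most |z|, so C can be read
    off the basis elements. This gives the continuity of the product in its left factor. *)
Lemma norm_mulr_le a : exists2 C, 0 <= C & forall z, `|z * a| <= C * `|z|.
Proof.
exists (\sum_A `|cliff_basis R A * a|); first by apply: sumr_ge0.
move=> z; rewrite [in leLHS](clifford_decomposition z) mulr_suml.
rewrite (le_trans (ler_norm_sum _ _ _))// mulr_suml; apply: ler_sum => A _.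
by rewrite -scalerAl normrZ mulrC ler_wpM2l// norm_coord_le.
Qed.

Lemma cvg_mulr_clifford (T : Type) (F : set_system T) (FF : Filter F) (f : T -> Cl) z a :
  f x @[x --> F] --> z -> f x * a @[x --> F] --> z * a.
Proof.
move=> fz; have [C C0 aC] := norm_mulr_le a.
apply/cvgrPdist_lt => e e0; have C1 : 0 < C + 1 by rewrite ltr_wpDl.
move/cvgrPdist_lt : fz => /(_ _ (divr_gt0 e0 C1)); apply: filterS => x.
rewrite ltr_pdivlMr// => fx; rewrite -mulrBl (le_lt_trans (aC _))//.
by rewrite mulrC (le_lt_trans _ fx)// ler_wpM2l// lerDl.
Qed.

Lemma is_derive_mulr_clifford f a x v df :
  is_derive x v f df -> is_derive x v (fun y => f y * a) (df * a).
Proof.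
move=> [fd <-].
have cvgf : h^-1 *: (((fun y => f y * a) \o shift x) (h *: v) - f x * a) @[h --> 0^'] --> 'D_v f
  x * a.
  under eq_fun do rewrite /= -mulrBl scalerAl.
  exact: cvg_mulr_clifford.
by split; [apply/cvg_ex; eexists; exact: cvgf|exact/cvg_lim].
Qed.

(** The Dirac operator multiplies from the left and so, by associativity, commutes with right
    multiplication by constants: left monogenic functions form a right module over the algebra. *)
Lemma monogenic_sum_mulr (S : set 'rV[R]_n) (f : {set 'I_n} -> 'rV[R]_n -> Cl)
    (a : {set 'I_n} -> Cl) (c : Cl) : closed S ->
  (forall A, monogenic (~` S) (f A)) ->
  monogenic (~` S) (fun x => \sum_A f A x * a A + c).
Proof.
move=> cS fm; apply: monogenic_is_derive => x0 Sx0.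
exists (fun i x => \sum_A 'D_(std_vec R i) (f A) x * a A); split.
- have : nbhs x0 (~` S) by apply: open_nbhs_nbhs; split => //; exact: closed_openC.
  apply: filterS => y Sy i.
  have D A : is_derive y (std_vec R i) (fun y => f A y * a A) ('D_(std_vec R i) (f A) y * a A).
    apply: is_derive_mulr_clifford; apply: derivableP.
    exact: ((fm A).1 i y Sy).1.
  rewrite -[\sum_A _]addr0.
  rewrite (_ : (fun x => _) = (fun x => \sum_A f A x * a A) + cst c)//.
  apply: is_deriveD.
  elim: (index_enum _) => [|A r IHr].
    rewrite big_nil (_ : (fun x => _) = cst 0); first exact: is_derive_cst.
    by apply/funext => x; rewrite big_nil.
  rewrite big_cons (_ : (fun x => _) = (fun x => f A x * a A) + (fun x => \sum_(A <- r) f A x * a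
    A)).
    exact: is_deriveD.
  by apply/funext => x; rewrite big_cons.
- move=> i; apply: continuous_sum_clifford => A.
  apply: (@cvg_mulr_clifford _ (nbhs x0)).
  exact: ((fm A).1 i x0 Sx0).2.
under eq_bigr do rewrite mulr_sumr.
rewrite exchange_big big1//= => A _; under eq_bigr do rewrite mulrA.
rewrite -mulr_suml; have := (fm A).2 x0 Sx0.
by rewrite /dirac_op => ->; rewrite mul0r.
Qed.

End CliffordRight.

Section CliffordJump.
Context {R : realType} {n : nat}.
Local Notation Cl := (clifford R n).
Local Notation mu := (lebesgue_row R n).

(** Stated for a pair of sides so that Omega can take either role. Each coordinate of g is solved by
    [scalar_jump] and multiplied on the right by its basis element; adding the constant c sets the
    value at infinity. *)
Lemma clifford_jump (S U V : set 'rV[R]_n) (g : 'rV[R]_n -> Cl) (N0 M nu del p : R)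
    (D : set 'rV[R]_n) (c : Cl) :
  (2 <= n)%N -> S !=set0 -> closed S -> open U -> open V ->
  (forall x, U x -> V x -> False) -> (forall x, ~ S x -> U x \/ V x) ->
  (forall x, U x -> ~ S x) ->
  (forall s, S s -> enorm s <= N0) -> 0 <= M -> 0 < nu -> nu <= 1 ->
  (forall x y, S x -> S y -> `|g x - g y| <= M * enorm (x - y) `^ nu) ->
  0 < del -> measurable D -> (forall x, U x -> edist x S < 2 * del -> D x) ->
  n%:R * (1 - nu) < p -> (dist_integral S p D < +oo)%E ->
  exists Psi PsiU PsiV : 'rV[R]_n -> Cl,
    [/\ monogenic (~` S) Psi,
      {in U, PsiU =1 Psi} /\ {within U `|` S, continuous PsiU},
      {in V, PsiV =1 Psi} /\ {within V `|` S, continuous PsiV},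
      forall x, S x -> PsiU x - PsiV x = g x
    & Psi x @[x --> @at_infinity R n] --> c].
Proof.
move=> n2 S0 cS oU oV UV0 UVS US SN M0 nu0 nu1 gM del0 mD UD np pD.
have gAM A x y : S x -> S y ->
    `|coord A (g x) - coord A (g y)| <= M * enorm (x - y) `^ nu.
  by move=> Sx Sy; rewrite -coordB (le_trans (norm_coord_le _ _))// gM.
have /choice[u Hu] : forall A : {set 'I_n}, exists u : 'rV[R]_n -> R, exists (w : 'rV[R]_n -> R)
  (v : 'rV[R]_n -> Cl),
  [/\ (forall x, V x -> u x = 0) /\ (exists N, forall x, N < enorm x -> u x = 0),
     (forall x, U x -> w x = u x) /\ (forall s, S s -> w s = coord A (g s)),
     {within U `|` S, continuous w},
     continuous v /\ v x @[x --> @at_infinity R n] --> 0 &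
     monogenic (~` S) (fun x => (u x)%:A - v x)].
  move=> A; exact: (@scalar_jump R n n2 S U V S0 cS oU oV UV0 UVS US N0 SN _ M nu M0 nu0 nu1 (gAM
    A) del D p del0 mD UD np pD).
have /choice[w Hw] := Hu; have {Hw}/choice[v Hv] := Hw.
exists (fun x => \sum_A ((u A x)%:A - v A x) * cliff_basis R A + c),
  (fun x => \sum_A ((w A x)%:A - v A x) * cliff_basis R A + c),
  (fun x => \sum_A (- v A x) * cliff_basis R A + c); split.
- by apply: monogenic_sum_mulr => // A; have [_ _ _ _] := Hv A.
- split.
    move=> x /set_mem Ux; congr (_ + _); apply: eq_bigr => A _.
    by have [_ [-> //]] := Hv A.
  apply/subspace_continuousP => x USx; apply: cvgD; last exact: cvg_cst.
  apply: cvg_sum_clifford => A; apply: cvg_mulr_clifford.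
  have [_ _ /subspace_continuousP wc [vc _] _] := Hv A.
  apply: cvgB; first by apply: cvgZr_tmp; exact: wc.
  by apply: cvg_trans (vc x); apply: cvg_app; exact: cvg_within.
- split.
    move=> x /set_mem Vx; congr (_ + _); apply: eq_bigr => A _.
    by have [[-> // _] _ _ _ _] := Hv A; rewrite scale0r sub0r.
  apply: continuous_subspaceT => x; apply: (@cvgD _ _ _ (nbhs x)); last exact: (@cvg_cst _ _ _
    (nbhs x)).
  apply: (@cvg_sum_clifford R n _ (nbhs x) _) => A; apply: (@cvg_mulr_clifford _ _ _ (nbhs x)).
  by have [_ _ _ [vc _] _] := Hv A; apply: (@cvgN _ _ _ (nbhs x)); exact: vc.
- move=> x Sx; rewrite opprD addrACA subrr addr0 -sumrB.
  rewrite [RHS]clifford_decomposition; apply: eq_bigr => A _.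
  have [_ [_ ws] _ _ _] := Hv A.
  by rewrite -mulrBl opprK subrK ws// -scalerAl mul1r.
- have L A : ((u A x)%:A - v A x) * cliff_basis R A @[x --> @at_infinity R n] --> (0 : Cl).
    have [[_ [N uN]] _ _ [_ vi] _] := Hv A.
    rewrite -(mul0r (cliff_basis R A)); apply: cvg_mulr_clifford.
    rewrite -[0]subr0; apply: cvgB => //; apply: cvg_near_cst.
    by exists N => // x /= /uN ->; rewrite scale0r.
  have := cvgD (cvg_sum_clifford _ L) (cvg_cst c).
  by rewrite big1_eq add0r; apply.
Qed.

End CliffordJump.

(** * The exponent and the boundary of a Jordan domain *)

Lemma integrability_exponent_gt (R : realType) n (S D : set 'rV[R]_n) (t : R) :
  (t%:E < integrability_exponent S D)%E ->
  exists2 p, t < p & (dist_integral S p D < +oo)%E.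
Proof.
by move=> /ereal_sup_gt[_ [p pD <-]]; rewrite lte_fin => tp; exists p.
Qed.

Lemma jordan_domain_boundary (R : realType) n (Omega S : set 'rV[R]_n) :
  jordan_domain Omega S -> Omega `|` S = closure Omega /\ (forall x, Omega x -> ~ S x).
Proof.
move=> [_ oO _ _ <-]; rewrite ((interior_id _).1 oO); split; last by move=> x Ox [].
by rewrite setDUK//; exact: subset_closure.
Qed.

(** If S were empty, Omega would be closed as well as open; following segments, it would be all of
    R^n, which is unbounded for n >= 1. *)
Lemma jordan_boundary_nonempty (R : realType) n (Omega S : set 'rV[R]_n) :
  (0 < n)%N -> jordan_domain Omega S -> S !=set0.
Proof.
move=> n0 jO; have [OS _] := jordan_domain_boundary jO.
move: jO => [[y Oy] oO _ [M [_ OM]] _].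
apply: contrapT => S0.
have nS z : ~ S z by move=> Sz; apply: S0; exists z.
have OO x : Omega x.
  apply: (@segment_same_side _ _ S Omega (~` Omega)) Oy => //.
  - rewrite openC; rewrite (_ : Omega = closure Omega); first exact: closed_closure.
    by rewrite -OS; apply/seteqP; split => [z|z []//]; [left|move=> /nS].
  - by move=> z _; have [|] := pselect (Omega z); [left|right].
(* Its sup norm is at least |M| + 2, while [bounded_set] bounds [Omega] by every number above M, in
   particular by |M| + 1. *)
pose z : 'rV[R]_n := const_mx (`|M| + 2).
have Mz : `|z| <= `|M| + 1 by apply: OM => //; rewrite (le_lt_trans (ler_norm M))// ltrDl.
have := le_trans (ler_coord_norm z (Ordinal n0)) Mz; rewrite mxE ger0_norm ?addr_ge0//.
by rewrite lerD2l; apply/negP; rewrite -ltNge ltrDl.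
Qed.

Unset Implicit Arguments.

Theorem theorem7 (R : realType) (n : nat) (hn : (2 <= n)%N)
  (S Omega : set 'rV[R]_n)
  (hcompact : compact S) (hsurf : topological_hypersurface S)
  (hOmega : jordan_domain Omega S)
  (r : R) (hr : forall x, S x -> enorm x < r)
  (nu : R) (hnu0 : 0 < nu) (hnu1 : nu <= 1)
  (g : 'rV[R]_n -> clifford R n) (hg : holder S nu g)
  (hm : (1 - marcinkiewicz Omega S r / n%:R%:E < nu%:E)%E)
  (c : clifford R n) :
  additive_jump_solvable Omega S g c.
Proof.
have n0 : (0 < n)%N by exact: ltnW.
have n0' : 0 < n%:R :> R by rewrite ltr0n.
have S0 := jordan_boundary_nonempty n0 hOmega.
have [OS OnS] := jordan_domain_boundary hOmega.
have oO : open Omega by case: hOmega.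
have cS : closed S by apply: compact_closed hcompact; exact: norm_hausdorff.
have oE : open (exterior Omega S).
  by rewrite /exterior OS openC; exact: closed_closure.
have [s0 /set_mem Ss0 smax] : exists2 s, s \in S & forall t, t \in S -> enorm t <= enorm s.
  by apply: compact_EVT_max => //; apply: continuous_subspaceT; exact: continuous_enorm.
have SN s : S s -> enorm s <= enorm s0 by move=> /mem_set; exact: smax.
have [M0 gM0] := hg.
have gM x y : S x -> S y -> `|g x - g y| <= `|M0| * enorm (x - y) `^ nu.
  by move=> Sx Sy; rewrite (le_trans (gM0 x y Sx Sy))// ler_wpM2r ?powR_ge0// ler_norm.
(* This is [hm] solved for the exponent. The value +oo is immediate, and -oo would make the left
   side of [hm] equal to +oo. *)
have hm' : ((n%:R * (1 - nu))%:E < marcinkiewicz Omega S r)%E.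
  move: hm; case: (marcinkiewicz _ _ _) => [m| |]; rewrite inver gt_eqF//.
  - by rewrite -EFinM -EFinB !lte_fin ltrBlDr -ltrBlDl ltr_pdivlMr// [_ * n%:R]mulrC.
  - by move=> _; rewrite ltry.
  - by rewrite gt0_mulNye ?lte_fin ?invr_gt0.
have OE x : Omega x -> exterior Omega S x -> False by move=> Ox; apply; left.
have OES x : ~ S x -> Omega x \/ exterior Omega S x.
  by move=> nSx; have [|nO] := pselect (Omega x); [left|right => -[]].
have EnS x : exterior Omega S x -> ~ S x by move=> Ex Sx; apply: Ex; right.
(* The term of the maximum that exceeds n (1 - nu) selects the side into which g is extended. For
   Omega the whole domain serves as [D], with [del] = 1. *)
move: hm'; rewrite /marcinkiewicz lt_max => /orP[] /integrability_exponent_gt[p np pD].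
  have mO : measurable Omega by exact: open_measurable_row.
  have [Phi [Phip [Phim [H1 [H2 H3] [H4 H5] H6 H7]]]] :=
    clifford_jump c hn S0 cS oO oE OE OES OnS SN (normr_ge0 M0) hnu0 hnu1 gM
      ltr01 mO (fun x Ox _ => Ox) np pD.
  by exists Phi, Phip, Phim.
(* [s0] is a point of S of largest norm, so points within 2 [del] = r - |s0| of S have norm below r:
   the exterior layer stays in the ball that defines the exponent. *)
pose del := (r - enorm s0) / 2.
have del0 : 0 < del by rewrite divr_gt0// subr_gt0 hr.
pose D := exterior Omega S `&` [set x | enorm x < r].
have mD : measurable D.
  apply: open_measurable_row; apply: openI => //.
  rewrite (_ : [set x | _] = (@enorm R n) @^-1` [set t | t < r])//.
  by apply: open_comp; [move=> x _; exact: continuous_enorm|exact: open_lt].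
have ED x : exterior Omega S x -> edist x S < 2 * del -> D x.
  move=> Ex /(edist_lt S0)[s Ss xs]; split => //=.
  have : enorm x <= enorm (x - s) + enorm s by rewrite (le_trans _ (enormD _ _))// subrK.
  by have := SN s Ss; move: xs; rewrite /del; lra.
(* With the exterior as first side, [clifford_jump] prescribes the exterior boundary value minus the
   interior one; it is therefore applied to - g. *)
have gM' x y : S x -> S y -> `|- g x - - g y| <= `|M0| * enorm (x - y) `^ nu.
  by move=> Sx Sy; rewrite -opprD normrN; exact: gM.
have EO x : exterior Omega S x -> Omega x -> False by move=> Ex Ox; exact: OE Ox Ex.
have EOS x : ~ S x -> exterior Omega S x \/ Omega x by move=> /OES[]; [right|left].
have [Phi [Phim [Phip [H1 [H2 H3] [H4 H5] H6 H7]]]] :=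
  clifford_jump c hn S0 cS oE oO EO EOS EnS SN (normr_ge0 M0) hnu0 hnu1 gM'
    del0 mD ED np pD.
exists Phi, Phip, Phim; split => //.
by move=> x Sx; rewrite -opprB H6// opprK.
Qed.
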